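(* The derivability problem in $!\mathbf{L}^*$ for sequents in which $!$ is applied only to variables (given such a sequent $\Pi \to C$, decide whether it is derivable in $!\mathbf{L}^*$) is decidable and belongs to the class $\mathrm{NP}$, i.e., can be resolved by a nondeterministic polynomial-time algorithm.
   Context: Fix a countably infinite set $\mathrm{Var}=\{p,q,r,\ldots\}$ of variables (primitive types). Formulae of $!\mathbf{L}^*$ are built from variables using the binary connectives $/$ and $\backslash$ and the unary connective $!$. Sequents are expressions $\Pi \to A$, where $A$ is a formula and $\Pi$ is a finite, possibly empty, linearly ordered sequence of formulae. Below $A,B,C$ (possibly with indices) range over formulae and capital Greek letters over finite, possibly empty, sequences of formulae. The calculus $!\mathbf{L}^*$ has the axioms $A \to A$ and the following rules (there is no cut rule and no weakening rule): - $(/\to)$: from $\Gamma \to A$ and $\Delta_1, B, \Delta_2 \to C$ infer $\Delta_1, B/A, \Gamma, \Delta_2 \to C$. - $(\to/)$: from $\Gamma, A \to B$ infer $\Gamma \to B/A$. - $(\backslash\to)$: from $\Gamma \to A$ and $\Delta_1, B, \Delta_2 \to C$ infer $\Delta_1, \Gamma, A\backslash B, \Delta_2 \to C$. - $(\to\backslash)$: from $A, \Gamma \to B$ infer $\Gamma \to A\backslash B$. - $(!\to)$: from $\Gamma_1, A, \Gamma_2 \to C$ infer $\Gamma_1, !A, \Gamma_2 \to C$. - $(\to !)$: from $!A_1,\ldots,!A_n \to B$ infer $!A_1,\ldots,!A_n \to {!}B$. - $(\mathrm{perm}_1)$: from $\Delta_1, !A, \Gamma, \Delta_2 \to C$ infer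 $\Delta_1, \Gamma, !A, \Delta_2 \to C$. - $(\mathrm{perm}_2)$: from $\Delta_1, \Gamma, !A, \Delta_2 \to C$ infer $\Delta_1, !A, \Gamma, \Delta_2 \to C$. - $(\mathrm{contr})$: from $\Delta_1, !A, !A, \Delta_2 \to C$ infer $\Delta_1, !A, \Delta_2 \to C$. ''$!$ is applied only to variables'' means that every subformula of the form $!A$ occurring in the sequent has $A \in \mathrm{Var}$. The size of a formula is the total number of its variable and connective occurrences ($|p|=1$ for $p\in\mathrm{Var}$, $|A\backslash B|=|B/A|=|A|+|B|+1$, $|!A|=|A|+1$), and the size of a sequent $A_1,\ldots,A_n\to B$ is $|A_1|+\cdots+|A_n|+|B|$. *)

(* Defs.v *)
(* MathComp world. *)
From HB Require Import structures.
From Corelib Require Import BinNums.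
From mathcomp Require Import all_boot all_order all_algebra.

Set Implicit Arguments.
Unset Strict Implicit.
Unset Printing Implicit Defensive.

(* [Over B A] is B / A and [Under A B] is A \ B: the denominator is [A] in     *)
(* both.                                                                      *)
Inductive formula : Type :=
| Var of nat
| Over of formula & formula
| Under of formula & formula
| Bang of formula.

Inductive derivable : seq formula -> formula -> Prop :=
| d_ax A :
    derivable [:: A] A
| d_over_l G A D1 B D2 C :
    derivable G A -> derivable (D1 ++ [:: B] ++ D2) C ->
    derivable (D1 ++ [:: Over B A] ++ G ++ D2) C
| d_over_r G A B :
    derivable (G ++ [:: A]) B ->
    derivable G (Over B A)
| d_under_l G A D1 B D2 C :
    derivable G A -> derivable (D1 ++ [:: B] ++ D2) C ->
    derivable (D1 ++ G ++ [:: Under A B] ++ D2) C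
| d_under_r G A B :
    derivable ([:: A] ++ G) B ->
    derivable G (Under A B)
| d_bang_l G1 A G2 C :
    derivable (G1 ++ [:: A] ++ G2) C ->
    derivable (G1 ++ [:: Bang A] ++ G2) C
| d_bang_r As B :
    derivable (map Bang As) B ->
    derivable (map Bang As) (Bang B)
| d_perm1 D1 A G D2 C :
    derivable (D1 ++ [:: Bang A] ++ G ++ D2) C ->
    derivable (D1 ++ G ++ [:: Bang A] ++ D2) C
| d_perm2 D1 G A D2 C :
    derivable (D1 ++ G ++ [:: Bang A] ++ D2) C ->
    derivable (D1 ++ [:: Bang A] ++ G ++ D2) C
| d_contr D1 A D2 C :
    derivable (D1 ++ [:: Bang A; Bang A] ++ D2) C ->
    derivable (D1 ++ [:: Bang A] ++ D2) C.

Fixpoint bang_only_vars (A : formula) : bool :=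
  match A with
  | Var _ => true
  | Over B C | Under B C => bang_only_vars B && bang_only_vars C
  | Bang (Var _) => true
  | Bang _ => false
  end.

(* Sequents as words over a finite alphabet: formulae in Polish notation, a   *)
(* variable being [TVar] followed by the binary digits of its index, least    *)
(* significant digit first, with no digit at all for index 0.                 *)
Inductive token : Type :=
  TVar | TDigit of bool | TOver | TUnder | TBang | TArrow.

Definition ord_of_token (t : token) : 'I_7 :=
  inord match t with
        | TVar => 0 | TDigit b => b.+1 | TOver => 3
        | TUnder => 4 | TBang => 5 | TArrow => 6
        end.

Definition token_of_ord (i : 'I_7) : token :=
  match val i with
  | 0 => TVar | 1 => TDigit false | 2 => TDigit true | 3 => TOver
  | 4 => TUnder | 5 => TBang | _ => TArrow
  end.

Lemma ord_of_tokenK : cancel ord_of_token token_of_ord.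
Proof. by case=> [|[]||||]; rewrite /token_of_ord /= inordK. Qed.

HB.instance Definition _ := Finite.copy token (can_type ord_of_tokenK).

Fixpoint pos_digits (p : positive) : seq bool :=
  match p with
  | xH => [:: true]
  | xO p => false :: pos_digits p
  | xI p => true :: pos_digits p
  end.

Definition nat_digits (n : nat) : seq bool :=
  if bin_of_nat n is Npos p then pos_digits p else [::].

Fixpoint encode_formula (A : formula) : seq token :=
  match A with
  | Var n => TVar :: map TDigit (nat_digits n)
  | Over B A => TOver :: encode_formula B ++ encode_formula A
  | Under A B => TUnder :: encode_formula A ++ encode_formula B
  | Bang A => TBang :: encode_formula A
  end.

Definition encode_sequent (Pi : seq formula) (C : formula) : seq token :=
  flatten (map encode_formula Pi) ++ TArrow :: encode_formula C.

Definition derivability_problem (w : seq token) : Prop :=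
  exists (Pi : seq formula) (C : formula),
    [/\ all bang_only_vars Pi && bang_only_vars C,
        derivable Pi C &
        w = encode_sequent Pi C].

Lemma pos_digits_inj : injective pos_digits.
Proof.
have nz p : pos_digits p <> [::] by case: p.
elim=> [p IH|p IH|] [q|q|] //= [] => [/IH->|/nz|/IH->|/esym/nz] //.
Qed.

Lemma nat_digits_inj : injective nat_digits.
Proof.
move=> m n; rewrite /nat_digits => E; apply: (can_inj bin_of_natK).
case: (bin_of_nat m) (bin_of_nat n) E => [|p] [|q] //; first by case: q.
  by case: p.
by move/pos_digits_inj->.
Qed.

Definition no_digit_head (s : seq token) : bool :=
  if s is TDigit _ :: _ then false else true.

Lemma digits_cat_inj (u v : seq bool) (s t : seq token) :
  no_digit_head s -> no_digit_head t ->
  map TDigit u ++ s = map TDigit v ++ t -> u = v /\ s = t.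
Proof.
move=> hs ht; elim: u v => [|a u IH] [|b v] //=.
- by move=> E; rewrite E in hs.
- by move=> E; rewrite -E in ht.
by case=> -> /IH[-> ->].
Qed.

Lemma no_digit_head_formula (A : formula) (s : seq token) :
  no_digit_head (encode_formula A ++ s).
Proof. by case: A. Qed.

Lemma encode_formula_cat_inj (A B : formula) (s t : seq token) :
  no_digit_head s -> no_digit_head t ->
  encode_formula A ++ s = encode_formula B ++ t -> A = B /\ s = t.
Proof.
elim: A B s t => [m|A1 IH1 A2 IH2|A1 IH1 A2 IH2|A IH] [n|B1 B2|B1 B2|B] //=
  s t hs ht [].
- by move/(digits_cat_inj hs ht)=> [/nat_digits_inj-> ->].
- rewrite -!catA => /IH1[||->] //; try exact: no_digit_head_formula.
  by move/IH2=> [||-> ->].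
- rewrite -!catA => /IH1[||->] //; try exact: no_digit_head_formula.
  by move/IH2=> [||-> ->].
by move/IH=> [||-> ->].
Qed.

Lemma encode_sequent_inj (Pi Pi' : seq formula) (C C' : formula) :
  encode_sequent Pi C = encode_sequent Pi' C' -> Pi = Pi' /\ C = C'.
Proof.
rewrite /encode_sequent.
have nd P : no_digit_head (flatten (map encode_formula P) ++ TArrow :: encode_formula C).
  by case: P => //= A P; rewrite -catA no_digit_head_formula.
have nd' P : no_digit_head (flatten (map encode_formula P) ++ TArrow :: encode_formula C').
  by case: P => //= A P; rewrite -catA no_digit_head_formula.
elim: Pi Pi' => [|A Pi IH] [|B Pi'] /=.
- move=> [E]; split=> //.
  by have [] := @encode_formula_cat_inj C C' [::] [::] isT isT; rewrite ?cats0.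
- by case: B.
- by case: A.
rewrite -!catA => /encode_formula_cat_inj[] //.
by move=> -> /IH[-> ->].
Qed.

(* Nondeterministic multitape Turing machines.  The tapes are infinite in     *)
(* both directions; tape [ord0] initially holds the input, with the head on   *)
(* its first letter, and the other tapes are blank.                           *)
Inductive move : Type := MLeft | MStay | MRight.

Definition ord_of_move (m : move) : 'I_3 :=
  inord match m with MLeft => 0 | MStay => 1 | MRight => 2 end.

Definition move_of_ord (i : 'I_3) : move :=
  match val i with 0 => MLeft | 1 => MStay | _ => MRight end.

Lemma ord_of_moveK : cancel ord_of_move move_of_ord.
Proof. by case; rewrite /move_of_ord /= inordK. Qed.

HB.instance Definition _ := Finite.copy move (can_type ord_of_moveK).

(* A tape cell is blank ([None]), or holds an input letter ([Some (inl _)])   *)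
(* or a work symbol of the machine ([Some (inr _)]).                          *)
Definition cell (Sigma work : finType) : finType := option (Sigma + work).

Record machine (Sigma : finType) : Type := Machine {
  work : finType;
  state : finType;
  ntapes : nat; (* number of tapes other than the input tape *)
  start : state;
  accepting : {set state};
  delta : state -> {ffun 'I_ntapes.+1 -> cell Sigma work} ->
          {set state * {ffun 'I_ntapes.+1 -> cell Sigma work * move}}
}.

(* The cells to the left of the head, nearest first; the scanned cell; the    *)
(* cells to its right, nearest first. Cells outside the lists are blank.      *)
Record tape (S : Type) : Type := Tape {
  left_cells : seq (option S);
  scanned : option S;
  right_cells : seq (option S)
}.

Definition act (S : Type) (a : option S * move) (t : tape S) : tape S :=
  let l := left_cells t in
  let c := a.1 in
  let r := right_cells t in
  match a.2 with
  | MLeft => Tape (behead l) (head None l) (c :: r)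
  | MStay => Tape l c r
  | MRight => Tape (c :: l) (head None r) (behead r)
  end.

Definition word_tape (S : Type) (w : seq S) : tape S :=
  Tape [::] (ohead w) (map Some (behead w)).

Definition config (Sigma : finType) (M : machine Sigma) : Type :=
  (state M * {ffun 'I_(ntapes M).+1 -> tape (Sigma + work M)})%type.

Definition init (Sigma : finType) (M : machine Sigma) (w : seq Sigma) :
    config M :=
  (start M, [ffun i => word_tape (if i == ord0 then map inl w else [::])]).

Definition moves (Sigma : finType) (M : machine Sigma) (c : config M) :=
  delta c.1 [ffun i => scanned (c.2 i)].

Definition step (Sigma : finType) (M : machine Sigma) (c c' : config M) :
    Prop :=
  exists2 a, a \in moves c & c' = (a.1, [ffun i => act (a.2 i) (c.2 i)]).

Fixpoint nsteps (Sigma : finType) (M : machine Sigma) (n : nat)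
    (c c' : config M) : Prop :=
  if n is n'.+1 then exists2 d, step c d & nsteps n' d c' else c = c'.

Definition halts_within (Sigma : finType) (M : machine Sigma)
    (w : seq Sigma) (t : nat) : Prop :=
  forall (n : nat) (c : config M), nsteps n (init M w) c -> n <= t.

Definition accepts (Sigma : finType) (M : machine Sigma) (w : seq Sigma) :
    Prop :=
  exists (n : nat) (c : config M),
    [/\ nsteps n (init M w) c, moves c = set0 & c.1 \in accepting M].

Definition deterministic (Sigma : finType) (M : machine Sigma) : Prop :=
  forall q r, #|@delta _ M q r| <= 1.

Definition TM_decidable (Sigma : finType) (L : seq Sigma -> Prop) : Prop :=
  exists2 M : machine Sigma, deterministic M &
    forall w : seq Sigma,
      (exists t : nat, halts_within M w t) /\ (accepts M w <-> L w).

Definition in_NP (Sigma : finType) (L : seq Sigma -> Prop) : Prop :=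
  exists (M : machine Sigma) (p : {poly nat}),
    forall w : seq Sigma,
      halts_within M w p.[size w]%R /\ (accepts M w <-> L w).

(* Main.v *)
From HB Require Import structures.
From Corelib Require Import BinNums.
Require Import Defs.
From mathcomp Require Import all_boot all_order all_algebra.
From mathcomp Require Import zify.

(* Read a sequent [A1, ..., An -> C] as the cyclic word [-A1 ... -An +C] of    *)
(* signed formulas. On such words the four rules for the divisions become     *)
(* two, one unary and one binary, and when [!] is applied to variables only,  *)
(* the rules for [!] shrink to axioms [!p -> p], [!p -> !p] and the moves and *)
(* contractions of negative [!p].                                             *)
(*                                                                            *)
(* Short derivations: as there is no weakening, a derivable sequent with [w]  *)
(* connectives has at most [w + 1] formulas on the left, and every binary     *)
(* rule adds a connective. So the divisions contribute at most [w] rules, the *)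
(* contractions linearly many, and the moves become polynomially many once    *)
(* the banged variables are kept in front.                                    *)
(*                                                                            *)
(* Membership in NP: a machine guesses a cyclic derivation, keeping on one    *)
(* stack the words derived so far, and compares the last one with the input.  *)
(* An odometer with polynomial period stops all its runs.                     *)
(*                                                                            *)
(* Decidability: as all its runs are bounded, the machine is simulated by a   *)
(* deterministic one that explores its choices depth first and records on an  *)
(* extra tape what is needed to undo them.                                    *)

Set Implicit Arguments.
Unset Strict Implicit.
Unset Printing Implicit Defensive.

(** * A cyclic calculus of signed formulas *)

(** Derivable sequents of this fragment have derivations of polynomial size, and a machine can guess
    and check one.

    The bound on the size rests on the absence of weakening: a derivable [G -> C] has at most
    [weight G C + 1] formulae on the left, where the weight counts divisions. Hence promotion
    degenerates: its premise [!A1, ..., !An -> p] has weight zero, so it can only be [!p -> p], and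
    promotion yields just the axiom [!p -> !p] ([derivable_var], [cheap_bang_r]). Dereliction is
    absorbed by the axioms ([derelicts_cyclic]). Permutations disappear when the banged variables
    are gathered in front and treated as a multiset. A contraction is paid for by a potential that
    drops with the number of banged variables; the potential is bounded through the weight, to which
    each division rule contributes once. The predicate [cheap] packs these invariants,
    [derivable_cheap] proves them by induction on derivations, [derivable_provable] extracts a cubic
    bound on the number of rules, and [cyclic_sound] is the converse.

    The machine is compiled by [prog_machine] from a nondeterministic program on stacks: the
    finitely many residuals of the program are the control states, and a clock of [d] tapes,
    counting in base [size w + 1], stops every run. Programs are analysed twice: [spec] says that
    every run is sound, [run] exhibits a run of known cost. These meet in [main_sound] and
    [main_complete].

    Since all runs are bounded, a depth-first search over the choices always halts, and it can be
    done deterministically ([halting_TM_decidable]). *)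

Notation item := (bool * formula)%type.

Definition pos (A : formula) : item := (true, A).
Definition neg (A : formula) : item := (false, A).

Definition banged (b : bool) (A : formula) : formula := if b then Bang A else A.

(** The argument [B] is always the left operand in print, be it numerator or denominator. With this
    order the two divisions differ only by the signs [o] and [~~ o] of the operands in the rules,
    and the Polish code is the division token followed by the codes of [B] and [A]. *)
Definition division (o : bool) (A B : formula) : formula :=
  if o then Over B A else Under B A.

(* Up to rotation, [s] has one positive formula, its conclusion; [n] counts    *)
(* the rules and [v] bounds the lengths of the variables.                     *)
Inductive cyclic (v : nat) : nat -> seq item -> Prop :=
| cyclic_ax (p : nat) (b c : bool) :
    c ==> b -> size (nat_digits p) <= v ->
    cyclic v 1 [:: neg (banged b (Var p)); pos (banged c (Var p))]
| cyclic_rot n x s : cyclic v n (x :: s) -> cyclic v n.+1 (rcons s x)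
| cyclic_swap n A x s :
    cyclic v n [:: neg (Bang A), x & s] ->
    cyclic v n.+1 [:: x, neg (Bang A) & s]
| cyclic_contr n A s :
    cyclic v n [:: neg (Bang A), neg (Bang A) & s] ->
    cyclic v n.+1 (neg (Bang A) :: s)
| cyclic_par n o A B s :
    cyclic v n [:: (~~ o, A), (o, B) & s] ->
    cyclic v n.+1 (pos (division o A B) :: s)
| cyclic_tens m n o A B s t :
    cyclic v m ((o, A) :: s) -> cyclic v n ((~~ o, B) :: t) ->
    cyclic v (m + n).+1 (neg (division o A B) :: s ++ t).

Lemma derivable_banged b c p :
  c ==> b -> derivable [:: banged b (Var p)] (banged c (Var p)).
Proof.
have D := d_bang_l (G1 := [::]) (G2 := [::]) (d_ax (Var p)).
by case: b; case: c => // _; apply: d_ax.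
Qed.

(** Every rule keeps exactly one positive formula, and the antecedent is read off cyclically from
    the letter after it, whence [s2 ++ s1]. A rotation therefore leaves the sequent unchanged. *)
Lemma cyclic_sound v n s : cyclic v n s ->
  exists s1 s2 C, s = map neg s1 ++ pos C :: map neg s2 /\ derivable (s2 ++ s1) C.
Proof.
elim=> {n s}
  [p b c bc _|n x s _ [[|y s1] [s2 [C [[-> ->] D]]]]
  |n A x s _ [[|B [|y s1]] [s2 [C [E D]]]]
  |n A s _ [[|B [|B' s1]] [s2 [C [E D]]]]
  |n o A B s _ [s1 [s2 [C [E D]]]]
  |m n o A B s t _ [s1 [s2 [C [E D]]]] _ [s3 [s4 [C' [E' D']]]]].
- exists [:: banged b (Var p)], [::], (banged c (Var p)).
  by split=> //; apply: derivable_banged.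
- exists s2, [::], C; split; last by rewrite cats0 in D *.
  by rewrite -cats1.
- exists s1, (s2 ++ [:: y]), C; split; last by rewrite -catA.
  by rewrite map_cat -cats1 -catA.
- by case: E.
(* Here [x] is the conclusion, so the banged formula passes from the end of the antecedent to its
   beginning. *)
- case: E => EB -> ->; exists [::], (Bang A :: s2), C; split=> //.
  subst B; have:= @d_perm2 [::] s2 A [::] C D; by rewrite !cats0.
- case: E => EB -> ->; subst B; exists (y :: Bang A :: s1), s2, C.
  split=> //; exact: (d_perm1 (G := [:: y]) D).
- by case: E.
- by case: E.
- case: E => EB EB' ->; subst B B'; exists (Bang A :: s1), s2, C.
  split=> //; exact: (d_contr D).
- case: o E; case: s1 D => [|D0 s1] D //=.
  + case: s1 D => [|D1 s1] D //= [] EA EB ->; subst D0 C.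
    exists [::], s2, (Over B A); split=> //; rewrite cats0.
    exact: d_over_r.
  + case=> EA; case: s2 D => [|D1 s2] D //= [] EB ->; subst C D1.
    exists [::], s2, (Under B A); split=> //.
    by rewrite cats0; apply: d_under_r; rewrite cats0 in D.
(* A premise with a positive first letter has its conclusion there; one with a negative first letter
   has it in the context. The other combinations are absurd. *)
case: o E E'; case: s1 D => [|D0 s1] D //=; case: s3 D' => [|D3 s3] D' //=.
- case=> EA -> [EB ->]; subst C D3; rewrite cats0 in D.
  exists (Over B A :: s2 ++ s3), s4, C'.
  rewrite /= !map_cat -!catA; split=> //.
  exact: d_over_l.
- case=> EA -> [EB ->]; subst C' D0; rewrite cats0 in D'.
  exists (Under B A :: s1), (s2 ++ s4), C.
  rewrite /= !map_cat -!catA /=; split=> //.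
  exact: d_under_l.
Qed.

(** The axioms concern variables, bare or banged, and no rule introduces [Bang]. So the machine need
    not check separately that its input lies in the fragment. *)
Lemma cyclic_bang_only v n s :
  cyclic v n s -> all (fun x => bang_only_vars x.2) s.
Proof.
elim=> {n s} [p b c _ _|n x s _|n A x s _|n A s _|n o A B s _|m n o A B s t _].
- by case: b; case: c.
- by rewrite all_rcons.
- by rewrite /= andbCA.
- by rewrite /= andbA andbb.
- by case: o => /=; rewrite andbA // [_ A && _]andbC.
by rewrite /= all_cat => /andP[HA ->] _ /andP[HB ->]; case: o; rewrite /= HA HB.
Qed.

(** * Completeness with polynomially many rules *)

(** Only divisions count, so that dereliction and promotion leave the weight of a sequent
    unchanged. *)
Fixpoint connectives (A : formula) : nat :=
  match A with
  | Var _ => 0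
  | Over B C | Under B C => (connectives B + connectives C).+1
  | Bang B => connectives B
  end.

Section Admissible.
Variable v : nat.

Fixpoint admissible (A : formula) : bool :=
  match A with
  | Var p | Bang (Var p) => size (nat_digits p) <= v
  | Over B C | Under B C => admissible B && admissible C
  | Bang _ => false
  end.

End Admissible.

Definition is_bang (A : formula) : bool := if A is Bang _ then true else false.

Definition bangvar (A : formula) : option nat :=
  if A is Bang (Var p) then Some p else None.

Definition bangvars (G : seq formula) : seq nat := pmap bangvar G.

Definition nonbang (G : seq formula) : seq formula :=
  filter (predC is_bang) G.

Definition total_connectives (G : seq formula) : nat :=
  sumn (map connectives G).

Definition bangs (S : seq nat) : seq formula := [seq Bang (Var p) | p <- S].

Definition provable (v n : nat) (s : seq item) : Prop :=
  exists2 m, m <= n & cyclic v m s.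

(** * Moving and contracting banged formulae at linear cost *)

Section Structural.
Variable v : nat.
Implicit Types (s t u : seq item) (n : nat) (A : formula).

Lemma provable_leq n m s : n <= m -> provable v n s -> provable v m s.
Proof. by move=> nm [k kn D]; exists k => //; apply: leq_trans nm. Qed.

Lemma provable_rot n s t :
  provable v n (s ++ t) -> provable v (n + size s) (t ++ s).
Proof.
elim: s n t => [|x s IH] n t; first by rewrite cats0 addn0.
case=> m mn D; rewrite -cat_rcons addnS -addSn; apply: IH.
exists m.+1 => //; rewrite -rcons_cat; exact: cyclic_rot.
Qed.

(** A swap followed by a rotation sends the neighbour of the banged formula to the far end and
    leaves the banged formula in front: two rules per letter of [s]. *)
Lemma provable_swaps n A s t :
  provable v n (neg (Bang A) :: s ++ t) ->
  provable v (n + 2 * size s) (neg (Bang A) :: t ++ s).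
Proof.
elim: s n t => [|x s IH] n t; first by rewrite cats0 addn0.
case=> m mn D; rewrite -cat_rcons /= mulnS addnA; apply: IH.
exists m.+2; first by rewrite addn2.
have := cyclic_rot (cyclic_swap D); by rewrite /= rcons_cat.
Qed.

Lemma provable_pull n A s t :
  provable v n (s ++ neg (Bang A) :: t) ->
  provable v (n + 2 * size (s ++ t)) (neg (Bang A) :: s ++ t).
Proof.
move/provable_rot=> D; have := @provable_swaps _ A t s D.
by apply: provable_leq; rewrite size_cat; lia.
Qed.

Lemma provable_push n A s t :
  provable v n (neg (Bang A) :: s ++ t) ->
  provable v (n + 2 * (size (s ++ t)).+1) (s ++ neg (Bang A) :: t).
Proof.
move/provable_swaps; rewrite -cat_cons => /provable_rot.
by apply: provable_leq; rewrite size_cat /=; lia.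
Qed.

Lemma provable_tens m n o A B s t :
  provable v m ((o, A) :: s) -> provable v n ((~~ o, B) :: t) ->
  provable v (m + n).+1 (neg (division o A B) :: s ++ t).
Proof.
move=> [k km H] [l ln H']; exists (k + l).+1; first by rewrite ltnS leq_add.
exact: cyclic_tens.
Qed.

Lemma provable_par n o A B s :
  provable v n [:: (~~ o, A), (o, B) & s] ->
  provable v n.+1 (pos (division o A B) :: s).
Proof. by case=> m mn D; exists m.+1 => //; apply: cyclic_par. Qed.

(** The first copy is pulled to the front and rotated to the end, the second is pulled to the front,
    and rotating the rest of the word makes the copies adjacent. *)
Lemma provable_contract n A s t u :
  provable v n (s ++ neg (Bang A) :: t ++ neg (Bang A) :: u) ->
  provable v (n + 5 * (size (s ++ t ++ u)).+2) (neg (Bang A) :: s ++ t ++ u).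
Proof.
move=> H; have {}H := provable_pull H.
have {}H := @provable_rot _ [:: neg (Bang A)] _ H.
have {}H : provable v (n + 2 * (size (s ++ t ++ u)).+1 + 1)
    ((s ++ t) ++ neg (Bang A) :: u ++ [:: neg (Bang A)]).
  move: H; rewrite -!catA /=; apply: provable_leq.
  by rewrite ?size_cat /= ?size_cat; lia.
have := provable_pull H; rewrite !catA -cat_cons => {}H.
have [m mn /cyclic_contr D] := provable_rot H.
exists m.+1; last by move: D; rewrite -?catA.
by move: mn; rewrite ?size_cat /= ?size_cat /=; lia.
Qed.

End Structural.

(** * Dereliction is admissible *)

Definition derelict (x y : item) : Prop :=
  x = y \/ exists p, x = neg (Var p) /\ y = neg (Bang (Var p)).

Fixpoint derelicts (s t : seq item) : Prop :=
  match s, t with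
  | [::], [::] => True
  | x :: s, y :: t => derelict x y /\ derelicts s t
  | _, _ => False
  end.

Lemma derelicts_refl s : derelicts s s.
Proof. by elim: s => //= x s; split=> //; left. Qed.

Lemma derelicts_cat s s' t t' :
  derelicts s s' -> derelicts t t' -> derelicts (s ++ t) (s' ++ t').
Proof. by elim: s s' => [|x s IH] [|x' s'] //= [d /IH H] /H. Qed.

Lemma derelicts_catl s t u : derelicts (s ++ t) u ->
  exists s' t', [/\ u = s' ++ t', derelicts s s' & derelicts t t'].
Proof.
elim: s u => [|x s IH] u /=; first by exists [::], u.
case: u => // y u [d] /IH[s' [t' [-> d1 d2]]].
by exists (y :: s'), t'.
Qed.

Lemma derelict_id x y :
  derelict x y -> (x.1 \/ forall p, x.2 <> Var p) -> y = x.
Proof. by case=> [->|[p [-> _]]] // [|/(_ p)]. Qed.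

(** A bare negative variable is never principal outside the axioms, so its replacement by the banged
    one climbs to the axioms and turns [p -> p] into [!p -> p]. The number of rules does not
    change. *)
Lemma derelicts_cyclic v n s s' :
  cyclic v n s -> derelicts s s' -> cyclic v n s'.
Proof.
move=> D; elim: D s' => {n s}
  [p b c bc pv|n x s _ IH|n A x s _ IH|n A s _ IH|n o A B s _ IH
  |m n o A B s t _ IH1 _ IH2] s'.
- case: s' => [|y [|z [|? ?]]] //= [dy //] [dz //] _.
  rewrite (derelict_id dz) => {dz}; last by left.
  case: dy => [<-|[q [Eq ->]]]; first exact: cyclic_ax.
  case: b bc Eq => //; case: c => // _ [<-].
  exact: (@cyclic_ax _ _ true false).
- rewrite -cats1 => /derelicts_catl[s1 [[|y [|? ?]] [-> d1 //= [d2 //]]]].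
  by move=> _; rewrite cats1; apply/cyclic_rot/IH.
- case: s' => [|x' [|y s']] //= [dx //] [dy ds].
  have Ey : y = neg (Bang A) by apply: derelict_id dy _; right.
  subst y.
  by apply/cyclic_swap/IH.
- case: s' => [|y s'] //= [dy ds].
  have Ey : y = neg (Bang A) by apply: derelict_id dy _; right.
  subst y.
  by apply/cyclic_contr/IH.
- case: s' => [|y s'] //= [dy ds].
  rewrite (derelict_id dy); last by left.
  by apply/cyclic_par/IH; do 2?split=> //; left.
case: s' => [|y s'] //= [dy] /derelicts_catl[s1 [t1 [-> ds dt]]].
rewrite (derelict_id dy); last by right; case: o {IH1 IH2 dy}.
by apply: cyclic_tens; [apply: IH1|apply: IH2]; split=> //; left.
Qed.

(** * Normal forms with the banged variables in front, and their cost *)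

Section Completeness.
Variables (v L : nat).
Implicit Types (G D Pi : seq formula) (A B C : formula) (S : seq nat).

Lemma bangs_cat S S' : bangs (S ++ S') = bangs S ++ bangs S'.
Proof. exact: map_cat. Qed.

Lemma bangvars_cat G D : bangvars (G ++ D) = bangvars G ++ bangvars D.
Proof. exact: pmap_cat. Qed.

Lemma nonbang_cat G D : nonbang (G ++ D) = nonbang G ++ nonbang D.
Proof. exact: filter_cat. Qed.

Lemma bangvars_bangs S : bangvars (bangs S) = S.
Proof. by elim: S => //= p S {2}<-. Qed.

Lemma nonbang_bangs S : nonbang (bangs S) = [::].
Proof. by elim: S. Qed.

Lemma bangvars_nonbang G : bangvars (nonbang G) = [::].
Proof. by elim: G => //= A G; case: A. Qed.

Lemma nonbang_id G : nonbang (nonbang G) = nonbang G.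
Proof. exact: filter_id. Qed.

Lemma size_bangs S : size (bangs S) = size S.
Proof. exact: size_map. Qed.

Definition bangsE := (bangs_cat, bangvars_cat, nonbang_cat, bangvars_bangs,
  nonbang_bangs, bangvars_nonbang, nonbang_id, cats0, cat0s).

Lemma size_bangvars_nonbang G :
  all (admissible v) G -> size (bangvars G) + size (nonbang G) = size G.
Proof.
elim: G => //= A G IH /andP[hA /IH].
by case: A hA => [q|? ?|? ?|[]] //= *; lia.
Qed.

Lemma admissible_bang A : admissible v (Bang A) -> exists p, A = Var p.
Proof. by case: A => // p _; exists p. Qed.

(** [S] collects the banged variables already met and [G] the other formulae already passed. Each
    new banged variable jumps over at most [L] letters, at two rules per letter. *)
Lemma pull_bangs n S G D C :
  all (admissible v) D -> size S + size G + size D < L ->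
  provable v n (map neg (bangs S ++ G ++ D) ++ [:: pos C]) ->
  exists2 S', perm_eq S' (bangvars D ++ S) &
    provable v (n + 2 * L * size D)
      (map neg (bangs S' ++ G ++ nonbang D) ++ [:: pos C]).
Proof.
elim: D n S G => [|A D IH] n S G /=.
  by move=> _ _ H; exists S; rewrite ?muln0 ?addn0.
case/andP=> hA hD szL H.
have [bA|nA] := boolP (is_bang A); last first.
  have [] := IH n S (rcons G A) hD; first by rewrite size_rcons; lia.
    by rewrite -cats1 -!catA.
  move=> S' pS'; rewrite -cats1 -!catA => H'.
  exists S'; first by case: A nA {hA H H'}.
  by apply: provable_leq H'; rewrite leq_add2l leq_mul2l leqnSn orbT.
have [p EA] : exists p, A = Bang (Var p).
  by case: A bA hA {H} => // A _ /admissible_bang[p ->]; exists p.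
subst A => {bA}.
have [] := IH (n + 2 * L) (p :: S) G hD; first by move: szL => /=; lia.
  rewrite catA map_cat -catA /= in H.
  have := provable_pull H; rewrite !map_cat -!catA /=.
  by apply: provable_leq; rewrite !size_cat !size_map /=; lia.
move=> S' pS' H'; exists S'.
  apply: perm_trans pS' _; rewrite perm_sym /=.
  by have := perm_catCA [:: p] (bangvars D) S; rewrite /= => ->.
by apply: provable_leq H'; rewrite mulnS addnA.
Qed.

(** The way back from the gathered word. For each banged variable of [D] some copy is taken out of
    [S] and pushed to its place, each move costing at most [2 * L]. *)
Lemma push_bangs n S G D C :
  all (admissible v) D -> size S + size G + size (nonbang D) < L ->
  perm_eq S (bangvars D) ->
  provable v n (map neg (bangs S ++ G ++ nonbang D) ++ [:: pos C]) ->
  provable v (n + 4 * L * size D) (map neg (G ++ D) ++ [:: pos C]).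
Proof.
elim: D n S G => [|A D IH] n S G /=.
  by move=> _ _ /perm_nilP->; rewrite muln0 addn0.
case/andP=> hA hD szL pS H.
have [bA|nA] := boolP (is_bang A); last first.
  rewrite nA /= in H szL.
  have pS': perm_eq S (bangvars D) by case: A nA pS {H hA szL}.
  have := IH n S (rcons G A) hD _ pS'; rewrite size_rcons -!cats1 -!catA /=.
  move/(_ _ H); rewrite mulnS => H'.
  by apply: (provable_leq _ (H' _)); lia.
rewrite bA /= in H szL.
have [p EA] : exists p, A = Bang (Var p).
  by case: A bA hA {pS H} => // A _ /admissible_bang[p ->]; exists p.
subst A => {bA}; rewrite /= in pS.
have pS1 : p \in S by rewrite (perm_mem pS) mem_head.
case/splitPr: pS1 pS H szL => S1 S2 pS H szL.
rewrite !bangsE -!catA /= map_cat -catA /= in H.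
have {}H := provable_pull H.
have := @provable_push v _ (Var p) (map neg (bangs (S1 ++ S2) ++ G))
  (map neg (nonbang D) ++ [:: pos C]).
rewrite !bangsE !map_cat -!catA in H *; move=> /(_ _ H) {}H.
have := IH _ (S1 ++ S2) (rcons G (Bang (Var p))) hD.
rewrite !bangsE !map_cat map_rcons -!cats1 -!catA /=.
move=> /(_ _ _ _ H) H'; rewrite size_cat /= in szL.
apply: provable_leq (H' _ _).
- by rewrite !size_cat !size_map /=; lia.
- by rewrite !size_cat /=; lia.
rewrite -(perm_cons p); apply: perm_trans pS.
by have := perm_catCA [:: p] S1 S2; rewrite /= => ->.
Qed.

Definition weight G C := total_connectives G + connectives C.

(* The last conjunct is an amortised bound: each left or right rule raises    *)
(* the right-hand side enough to pay for [10 * L * L] further steps, and so   *)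
(* does a contraction or a dereliction, which lowers the measure              *)
(* [size (bangvars G) + 2 * size (nonbang G)].                                *)
Definition cheap G C : Prop :=
  size G <= (weight G C).+1 /\
  exists S n, [/\ perm_eq S (bangvars G),
    provable v n (map neg (bangs S ++ nonbang G) ++ [:: pos C]) &
    n + 10 * L * L * (size (bangvars G) + 2 * size (nonbang G)) <=
      10 * L * L * (5 * weight G C + 3)].

Lemma nonbang_cons A G : ~~ is_bang A -> nonbang (A :: G) = A :: nonbang G.
Proof. by rewrite /nonbang /= => ->. Qed.

Lemma total_connectives_cat G D :
  total_connectives (G ++ D) = total_connectives G + total_connectives D.
Proof. by rewrite /total_connectives map_cat sumn_cat. Qed.

Lemma admissible_bangs G : all (admissible v) G ->
  all (admissible v) (bangs (bangvars G)).
Proof. by elim: G => //= A G IH /andP[]; case: A => // -[]//= p -> /IH. Qed.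

Lemma admissible_perm S G : perm_eq S (bangvars G) ->
  all (admissible v) G -> all (admissible v) (bangs S).
Proof.
by move=> pS /admissible_bangs; rewrite /bangs !all_map (perm_all _ pS).
Qed.

Lemma all_nonbang G : all (admissible v) G -> all (admissible v) (nonbang G).
Proof. by move=> hG; rewrite all_filter; apply: sub_all hG => A /= ->; apply/implyP. Qed.

(** A rule leaves the banged variables scattered; regathering them costs at most [2 * L * L], a term
    that every budget lemma below sets aside. *)
Lemma cheap_intro D G C n :
  all (admissible v) D -> all (admissible v) G ->
  perm_eq (bangvars D) (bangvars G) -> nonbang D = nonbang G ->
  size G <= (weight G C).+1 -> (weight G C).+2 <= L ->
  provable v n (map neg D ++ [:: pos C]) ->
  n + 2 * L * L + 10 * L * L * (size (bangvars G) + 2 * size (nonbang G)) <=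
      10 * L * L * (5 * weight G C + 3) ->
  cheap G C.
Proof.
move=> hD hG pD nD szG wL H le; split=> //.
have szD : size D = size G.
  by rewrite -(size_bangvars_nonbang hD) -(size_bangvars_nonbang hG) nD (perm_size pD).
have [|//|S pS H'] := @pull_bangs n [::] [::] D C hD; first by rewrite szD /=; lia.
exists S, (n + 2 * L * size D); split.
- by apply: perm_trans pS _; rewrite cats0.
- by rewrite -nD.
apply: leq_trans le; rewrite leq_add2r leq_add2l leq_mul2l szD.
by apply/orP; right; lia.
Qed.

(** The division rules want their active formula at the head of the word. If it is not banged, a
    rotation puts it there; if it is [!p], the gathered word has forgotten its position, and any
    copy of [p] in [S] is moved to the place required. *)
Lemma cheap_focus D1 B D2 C :
  all (admissible v) (D1 ++ B :: D2) ->
  (weight (D1 ++ B :: D2) C).+2 <= L ->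
  cheap (D1 ++ B :: D2) C ->
  exists S n, [/\ perm_eq S (bangvars (D1 ++ D2)),
    provable v n (neg B :: map neg (nonbang D2) ++ pos C ::
      map neg (bangs S ++ nonbang D1)) &
    n + 10 * L * L * (size (bangvars (D1 ++ B :: D2)) +
                      2 * size (nonbang (D1 ++ B :: D2))) <=
      10 * L * L * (5 * weight (D1 ++ B :: D2) C + 3) + 5 * L].
Proof.
move=> hD wL [szD [S [n [pS H le]]]].
have szE := size_bangvars_nonbang hD.
have [bB|nB] := boolP (is_bang B); last first.
  exists S, (n + L); split.
  - by apply: perm_trans pS _; rewrite !bangvars_cat; case: B nB {hD szD wL H le szE}.
  - rewrite nonbang_cat (nonbang_cons _ nB) catA map_cat -catA in H.
    have := provable_rot H; rewrite -!catA /=; apply: provable_leq.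
    have szS : size S + size (nonbang (D1 ++ B :: D2)) = size (D1 ++ B :: D2).
      by rewrite (perm_size pS).
    rewrite nonbang_cat !size_cat in szS szD.
    by rewrite !size_map !size_cat size_bangs; lia.
  by lia.
have [p EB] : exists p, B = Bang (Var p).
  have : admissible v B by move: hD; rewrite all_cat /= => /and3P[].
  by case: B bB {hD wL szD pS H le szE} => // A _ /admissible_bang[p ->]; exists p.
subst B => {bB}; rewrite !bangvars_cat /= in pS.
have pS1 : p \in S by rewrite (perm_mem pS) mem_cat mem_head orbT.
have szS : size S + size (nonbang D1 ++ nonbang D2) = size (D1 ++ Bang (Var p) :: D2).
  by rewrite -szE (perm_size pS) bangvars_cat nonbang_cat.
case/splitPr: pS1 pS szS H => S1 S2 pS szS H.
rewrite !bangsE -!catA /= map_cat -catA /= in H.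
have {}H := provable_pull H.
have H2 := @provable_swaps v _ (Var p) (map neg (bangs (S1 ++ S2) ++ nonbang D1))
  (map neg (nonbang D2) ++ [:: pos C]).
rewrite !bangsE !map_cat -!catA in H H2; move/H2: H => {H2}H.
exists (S1 ++ S2), (n + 5 * L); split; last by rewrite addnAC leq_add2r.
- rewrite -(perm_cons p); have := perm_catCA [:: p] S1 S2; rewrite /= => ->.
  apply: perm_trans pS _; rewrite !bangvars_cat perm_sym.
  by have := perm_catCA [:: p] (bangvars D1) (bangvars D2); rewrite /= => ->.
rewrite !bangsE !map_cat -!catA; apply: provable_leq H.
rewrite !size_cat /= in szS szD *.
by rewrite !size_map; lia.
Qed.

(** The new division is worth [50 * L * L], and merging the two constants [3] into one loses
    [30 * L * L]. Of the rest, [10 * L * L] covers the growth of the measure by one, and as much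
    remains for the [10 * L + 2 * L * L] further steps. *)
Lemma budget2 n1 n2 k1 k2 k w1 w2 w :
  1 < L -> k <= k1 + k2 + 1 -> w1 + w2 + 1 <= w ->
  n1 + 10 * L * L * k1 <= 10 * L * L * (5 * w1 + 3) ->
  n2 + 10 * L * L * k2 <= 10 * L * L * (5 * w2 + 3) + 5 * L ->
  n1 + n2 + 5 * L + 2 * L * L + 10 * L * L * k <= 10 * L * L * (5 * w + 3).
Proof.
move=> L1 kk ww.
have LL : 2 * L <= L * L by rewrite leq_mul2r L1 orbT.
rewrite -(mulnA 10 L L) -(mulnA 2 L L); move: (L * L) LL => M LL le1 le2.
have : 10 * M * k <= 10 * M * (k1 + k2 + 1) by rewrite leq_mul2l kk orbT.
have : 10 * M * (5 * (w1 + w2 + 1) + 3) <= 10 * M * (5 * w + 3).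
  by rewrite leq_mul2l leq_add2r leq_mul2l ww !orbT.

lia.
Qed.

Lemma size_nonbang G : size (nonbang G) <= size G.
Proof. by rewrite size_filter count_size. Qed.

(** The lengths of the two antecedents add up, and so do the weights, up to one new division: this
    preserves the bound [weight + 1] on the length. The measure may grow by one, namely when [B] is
    a banged variable, counted once, while the division that replaces it is counted twice. *)
Lemma cheap_left o A B G D1 D2 C :
  let F := if o then Over B A else Under A B in
  let M := if o then F :: G else G ++ [:: F] in
  all (admissible v) (D1 ++ M ++ D2) ->
  (weight (D1 ++ M ++ D2) C).+2 <= L ->
  cheap G A -> cheap (D1 ++ B :: D2) C -> cheap (D1 ++ M ++ D2) C.
Proof.
move=> F M.
have wE : weight G A + weight (D1 ++ B :: D2) C + 1 = weight (D1 ++ M ++ D2) C.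
  rewrite /weight /M /F !total_connectives_cat {F M}; case: o;
  by rewrite ?total_connectives_cat /total_connectives /= ?map_cat ?sumn_cat; lia.
have nF : ~~ is_bang F by rewrite /F; case: (o).
have bF : bangvar F = None by rewrite /F; case: (o).
have szM : size M = (size G).+1 by rewrite /M; case: (o); rewrite ?size_cat ?addn1.
have bM : bangvars M = bangvars G.
  by rewrite /M; case: (o); rewrite ?bangvars_cat /= bF ?cats0.
move=> hD wL [szG [S1 [n1 [pS1 H1 le1]]]] c2.
have [hD1 hF hG hD2]: [/\ all (admissible v) D1, admissible v F,
    all (admissible v) G & all (admissible v) D2].
  move: hD; rewrite /M !all_cat; case: (o); rewrite ?all_cat /= ?andbT -?andbA.
    by case/and4P.
  by case/and4P.
have [hA hB] : admissible v A /\ admissible v B.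
  by move: hF; rewrite /F; case: (o) => /andP[].
have hD' : all (admissible v) (D1 ++ B :: D2) by rewrite all_cat /= hD1 hB.
have szD := c2.1.
have wL2 : (weight (D1 ++ B :: D2) C).+2 <= L by clear -wE wL; lia.
have [S2 [n2 [pS2 H2 le2]]] := cheap_focus hD' wL2 c2.
have szE : size S1 + size (nonbang G) = size G.
  by rewrite (perm_size pS1) size_bangvars_nonbang.
have szE2 : size S2 <= size D1 + size D2.
  rewrite (perm_size pS2) -size_cat -(@size_bangvars_nonbang (D1 ++ D2)) ?leq_addr //.
  by rewrite all_cat hD1.
have szn1 := size_nonbang D1; have szn2 := size_nonbang D2.
rewrite size_cat /= in szD.
have szL : size D1 + size G + size D2 + 2 <= L by clear -szD szG wE wL; lia.
have hS1 := admissible_perm pS1 hG.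
have hS2 : all (admissible v) (bangs S2).
  by apply: admissible_perm pS2 _; rewrite all_cat hD1.
have [hn1 hn2 hnG] := And3 (all_nonbang hD1) (all_nonbang hD2) (all_nonbang hG).
pose N := if o then F :: bangs S1 ++ nonbang G else bangs S1 ++ nonbang G ++ [:: F].
have bN : bangvars N = S1.
  by rewrite /N; case: (o); rewrite /= !bangsE /= bF ?cats0.
(* What the binary rule yields after a rotation, the banged variables of the two premises still
   apart. *)
pose E := bangs S2 ++ nonbang D1 ++ N ++ nonbang D2.
have := provable_rot H1; rewrite /= => {}H1.
apply: (@cheap_intro E _ _ (n1 + n2 + 5 * L)) => //.
- rewrite /E /N; case: (o); do 4?[rewrite ?all_cat /=];
  by rewrite hF hS2 hS1 hn1 hn2 hnG.
- rewrite /E !bangsE bN bM; apply: perm_trans (perm_cat pS2 pS1) _.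
  by rewrite bangvars_cat -catA perm_cat2l perm_catC.
- by rewrite /E /N /M; case: (o); rewrite !(bangsE, nonbang_cons _ nF).
- by rewrite !size_cat szM; clear -szG szD wE; lia.
- have H : provable v (n1 + n2 + 5 * L) (map neg E ++ [:: pos C]).
    rewrite /E /N /F; clear -H1 H2 szL szE szE2 szn1 szn2; case: o H2 => H2.
      have H : provable v (n1 + L + n2).+1
          ((neg (Over B A) :: map neg (bangs S1 ++ nonbang G ++ nonbang D2) ++
          [:: pos C]) ++ map neg (bangs S2 ++ nonbang D1)).
        have := provable_tens (o := true) H1 H2; rewrite !map_cat /= -!catA /=.
        by apply: provable_leq; rewrite size_cat !size_map; lia.
      move/provable_rot: H; rewrite !map_cat /= !map_cat -!catA /= -!catA.
      by apply: provable_leq; rewrite !size_cat /= !size_map; lia.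
    have H : provable v (n2 + (n1 + L)).+1
        ((neg (Under A B) :: map neg (nonbang D2) ++ [:: pos C]) ++
         map neg (bangs S2 ++ nonbang D1 ++ bangs S1 ++ nonbang G)).
      have := provable_tens (o := false) H2 H1; rewrite !map_cat /= -!catA /= -!catA.
      by apply: provable_leq; rewrite size_cat !size_map; lia.
    move/provable_rot: H; rewrite !map_cat /= -!catA /= -?catA.
    by apply: provable_leq; rewrite !size_cat /= !size_map; lia.
  exact: H.
apply: budget2 le1 le2; [by clear -wL wE; lia| |by clear -wE; lia].
rewrite !bangvars_cat !nonbang_cat bM !size_cat.
have -> : size (nonbang M) = (size (nonbang G)).+1.
  by rewrite /M; case: (o); rewrite ?nonbang_cat nonbang_cons // ?size_cat ?addn1.
clear -hB; case: B hB => [?|? ?|? ?|[]] //= *; lia.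
Qed.

(** Introducing [A \ B] requires the positive [B] to be next to the negative [A], but the gathered
    banged variables stand between them. They are sent to the end one by one. *)
Lemma flush_bangs n x S t :
  provable v n (x :: map neg (bangs S) ++ t) ->
  provable v (n + (2 * size (map neg (bangs S) ++ t)).+1 * size S)
    (x :: t ++ map neg (bangs S)).
Proof.
elim: S n t => [|p S IH] n t /=; first by rewrite muln0 addn0 cats0.
move=> H; have {}H := @provable_pull _ _ (Var p) [:: x] _ H.
have := @provable_rot _ _ [:: neg (Bang (Var p))] _ H.
rewrite /= -catA => /IH; rewrite -catA; apply: provable_leq.
by rewrite /= !size_cat /= mulnS; lia.
Qed.

(** The term [3 * L * L] is for [flush_bangs], [10 * L] for the rotations and the rule itself,
    [2 * L * L] for regathering; the new division is worth [50 * L * L]. *)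
Lemma budget1 n k1 k w1 w :
  1 < L -> k <= k1 -> w1 + 1 <= w ->
  n + 10 * L * L * k1 <= 10 * L * L * (5 * w1 + 3) + 5 * L ->
  n + 3 * L * L + 10 * L + 2 * L * L + 10 * L * L * k <=
    10 * L * L * (5 * w + 3).
Proof.
move=> L1 kk ww.
have LL : 2 * L <= L * L by rewrite leq_mul2r L1 orbT.
rewrite -(mulnA 10 L L) -(mulnA 2 L L) -(mulnA 3 L L).
move: (L * L) LL => M LL le1.
have : 10 * M * k <= 10 * M * k1 by rewrite leq_mul2l kk orbT.
have : 10 * M * (5 * (w1 + 1) + 3) <= 10 * M * (5 * w + 3).
  by rewrite leq_mul2l leq_add2r leq_mul2l ww !orbT.
lia.
Qed.

Lemma cheap_right o A B G :
  let F := if o then Over B A else Under A B in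
  all (admissible v) G -> admissible v F -> (weight G F).+2 <= L ->
  cheap (if o then G ++ [:: A] else A :: G) B -> cheap G F.
Proof.
move=> F hG hF wL c.
have [hA hB] : admissible v A /\ admissible v B.
  by move: hF; rewrite /F; case: (o) => /andP[].
pose D1 := if o then G else [::]; pose D2 := if o then [::] else G.
have DE : (if o then G ++ [:: A] else A :: G) = D1 ++ A :: D2.
  by rewrite /D1 /D2; case: (o).
have hD : all (admissible v) (D1 ++ A :: D2).
  by rewrite -DE; case: (o); rewrite ?all_cat /= hA ?andbT.
have GE : D1 ++ D2 = G by rewrite /D1 /D2; case: (o); rewrite ?cats0.
rewrite DE in c; have szD := c.1.
have wE : weight (D1 ++ A :: D2) B + 1 = weight G F.
  by rewrite -GE /weight /F !total_connectives_cat {2}/total_connectives /=; case: (o);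
    rewrite /= /total_connectives; lia.
have wL2 : (weight (D1 ++ A :: D2) B).+2 <= L by lia.
have [S [n [pS H le]]] := cheap_focus hD wL2 c.
rewrite size_cat /= in szD.
have szG : size G = size D1 + size D2 by rewrite -GE size_cat.
have szE : size S + size (nonbang G) = size G.
  by rewrite (perm_size pS) GE size_bangvars_nonbang.
have hS : all (admissible v) (bangs S).
  by apply: admissible_perm pS _; rewrite GE.
have hnG := all_nonbang hG.
rewrite GE in pS.
apply: (@cheap_intro (if o then bangs S ++ nonbang G else nonbang G ++ bangs S)
  _ _ (n + 3 * L * L + 10 * L)) => //.
- by case: (o); rewrite all_cat hS hnG.
- by case: (o); rewrite !bangsE.
- by case: (o); rewrite !bangsE.
- by lia.
- rewrite /F /D1 /D2 in H *; case: (o) H => /= H.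
    have := @provable_rot _ _ [:: _] _ (provable_par (o := true) H).
    by apply: provable_leq => /=; lia.
  rewrite cats0 -cat_cons in H.
  have := provable_rot H; rewrite /= => /flush_bangs /= {}H.
  have := @provable_rot _ _ [:: _] _ (provable_par (o := false) H).
  rewrite map_cat; apply: provable_leq => /=.
  rewrite !size_cat /= !size_map.
  set k := _.+1 * size S; have : k <= 3 * L * L by apply: leq_mul; lia.
  by lia.
apply: budget1 le; [by clear -wL; lia| |by clear -wE; lia].
rewrite -GE !bangvars_cat !nonbang_cat !size_cat.
by clear; case: A => [?|? ?|? ?|[]] /=; lia.
Qed.

Lemma budget0 n m k1 k w :
  1 < L -> k < k1 -> m <= 8 * L ->
  n + 10 * L * L * k1 <= 10 * L * L * (5 * w + 3) ->
  n + m + 2 * L * L + 10 * L * L * k <= 10 * L * L * (5 * w + 3).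
Proof.
move=> L1 kk ww.
have LL : 2 * L <= L * L by rewrite leq_mul2r L1 orbT.
rewrite -(mulnA 10 L L) -(mulnA 2 L L).
move: (L * L) LL => M LL le1.
have : 10 * M * k.+1 <= 10 * M * k1 by rewrite leq_mul2l kk orbT.
lia.
Qed.

(** The rule itself is free by [derelicts_cyclic]. The formula now counts once instead of twice in
    the measure, and the difference pays for moving [!p] to the front. *)
Lemma cheap_derelict p G1 G2 C :
  let A := Bang (Var p) in
  all (admissible v) (G1 ++ A :: G2) -> (weight (G1 ++ A :: G2) C).+2 <= L ->
  cheap (G1 ++ Var p :: G2) C -> cheap (G1 ++ A :: G2) C.
Proof.
move=> A hG wL [szG [S [n [pS [m mn H] le]]]].
have wE : weight (G1 ++ Var p :: G2) C = weight (G1 ++ A :: G2) C.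
  by rewrite /weight !total_connectives_cat /total_connectives.
have hG' : all (admissible v) (G1 ++ Var p :: G2) by rewrite !all_cat /= in hG *.
have hS := admissible_perm pS hG'.
move: (all_nonbang hG') (pS).
rewrite bangvars_cat nonbang_cat all_cat /= -bangvars_cat => /and3P[hn1 hp hn2] pS'.
rewrite wE in szG le.
apply: (@cheap_intro (bangs S ++ nonbang G1 ++ A :: nonbang G2) _ _ (n + 0)) => //.
- by rewrite !all_cat hS hn1 /= hp.
- apply/permP => a; have := permP pS' a.
  by rewrite !bangsE /= !bangsE !count_cat /=; lia.
- by rewrite !bangsE /= -/(nonbang _) !bangsE.
- by rewrite !size_cat /= in szG *.
- exists m; first by rewrite addn0.
  apply: derelicts_cyclic H _; rewrite nonbang_cat !map_cat -!catA.
  do 2!(apply: derelicts_cat; first exact: derelicts_refl).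
  by split; [right; exists p|apply: derelicts_refl].
apply: budget0 le => //; try lia.
by rewrite !bangvars_cat !nonbang_cat !size_cat /=; lia.
Qed.

(** Permutations change none of the data on which [cheap] depends, the banged variables being known
    only up to order; so they cost nothing, however many there are. *)
Lemma cheap_perm G D C :
  perm_eq (bangvars G) (bangvars D) -> nonbang G = nonbang D ->
  size G = size D -> total_connectives G = total_connectives D ->
  cheap G C -> cheap D C.
Proof.
move=> pGD nGD szE tE [szG [S [n [pS H le]]]].
rewrite /cheap /weight -tE -szE -nGD -(perm_size pGD); split=> //.
by exists S, n; split=> //; apply: perm_trans pGD.
Qed.

(** One banged variable less releases [10 * L * L], enough to bring two copies together at cost
    [5 * L] and to regather. *)
Lemma cheap_contr p G1 G2 C :
  let A := Bang (Var p) in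
  all (admissible v) (G1 ++ A :: G2) -> (weight (G1 ++ A :: G2) C).+2 <= L ->
  cheap (G1 ++ A :: A :: G2) C -> cheap (G1 ++ A :: G2) C.
Proof.
move=> A hG wL [szG [S [n [pS H le]]]].
have wE : weight (G1 ++ A :: A :: G2) C = weight (G1 ++ A :: G2) C.
  by rewrite /weight !total_connectives_cat /total_connectives.
have hG' : all (admissible v) (G1 ++ A :: A :: G2).
  by move: hG; rewrite !all_cat /= => /and3P[-> -> ->].
have szE : size S + size (nonbang (G1 ++ A :: A :: G2)) = size (G1 ++ A :: A :: G2).
  by rewrite (perm_size pS) size_bangvars_nonbang.
have hS := admissible_perm pS hG'.
have {hG'} := all_nonbang hG'.
rewrite bangvars_cat nonbang_cat all_cat /= in pS szE H * => /andP[hn1 hn2].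
rewrite wE in szG le.
have pS1 : p \in S by rewrite (perm_mem pS) mem_cat mem_head orbT.
have [S' pS'] : exists S', perm_eq S [:: p, p & S'].
  exists (bangvars G1 ++ bangvars G2); apply: perm_trans pS _.
  by apply/permP => a; rewrite /= !count_cat /=; lia.
have ex2 : exists S1 S2 S3, S = S1 ++ p :: S2 ++ p :: S3.
  case/splitPr: pS1 pS' {pS H hS szE} => S1 S2 pS'.
  have : p \in S1 ++ S2.
    rewrite -has_pred1 has_count.
    by have := permP pS' (pred1 p); rewrite !count_cat /= eqxx; lia.
  rewrite mem_cat => /orP[]/splitPr[T1 T2].
    by exists T1, T2, S2; rewrite -catA.
  by exists S1, T1, T2.
case: ex2 => S1 [S2 [S3 ES]]; subst S.
have szL : (size S1 + size S2 + size S3 + size (nonbang G1) + size (nonbang G2)).+3 <= L.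
  have : size (S1 ++ p :: S2 ++ p :: S3) + size (nonbang G1 ++ nonbang G2) < L.
    by rewrite szE; clear -szG wL; lia.
  by clear; rewrite !size_cat /= size_cat /=; lia.
pose X := bangs S3 ++ nonbang G1 ++ nonbang G2.
have {}H : provable v n (map neg (bangs S1) ++ neg A :: map neg (bangs S2) ++
    neg A :: (map neg X ++ [:: pos C])).
  by move: H; rewrite /X !bangsE /= !bangsE /= !map_cat /= !map_cat /= -!catA /= -!catA.
apply: (@cheap_intro (A :: bangs S1 ++ bangs S2 ++ X) _ _ (n + 5 * L)) => //.
- move: hS; rewrite -cat1s -[p :: S3]cat1s !bangs_cat !all_cat.
  by case/and5P=> h1 h2 h3 _ h4; rewrite -cat1s /X !all_cat h1 h2 h3 h4 hn1.
- apply/permP => a; have := permP pS a.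
  by clear; rewrite /X !(bangsE, count_cat) /= !(bangsE, count_cat) /=; lia.
- by rewrite /X /= !bangsE.
- by move: szG; clear; rewrite !size_cat /=; lia.
- have := provable_contract H; rewrite !map_cat /= -!catA /= map_cat.
  rewrite !map_cat -!catA; apply: provable_leq.
  by move: szL; clear; rewrite !(size_cat, size_map) /=; lia.
apply: budget0 le; [by clear -wL; lia| |by clear; lia].
by clear; rewrite !bangvars_cat !nonbang_cat !size_cat /=; lia.
Qed.

End Completeness.

Definition about (p : nat) (A : formula) : bool :=
  match A with Var q | Bang (Var q) => q == p | _ => false end.

Definition about_some (A : formula) : bool :=
  match A with Var _ | Bang (Var _) => true | _ => false end.

Lemma all_catCA (T : Type) (a : pred T) s t u w :
  all a (s ++ t ++ u ++ w) = all a (s ++ u ++ t ++ w).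
Proof. by rewrite !all_cat [all a t && _]andbCA. Qed.

Lemma all_dup (T : Type) (a : pred T) s x t :
  all a (s ++ [:: x; x] ++ t) = all a (s ++ [:: x] ++ t).
Proof. by rewrite !all_cat /=; case: (a x). Qed.

(** Between such a sequent and the axiom only dereliction, permutation and contraction are possible,
    and none of them brings in another variable or empties the antecedent. *)
Lemma derivable_var G p : derivable G (Var p) -> all about_some G ->
  G <> [::] /\ all (about p) G.
Proof.
move EC: (Var p) => C D; elim: D EC => {G C}
  [A|G A D1 B D2 C _ _ _ _|G A B _ _|G A D1 B D2 C _ _ _ _|G A B _ _
  |G1 A G2 C _ IH|As B _ _|D1 A G D2 C _ IH|D1 G A D2 C _ IH|D1 A D2 C _ IH] EC //.
- by rewrite -EC /= eqxx.
- by rewrite all_cat /= andbF.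
- by rewrite !all_cat /= !andbF.
- rewrite all_cat; case: A IH => [q|? ?|? ?|?] IH /=; rewrite ?andbF //.
  move=> H; have [|_] := IH EC; first by rewrite all_cat.
  rewrite !all_cat /= ?andbT => H2; split; first by case: (G1).
  exact: H2.
- rewrite all_catCA => H; have [_ H'] := IH EC H.
  by rewrite all_catCA; split=> //; case: (D1); case: (G).
- rewrite -all_catCA => H; have [_ H'] := IH EC H.
  by rewrite -all_catCA; split=> //; case: (D1).
rewrite -all_dup => H; have [_ H'] := IH EC H.
by rewrite -all_dup; split=> //; case: (D1).
Qed.

Section Main.
Variables v L : nat.

Lemma cheap_var b c p : c ==> b -> size (nat_digits p) <= v -> 1 < L ->
  cheap v L [:: banged b (Var p)] (banged c (Var p)).
Proof.
move=> bc pv L1.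
have LL : 0 < L * L by rewrite muln_gt0; lia.
split; first by case: (b).
exists (bangvars [:: banged b (Var p)]), 1; split=> //.
  exists 1 => //; have := cyclic_ax bc pv; by case: (b).
rewrite -(mulnA 10 L L); move: (L * L) LL => M M0.
by case: b bc; case: c => //= _; rewrite /weight /total_connectives /=; lia.
Qed.

Lemma cheap_over_l A B G D1 D2 C :
  all (admissible v) (D1 ++ [:: Over B A] ++ G ++ D2) ->
  (weight (D1 ++ [:: Over B A] ++ G ++ D2) C).+2 <= L ->
  cheap v L G A -> cheap v L (D1 ++ [:: B] ++ D2) C ->
  cheap v L (D1 ++ [:: Over B A] ++ G ++ D2) C.
Proof. by move=> *; apply: (@cheap_left v L true A B G). Qed.

Lemma cheap_under_l A B G D1 D2 C :
  all (admissible v) (D1 ++ G ++ [:: Under A B] ++ D2) ->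
  (weight (D1 ++ G ++ [:: Under A B] ++ D2) C).+2 <= L ->
  cheap v L G A -> cheap v L (D1 ++ [:: B] ++ D2) C ->
  cheap v L (D1 ++ G ++ [:: Under A B] ++ D2) C.
Proof. by rewrite (catA G) => *; apply: (@cheap_left v L false A B G). Qed.

(** The cyclic calculus has axioms for variables only, so [A -> A] is expanded along [A]. *)
Lemma cheap_id A : admissible v A -> (weight [:: A] A).+2 <= L ->
  cheap v L [:: A] A.
Proof.
elim: A => [p|B IHB A IHA|A IHA B IHB|[]//= p _] hA wL.
- exact: (@cheap_var false false).
- have [hB hA'] := andP hA; rewrite /weight /total_connectives /= in wL.
  apply: (@cheap_right v L true A B [:: Over B A]); rewrite /= ?andbT //.
  apply: (@cheap_over_l A B [:: A] [::] [::] B) => /=.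
  + by move: hA => /= /andP[-> ->].
  + by rewrite /weight /total_connectives /=; lia.
  + by apply: IHA => //; rewrite /weight /total_connectives /=; lia.
  + by apply: IHB => //; rewrite /weight /total_connectives /=; lia.
- have [hA' hB] := andP hA; rewrite /weight /total_connectives /= in wL.
  apply: (@cheap_right v L false A B [:: Under A B]); rewrite /= ?andbT //.
  apply: (@cheap_under_l A B [:: A] [::] [::] B) => /=.
  + by move: hA => /= /andP[-> ->].
  + by rewrite /weight /total_connectives /=; lia.
  + by apply: IHA => //; rewrite /weight /total_connectives /=; lia.
  + by apply: IHB => //; rewrite /weight /total_connectives /=; lia.
exact: (@cheap_var true true).
Qed.

Lemma weight_cat G D C : weight (G ++ D) C = total_connectives G + weight D C.
Proof. by rewrite /weight total_connectives_cat addnA. Qed.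

Lemma total_connectives1 A : total_connectives [:: A] = connectives A.
Proof. exact: addn0. Qed.

(** With banged variables only, the weight is zero and the length bound leaves at most one formula
    on the left; by [derivable_var] it is [!p]. So promotion produces only the axiom [!p -> !p]. *)
Lemma cheap_bang_r As B : all (admissible v) (map Bang As) ->
  admissible v (Bang B) -> 1 < L -> derivable (map Bang As) B ->
  cheap v L (map Bang As) B -> cheap v L (map Bang As) (Bang B).
Proof.
move=> hAs /admissible_bang[p EB] L1 D [szA _]; subst B.
have cE : total_connectives (map Bang As) = 0.
  elim: As hAs {szA D} => //= A As IH /andP[/admissible_bang[q ->]].
  by rewrite /total_connectives /= => /IH.
rewrite /weight cE /= in szA.
have [|nz aA] := derivable_var D.
  by move: hAs; rewrite !all_map; apply: sub_all => -[?|? ?|? ?|?].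
case: As hAs aA nz szA {D cE} => [|A [|? ?]] //=.
rewrite andbT; case: A => //= q hq; rewrite andbT => /eqP Eq _ _.
by subst q; apply: (@cheap_var true true).
Qed.

Lemma derivable_cheap G C : derivable G C ->
  all (admissible v) G -> admissible v C -> (weight G C).+2 <= L ->
  cheap v L G C.
Proof.
elim=> {G C}
  [A|G A D1 B D2 C _ IHA _ IHB|G A B _ IH|G A D1 B D2 C _ IHA _ IHB|G A B _ IH
  |G1 A G2 C _ IH|As B D IH|D1 A G D2 C _ IH|D1 G A D2 C _ IH|D1 A D2 C _ IH]
  hG hC wL.
- by apply: cheap_id => //; case/andP: hG.
- have [hD1 [hB hA] hG' hD2]: [/\ all (admissible v) D1,
      admissible v B /\ admissible v A, all (admissible v) G &
      all (admissible v) D2].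
    by move: hG; rewrite !all_cat => /and4P[? /andP[/andP[? ?] _] ? ?].
  move: (wL); rewrite !weight_cat total_connectives1 /= => wL'.
  apply: cheap_over_l => //.
    by apply: IHA => //; rewrite /weight; clear -wL'; lia.
  apply: IHB => //; first by rewrite !all_cat hD1 hD2 all_seq1 hB.
  by move: wL'; clear; rewrite !weight_cat total_connectives1; lia.
- have [hB hA] : admissible v B /\ admissible v A by apply/andP.
  apply: (@cheap_right v L true A B G) => //.
  apply: IH => //; first by rewrite all_cat hG all_seq1.
  by move: wL; clear; rewrite /weight total_connectives_cat /total_connectives /=; lia.
- have [hD1 hG' [hA hB] hD2]: [/\ all (admissible v) D1,
      all (admissible v) G, admissible v A /\ admissible v B &
      all (admissible v) D2].
    by move: hG; rewrite !all_cat => /and4P[? ? /andP[/andP[? ?] _] ?].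
  move: (wL); rewrite !weight_cat total_connectives1 /= => wL'.
  apply: cheap_under_l => //.
    by apply: IHA => //; rewrite /weight; clear -wL'; lia.
  apply: IHB => //; first by rewrite !all_cat hD1 hD2 all_seq1 hB.
  by move: wL'; clear; rewrite !weight_cat total_connectives1; lia.
- have [hA hB] : admissible v A /\ admissible v B by apply/andP.
  apply: (@cheap_right v L false A B G) => //.
  apply: IH => //; first by rewrite all_cat all_seq1 hA.
  by move: wL; clear; rewrite /weight /total_connectives /=; lia.
- have [p EA] : exists p, A = Var p.
    by move: hG; rewrite !all_cat => /and3P[_ /andP[/admissible_bang]].
  subst A; apply: cheap_derelict => //; apply: IH => //.
    by move: hG; rewrite !all_cat.
  by move: wL; rewrite !weight_cat !total_connectives1.
- apply: (@cheap_bang_r As B hG hC _ D); first by clear -wL; lia.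
  apply: IH => //.
  by have [p EB] := admissible_bang hC; subst B; move: hC.
- have wE : weight (D1 ++ G ++ [:: Bang A] ++ D2) C =
            weight (D1 ++ [:: Bang A] ++ G ++ D2) C.
    by clear; rewrite !weight_cat !total_connectives1; lia.
  rewrite all_catCA in hG; rewrite wE in wL.
  apply: cheap_perm (IH hG hC wL).
  + by rewrite !bangvars_cat perm_cat2l perm_catCA.
  + by rewrite !nonbang_cat.
  + by clear; rewrite !size_cat; lia.
  by clear; rewrite !total_connectives_cat; lia.
- have wE : weight (D1 ++ G ++ [:: Bang A] ++ D2) C =
            weight (D1 ++ [:: Bang A] ++ G ++ D2) C.
    by clear; rewrite !weight_cat !total_connectives1; lia.
  rewrite -all_catCA in hG; rewrite -wE in wL.
  apply: cheap_perm (IH hG hC wL).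
  + by rewrite !bangvars_cat perm_cat2l perm_catCA.
  + by rewrite !nonbang_cat.
  + by clear; rewrite !size_cat; lia.
  by clear; rewrite !total_connectives_cat; lia.
have [p EA] : exists p, A = Var p.
  by move: hG; rewrite !all_cat => /and3P[_ /andP[/admissible_bang]].
subst A; apply: cheap_contr => //; apply: IH => //; first by rewrite all_dup.
by move: wL; clear; rewrite !weight_cat total_connectives1 /total_connectives /=; lia.
Qed.

(** [push_bangs] restores the order of the antecedent at cost at most [4 * L * L]; dropping the
    potential and bounding [5 * weight G C + 3] by [5 * L] gives the other term. *)
Lemma derivable_provable G C : derivable G C ->
  all (admissible v) G -> admissible v C -> (weight G C).+2 <= L ->
  provable v (10 * L * L * (5 * L) + 4 * L * L) (map neg G ++ [:: pos C]).
Proof.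
move=> D hG hC wL; have [szG [S [n [pS H le]]]] := derivable_cheap D hG hC wL.
have szE : size S + size (nonbang G) = size G.
  by rewrite (perm_size pS) (size_bangvars_nonbang hG).
have := @push_bangs v L n S [::] G C hG _ pS H.
rewrite /= addn0 szE => H'; apply: provable_leq (H' _); last by clear -szG wL; lia.
rewrite leq_add //; last by rewrite leq_mul2l; clear -szG wL; lia.
apply: leq_trans (leq_trans (leq_addr _ _) le) _.
by rewrite leq_mul2l; clear -szG wL; lia.
Qed.

End Main.

(** * Determinization *)

Section Runs.
Variables (Sigma : finType) (M : machine Sigma).
Implicit Types c d : config M.

Lemma nsteps_cat m n c d e :
  nsteps m c d -> nsteps n d e -> nsteps (m + n) c e.
Proof.
elim: m c => [|m IH] c /=; first by move->.
by case=> c1 s /IH H /H; exists c1.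
Qed.

Definition accepts_from c : Prop :=
  exists n d, [/\ nsteps n c d, moves d = set0 & d.1 \in accepting M].

Lemma step_halted c d : moves c = set0 -> ~ step c d.
Proof. by move=> c0 [a]; rewrite c0 inE. Qed.

(** Without choice, every run from [c] is an initial part of the halting one. *)
Lemma deterministic_steps m n c d e : deterministic M ->
  nsteps n c d -> moves d = set0 -> nsteps m c e ->
  m <= n /\ (moves e = set0 -> e = d).
Proof.
move=> det; elim: n c m => [|n IH] c [|m] /=.
- by move=> -> _ ->.
- by move=> -> d0 [e' /(step_halted d0)].
- by case=> d' s _ _ <-; split=> // /step_halted/(_ s).
case=> d1 [a aM d1E] nd d0 [e1 [b bM e1E] ne].
have /set1P/esym Eab : b \in [set a].
  suff -> : [set a] = moves c by [].
  by apply/eqP; rewrite eqEcard sub1set aM cards1 det.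
have Ee : d1 = e1 by rewrite d1E e1E Eab.
by rewrite Ee in nd; have [] := IH _ _ nd d0 ne.
Qed.

Definition next_config c
    (a : state M * {ffun 'I_(ntapes M).+1 -> cell Sigma (work M) * move}) : config M :=
  (a.1, [ffun i => act (a.2 i) (c.2 i)]).

Lemma step_next c a : a \in moves c -> step c (next_config c a).
Proof. by exists a. Qed.

Lemma accepts_from_nsteps n c d : nsteps n c d -> accepts_from d -> accepts_from c.
Proof.
move=> s [m [e [nd e0 ea]]]; exists (n + m), e.
by split=> //; apply: nsteps_cat nd.
Qed.

Lemma accepts_from_step c d : step c d -> accepts_from d -> accepts_from c.
Proof. by move=> s; apply: (@accepts_from_nsteps 1); exists d. Qed.

Lemma accepts_from_inv c : moves c != set0 -> accepts_from c ->
  exists2 a, a \in moves c & accepts_from (next_config c a).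
Proof.
move=> nz [[|n] [d [/= nd d0 da]]]; first by subst d; rewrite d0 eqxx in nz.
by case: nd => d1 [a aM ->] nd; exists a => //; exists n, d.
Qed.

End Runs.

Section Determinize.
Variables (Sigma : finType) (M : machine Sigma).

Local Notation index_ := 'I_(ntapes M).+1.
Local Notation cellM := (cell Sigma (work M)).
Local Notation reading := {ffun index_ -> cellM}.
Local Notation action := (state M * {ffun index_ -> cellM * move})%type.
Local Notation record := (state M * reading * action)%type.
Local Notation cellD := (cell Sigma (work M + record)%type).

Definition lift_cell (x : cellM) : cellD :=
  omap (fun y => match y with inl a => inl a | inr b => inr (inl b) end) x.

Definition lower_cell (x : cellD) : cellM :=
  match x with
  | Some (inl a) => Some (inl a)
  | Some (inr (inl b)) => Some (inr b)
  | _ => None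
  end.

Lemma lift_cellK : cancel lift_cell lower_cell.
Proof. by case=> [[]|]. Qed.

Definition record_cell (x : record) : cellD := Some (inr (inr x)).

Definition opposite (m : move) : move :=
  match m with MLeft => MRight | MStay => MStay | MRight => MLeft end.

(* [inl q]: about to explore from state [q]; [inr (Some x)]: the moves of the *)
(* choice recorded in [x] are undone and its successor is next;               *)
(* [inr None]: backtracking, with the head of the history on the last record. *)
Definition dfs_state : finType := (state M + option record)%type.

Definition with_history (f : index_ -> cellD * move) (h : cellD * move) :
    {ffun 'I_(ntapes M).+2 -> cellD * move} :=
  [ffun i => if unlift ord_max i is Some j then f j else h].

(** When no choice is left, the symbols scanned before the choice are rewritten from [r], because
    undoing the moves does not restore what was overwritten; the record is erased by the blank. *)
Definition dfs_try (q : state M) (r : reading) (acts : seq action) :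
    dfs_state * {ffun 'I_(ntapes M).+2 -> cellD * move} :=
  if acts is a :: _ then
    (inl a.1, with_history (fun j => (lift_cell (a.2 j).1, (a.2 j).2))
                           (record_cell (q, r, a), MRight))
  else (inr None, with_history (fun j => (lift_cell (r j), MStay)) (None, MLeft)).

Definition dfs_delta (s : dfs_state)
    (r : {ffun 'I_(ntapes M).+2 -> cellD}) :
    {set dfs_state * {ffun 'I_(ntapes M).+2 -> cellD * move}} :=
  let r0 := [ffun j => lower_cell (r (lift ord_max j))] in
  match s with
  | inl q =>
      if (delta q r0 == set0) && (q \in accepting M) then set0
      else [set dfs_try q r0 (enum (delta q r0))]
  | inr (Some (q, r1, a)) =>
      let acts := enum (delta q r1) in
      [set dfs_try q r1 (drop (index a acts).+1 acts)]
  | inr None =>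
      if r ord_max is Some (inr (inr x)) then
        [set (inr (Some x),
          with_history (fun j => (lift_cell (r0 j), opposite (x.2.2 j).2))
                       (r ord_max, MStay))]
      else set0
  end.

Definition dfs_machine : machine Sigma :=
  {| work := (work M + record)%type; state := dfs_state;
     ntapes := (ntapes M).+1; start := inl (start M);
     accepting := [set s : dfs_state | if s is inl q then q \in accepting M else false];
     delta := dfs_delta |}.

Lemma dfs_deterministic : deterministic dfs_machine.
Proof.
move=> s r; rewrite /= /dfs_delta.
case: s => [q|[[[q r1] a]|]]; rewrite ?cards1 //.
  by case: ifP; rewrite ?cards1 ?cards0.
by case: (r _) => [[?|[?|?]]|]; rewrite ?cards1 ?cards0.
Qed.

(** The scanned cell is left out: just after a move is undone it still holds the symbol written by
    the abandoned choice, until the next attempt overwrites it. Comparing with [nth None] ignores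
    trailing blanks. *)
Definition same_sides (t : tape (Sigma + work M)) (t' : tape (Sigma + (work M + record))) :=
  (forall i, nth None (left_cells t') i = lift_cell (nth None (left_cells t) i)) /\
  (forall i, nth None (right_cells t') i = lift_cell (nth None (right_cells t) i)).

Definition same_tape t t' :=
  same_sides t t' /\ scanned t' = lift_cell (scanned t).

Lemma nth_behead (T : Type) (x : T) s i : nth x (behead s) i = nth x s i.+1.
Proof. by case: s => //=; rewrite nth_nil. Qed.

Lemma head_nth (T : Type) (x : T) s : head x s = nth x s 0.
Proof. by case: s. Qed.

Lemma act_same x m t t' : same_sides t t' ->
  same_tape (act (x, m) t) (act (lift_cell x, m) t').
Proof.
case=> hl hr; split; last by case: m => //=; rewrite !head_nth.
by split; case: m => //= -[|i] //=; rewrite !nth_behead.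
Qed.

Lemma act_undo x m t t' : same_tape (act (x, m) t) t' ->
  same_sides t (act (scanned t', opposite m) t').
Proof.
case=> -[hl hr] hs; split; case: m hl hr hs => //= hl hr hs [|i];
  by rewrite /= ?nth_behead ?hs ?hl ?hr /= ?head_nth ?nth_behead.
Qed.

(** During exploration the head of the history tape stands just to the right of the last record, and
    during backtracking on it, as in [history_at]. A blank there signals an empty history. *)
Definition history_before (H : seq record) (t : tape (Sigma + (work M + record))) :=
  forall i, nth None (left_cells t) i = nth None (map record_cell H) i.

Definition history_at (H : seq record) (t : tape (Sigma + (work M + record))) :=
  forall i, nth None (scanned t :: left_cells t) i = nth None (map record_cell H) i.

Lemma history_push x H t : history_before H t ->
  history_before (x :: H) (act (record_cell x, MRight) t).
Proof. by move=> h [|i] /=. Qed.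

Lemma history_back H t : history_before H t -> history_at H (act (None, MLeft) t).
Proof. by move=> h [|i] /=; rewrite ?head_nth ?nth_behead. Qed.

Lemma history_at_before x H t : history_at (x :: H) t -> history_before H t.
Proof. by move=> h i; apply: (h i.+1). Qed.

Definition tracks (c : config M) (e : config dfs_machine) : Prop :=
  forall j, same_tape (c.2 j) (e.2 (lift ord_max j)).

Lemma tracks_lower c e : tracks c e ->
  [ffun j => lower_cell ([ffun i => scanned (e.2 i)] (lift ord_max j))] =
  [ffun j => scanned (c.2 j)].
Proof. by move=> h; apply/ffunP => j; rewrite !ffunE (h j).2 lift_cellK. Qed.

Definition readings (c : config M) : reading := [ffun j => scanned (c.2 j)].

(** The outcome for a whole subtree of choices: either acceptance is found below [c], or the search
    comes back to a configuration that still tracks [c], with the history it started from, so that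
    the parent can try its next choice. *)
Definition explored (c : config M) H (e : config dfs_machine) : Prop :=
  (accepts_from c /\ accepts_from e) \/
  (~ accepts_from c /\ exists n e',
     [/\ nsteps n e e', e'.1 = inr None, tracks c e' &
         history_at H (e'.2 ord_max)]).

Lemma next_lift (e : config dfs_machine) s f h j :
  (next_config e (s, with_history f h)).2 (lift ord_max j) =
    act (f j) (e.2 (lift ord_max j)).
Proof. by rewrite /= !ffunE liftK. Qed.

Lemma next_history (e : config dfs_machine) s f h :
  (next_config e (s, with_history f h)).2 ord_max = act h (e.2 ord_max).
Proof. by rewrite /= !ffunE unlift_none. Qed.

Lemma back_step (c : config M) a H (e : config dfs_machine) :
  e.1 = inr None -> tracks (next_config c a) e ->
  history_at ((c.1, readings c, a) :: H) (e.2 ord_max) ->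
  exists2 e', step e e' & [/\ e'.1 = inr (Some (c.1, readings c, a)),
    forall j, same_sides (c.2 j) (e'.2 (lift ord_max j)) &
    history_at ((c.1, readings c, a) :: H) (e'.2 ord_max)].
Proof.
move=> e1 te he; have := he 0; rewrite /= => h0.
eexists; first apply: step_next.
  rewrite /moves /= e1 /= ffunE h0 /=; exact: set11.
split=> // [j|i].
  rewrite next_lift (tracks_lower te) ffunE -(te j).2.
  by have := @act_undo (a.2 j).1 (a.2 j).2 (c.2 j) (e.2 (lift ord_max j));
     rewrite -surjective_pairing; apply; have := te j; rewrite ffunE.
rewrite next_history; case: i => [|i] //; exact: (he i.+1).
Qed.

Lemma try_cons (c : config M) a s H (e : config dfs_machine) :
  (forall j, same_sides (c.2 j) (e.2 (lift ord_max j))) ->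
  history_before H (e.2 ord_max) ->
  let e' := next_config e (dfs_try c.1 (readings c) (a :: s)) in
  [/\ e'.1 = inl a.1, tracks (next_config c a) e' &
      history_before ((c.1, readings c, a) :: H) (e'.2 ord_max)].
Proof.
move=> se he; split=> // [j|].
  by rewrite next_lift ffunE [a.2 j]surjective_pairing; apply: act_same.
by rewrite next_history; apply: history_push.
Qed.

Lemma try_nil (c : config M) H (e : config dfs_machine) :
  (forall j, same_sides (c.2 j) (e.2 (lift ord_max j))) ->
  history_before H (e.2 ord_max) ->
  let e' := next_config e (dfs_try c.1 (readings c) [::]) in
  [/\ e'.1 = inr None, tracks c e' & history_at H (e'.2 ord_max)].
Proof.
move=> se he; split=> // [j|].
  rewrite next_lift ffunE; have := act_same (scanned (c.2 j)) MStay (se j).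
  by case: (c.2 j).
by rewrite next_history; apply: history_back.
Qed.

Lemma redo_step (c : config M) p a s (e : config dfs_machine) :
  enum (moves c) = p ++ a :: s -> e.1 = inr (Some (c.1, readings c, a)) ->
  step e (next_config e (dfs_try c.1 (readings c) s)).
Proof.
move=> En e1; apply: step_next; rewrite /moves /= e1 /=.
have -> : delta c.1 (readings c) = moves c by [].
have : uniq (p ++ a :: s) by rewrite -En enum_uniq.
rewrite En cat_uniq /= => /and3P[_ /norP[ap _] _].
rewrite index_cat (negbTE ap) /= eqxx addn0 -cat_rcons -(size_rcons p a).
by rewrite drop_size_cat ?set11.
Qed.

(** Induction on the choices [s] after the current one [a], those in [p] having failed already. The
    subtrees are supposed explored correctly. *)
Lemma try_next (c : config M) (e : config dfs_machine) H p a s :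
  enum (moves c) = p ++ a :: s ->
  (forall b, b \in moves c -> forall H' (e' : config dfs_machine),
     e'.1 = inl b.1 -> tracks (next_config c b) e' ->
     history_before H' (e'.2 ord_max) -> explored (next_config c b) H' e') ->
  (forall b, b \in p -> ~ accepts_from (next_config c b)) ->
  e.1 = inl a.1 -> tracks (next_config c a) e ->
  history_before ((c.1, readings c, a) :: H) (e.2 ord_max) ->
  explored c H e.
Proof.
move=> En IH; elim: s p a e En => [|b s IHs] p a e En hp e1 te he;
  (have aM : a \in moves c by rewrite -mem_enum En mem_cat mem_head orbT);
  case: (IH a aM _ e e1 te he) => [[ac ae]|[nac [n [e2 [ne e21 te2 he2]]]]];
  try (by left; split=> //; apply: accepts_from_step ac; apply: step_next);
  have [e3 s3 [e31 te3 he3]] := back_step e21 te2 he2;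
  have s4 := redo_step En e31.
- have [e41 te4 he4] := try_nil te3 (history_at_before he3).
  right; split.
    move=> /accepts_from_inv[|b]; first by apply/set0Pn; exists a.
    rewrite -mem_enum En mem_cat inE => /orP[/hp|/eqP->] //.
  exists (n + 2), (next_config e3 (dfs_try c.1 (readings c) [::])); split=> //.
  by apply: nsteps_cat ne _; exists e3 => //; eexists; first exact: s4.
have [e41 te4 he4] := @try_cons c b s _ _ te3 (history_at_before he3).
have := IHs (rcons p a) b _ _ _ e41 te4 he4.
case=> [||[ac ae]|[nac' [m [e5 [ne5 e51 te5 he5]]]]].
- by rewrite cat_rcons.
- by move=> b'; rewrite mem_rcons inE => /orP[/eqP->|/hp].
- left; split=> //; apply: accepts_from_nsteps ne _.
  by apply: accepts_from_step s3 _; apply: accepts_from_step s4 _.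
right; split=> //; exists (n + m.+2), e5; split=> //.
apply: nsteps_cat ne _; exists e3 => //.
by exists (next_config e3 (dfs_try c.1 (readings c) (b :: s))).
Qed.

Lemma dfs_moves (c : config M) (e : config dfs_machine) :
  e.1 = inl c.1 -> tracks c e ->
  moves e = if (moves c == set0) && (c.1 \in accepting M) then set0
            else [set dfs_try c.1 (readings c) (enum (moves c))].
Proof. by move=> e1 te; rewrite {1}/moves /= e1 /= (tracks_lower te). Qed.

Lemma explore_halted (c : config M) H (e : config dfs_machine) :
  moves c = set0 -> e.1 = inl c.1 -> tracks c e ->
  history_before H (e.2 ord_max) -> explored c H e.
Proof.
move=> c0 e1 te he; have := dfs_moves e1 te; rewrite c0 eqxx andTb enum_set0.
have [ca e0|cna eE] := boolP (c.1 \in accepting M).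
  left; split; first by exists 0, c.
  by exists 0, e; split=> //; rewrite inE e1.
have [e'1 te' he'] := try_nil (fun j => (te j).1) he.
right; split.
  case=> [[|n]] [d [/= nd d0 da]]; first by subst d; case/negP: cna.
  by case: nd => d' /(step_halted c0).
exists 1, (next_config e (dfs_try c.1 (readings c) [::])); split=> //.
by eexists; first (apply: step_next; rewrite eE; exact: set11).
Qed.

(** The bound [t] on the runs from [c] serves only as induction measure; the searching machine does
    not know it. *)
Lemma explore t (c : config M) H (e : config dfs_machine) :
  (forall n d, nsteps n c d -> n <= t) -> e.1 = inl c.1 -> tracks c e ->
  history_before H (e.2 ord_max) -> explored c H e.
Proof.
elim: t c H e => [|t IH] c H e ht e1 te he;
  have [c0|cn] := eqVneq (moves c) set0; try exact: explore_halted.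
  have [a aM] := set0Pn _ cn.
  by have /ht : nsteps 1 c (next_config c a) by eexists; first apply: step_next aM.
have := dfs_moves e1 te; rewrite (negbTE cn) andFb.
case En: (enum (moves c)) => [|a s] eE.
  by move: cn; rewrite -cards_eq0 cardE En.
have [e'1 te' he'] := @try_cons c a s _ _ (fun j => (te j).1) he.
have se : step e (next_config e (dfs_try c.1 (readings c) (a :: s))).
  by apply: step_next; rewrite eE set11.
have := try_next (p := [::]) En _ _ e'1 te' he'.
case=> // [b bM H' e' e'1' te'' he''|[ac ae]|[nac [n [e2 [ne e21 te2 he2]]]]].
- apply: IH => // n d nd; apply: (ht n.+1 d).
  by exists (next_config c b) => //; apply: step_next.
- by left; split=> //; apply: accepts_from_step ae.
right; split=> //; exists n.+1, e2; split=> //.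
by eexists; first exact: se.
Qed.

Lemma nth_lift_cell s i :
  nth None (map lift_cell s) i = lift_cell (nth None s i).
Proof. by elim: s i => [|x s IH] [|i] /=. Qed.

Lemma tracks_init w : tracks (init M w) (init dfs_machine w).
Proof.
move=> j; rewrite !ffunE.
have -> : (lift ord_max j == ord0) = (j == ord0).
  by rewrite -!val_eqE /= /bump leqNgt ltn_ord.
by case: (j == ord0); case: w => [|x w]; split=> //; split=> // i;
  rewrite -nth_lift_cell //= -!map_comp.
Qed.

(** If the search fails at the root, the machine scans a blank on the history tape and stops in a
    rejecting state. In both outcomes one run halts, and determinism extends this to all runs. *)
Lemma dfs_correct w t : halts_within M w t ->
  (exists t', halts_within dfs_machine w t') /\
  (accepts dfs_machine w <-> accepts M w).
Proof.
move=> ht; have ex := explore (c := init M w) (e := init dfs_machine w)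
  (H := [::]) ht erefl (tracks_init w).
have {}ex : explored (init M w) [::] (init dfs_machine w).
  by apply: ex => i; rewrite ffunE /= nth_nil.
have halt n e : nsteps n (init dfs_machine w) e -> moves e = set0 ->
    halts_within dfs_machine w n.
  by move=> ne e0 m d nd; have [] := deterministic_steps dfs_deterministic ne e0 nd.
case: ex => [[ac [n [e [ne e0 ea]]]]|[nac [n [e [ne e1 te he]]]]].
  by split; [exists n; apply: halt ne e0|split=> // _; exists n, e].
have e0 : moves e = set0.
  rewrite /moves /= e1 /= ffunE; have := he 0.
  by rewrite /=; case: (scanned _) => [[?|[?|?]]|].
split; first by exists n; apply: halt ne e0.
split=> // -[m [d [nd d0 da]]].
have [_ /(_ d0) Ed] := deterministic_steps dfs_deterministic ne e0 nd.
by rewrite Ed inE e1 in da.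
Qed.

End Determinize.

Lemma halting_TM_decidable (Sigma : finType) (M : machine Sigma) (L : seq Sigma -> Prop) :
  (forall w, exists t, halts_within M w t) ->
  (forall w, accepts M w <-> L w) -> TM_decidable L.
Proof.
move=> ht aL; exists (dfs_machine M); first exact: dfs_deterministic.
move=> w; have [t wt] := ht w; have [h aD] := dfs_correct wt.
by split=> //; rewrite aD.
Qed.

(** * Clocked stack machines *)

Section Odometer.
Variable n : nat.

Definition odometer_low d (v : nat -> nat) (j : nat) : bool :=
  [forall i : 'I_d, (i < j) ==> (v i == 0)].

(** Subtraction of one with all borrows at once: whether digit [j] changes depends only on which
    lower digits are zero, a condition that a machine reads in a single step. *)
Definition odometer_tick d (v : nat -> nat) (j : nat) : nat :=
  if odometer_low d v j then (if v j == 0 then n else (v j).-1) else v j.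

Definition odometer_value d (v : nat -> nat) : nat :=
  \sum_(j < d) v j * n.+1 ^ j.

Lemma odometer_lowS d v j : j <= d -> odometer_low d.+1 v j = odometer_low d v j.
Proof.
move=> jd; apply/forallP/forallP => h i; apply/implyP => ij.
  by have := h (widen_ord (leqnSn d) i); rewrite /= ij.
have id : i < d by apply: leq_trans jd.
by have := h (Ordinal id); rewrite /= ij.
Qed.

(** The value drops by one, and wraps from zero to its maximum. By induction on the digits: the top
    one changes only when the lower ones are all zero, and these then wrap to [n.+1 ^ d - 1]. *)
Lemma odometer_tickP d v :
  (odometer_value d (odometer_tick d v)).+1 =
  if odometer_low d v d then n.+1 ^ d else odometer_value d v.
Proof.
elim: d => [|d IH].
  rewrite /odometer_value !big_ord0 expn0.
  by have -> : odometer_low 0 v 0 = true by apply/forallP => -[].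
rewrite /odometer_value !big_ord_recr /= -addSn.
have -> : \sum_(i < d) odometer_tick d.+1 v i * n.+1 ^ i =
          odometer_value d (odometer_tick d v).
  apply: eq_bigr => i _; congr (_ * _); rewrite /odometer_tick odometer_lowS //.
  exact: ltnW.
rewrite IH /odometer_tick odometer_lowS //.
have -> : odometer_low d.+1 v d.+1 = odometer_low d v d && (v d == 0).
  apply/forallP/andP => [h|[/forallP h vd] i].
    split; last by have := h ord_max; rewrite /= ltnSn.
    apply/forallP => i; have := h (widen_ord (leqnSn d) i).
    by rewrite /= (ltn_trans (ltn_ord i)) // => vi; apply/implyP.
  apply/implyP => _; case: (ltngtP i d) => [id|/(leq_trans (ltn_ord i))|-> //].
    by have := h (Ordinal id); rewrite /= id.
  by rewrite ltnn.
have [/forallP h|_] := boolP (odometer_low d v d) => //=.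
have z : \sum_(i < d) v i * n.+1 ^ i = 0.
  by apply: big1 => i _; have := h i; rewrite ltn_ord => /eqP->.
rewrite z; have [vd|vd] := eqVneq (v d) 0; first by rewrite expnS mulSn.
by rewrite -mulSn prednK ?lt0n.
Qed.

Lemma odometer_value_max d : (odometer_value d (fun=> n)).+1 = n.+1 ^ d.
Proof.
elim: d => [|d IH]; first by rewrite /odometer_value big_ord0.
by rewrite /odometer_value big_ord_recr /= -addSn IH expnS mulSn.
Qed.

Lemma odometer_zero d v : odometer_low d v d = (odometer_value d v == 0).
Proof.
rewrite /odometer_value sum_nat_eq0; apply: eq_forallb => i.
by rewrite ltn_ord muln_eq0 expn_eq0 /= orbF.
Qed.

End Odometer.

Section StackMachine.
Variables (Sigma E Q : finType) (k d : nat) (mark : E).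

Local Notation symbol := (Sigma + E)%type.
Local Notation cell := (option (Sigma + E)).

(* [inl (Some x)] pops [x], [inl None] tests for a blank top cell, [inr None] *)
(* pushes a blank cell and [inr (Some x)] overwrites the top cell with [x].   *)
Definition instr : finType :=
  option ('I_k.+1 * (option (Sigma + E) + option (Sigma + E))).

Definition store : Type := {ffun 'I_k.+1 -> seq (option (Sigma + E))}.

Definition upd (st : store) (i : 'I_k.+1) (s : seq cell) : store :=
  [ffun j => if j == i then s else st j].

(** A tape does not distinguish an empty stack from a blank top, hence [head None]. Pushing a symbol
    takes two instructions, since a head cannot move and write on the cell it reaches in one
    step. *)
Definition exec_instr (a : instr) (st : store) : option store :=
  match a with
  | None => Some st
  | Some (i, inl (Some x)) =>
      if head None (st i) == Some x then Some (upd st i (behead (st i))) else None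
  | Some (i, inl None) => if head None (st i) == None then Some st else None
  | Some (i, inr None) => Some (upd st i (None :: st i))
  | Some (i, inr (Some x)) => Some (upd st i (Some x :: behead (st i)))
  end.

Variables (rules : Q -> instr -> Q -> bool) (q0 qf : Q).

Definition sstep (c c' : Q * store) : Prop :=
  exists2 a, rules c.1 a c'.1 & exec_instr a c.2 = Some c'.2.

Fixpoint srun (n : nat) (c c' : Q * store) : Prop :=
  if n is n'.+1 then exists2 c1, sstep c c1 & srun n' c1 c' else c = c'.

Definition init_store (w : seq Sigma) : store :=
  [ffun i => if i == ord0 then [seq Some (inl x) | x <- w] else [::]].

Definition clock_state : finType := option (Q * {ffun 'I_d -> bool})%type.

Definition join_tapes (T : Type) (f : 'I_k.+1 -> T) (g : 'I_d -> T) :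
    {ffun 'I_(k + d).+1 -> T} :=
  [ffun i => match split (i : 'I_(k.+1 + d)) with inl a => f a | inr b => g b end].

Definition guard (a : instr) (r : 'I_k.+1 -> cell) : bool :=
  if a is Some (i, inl x) then r i == x else true.

Definition instr_action (a : instr) (r : 'I_k.+1 -> cell) (i : 'I_k.+1) :
    cell * move :=
  if a is Some (i', o) then
    if i == i' then
      match o with
      | inl (Some _) => (None, MLeft)
      | inl None => (r i, MStay)
      | inr None => (r i, MRight)
      | inr (Some x) => (Some x, MStay)
      end
    else (r i, MStay)
  else (r i, MStay).

Definition clock_low (r : 'I_d -> cell) (j : 'I_d) : bool :=
  [forall i : 'I_d, (i < j) ==> (r i == None)].

Definition clock_dirs (dirs : {ffun 'I_d -> bool}) (r : 'I_d -> cell) :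
    {ffun 'I_d -> bool} :=
  [ffun j => dirs j (+) (clock_low r j && (r j == None))].

Definition clock_action (dirs : {ffun 'I_d -> bool}) (r : 'I_d -> cell)
    (j : 'I_d) : cell * move :=
  (r j, if clock_low r j then (if clock_dirs dirs r j then MRight else MLeft)
        else MStay).

Definition run_move (dirs : {ffun 'I_d -> bool}) (r : {ffun 'I_(k + d).+1 -> cell})
    (a : instr) (q : Q) : clock_state * {ffun 'I_(k + d).+1 -> cell * move} :=
  let rs i := r (lshift d i : 'I_(k.+1 + d)) in
  let rc j := r (rshift k.+1 j : 'I_(k.+1 + d)) in
  (Some (q, clock_dirs dirs rc),
   join_tapes (instr_action a rs) (clock_action dirs rc)).

(* The state [None] consumes the input, pushing one mark per letter on every  *)
(* clock tape. Each later step also moves the clock tapes: the marks ahead of *)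
(* the heads, in the directions given by the state, are the digits of a       *)
(* counter in base [size w + 1], and a digit is reset by turning around.      *)
Definition clock_delta (s : clock_state) (r : {ffun 'I_(k + d).+1 -> cell}) :
    {set clock_state * {ffun 'I_(k + d).+1 -> cell * move}} :=
  let rs i := r (lshift d i : 'I_(k.+1 + d)) in
  let rc j := r (rshift k.+1 j : 'I_(k.+1 + d)) in
  match s with
  | None =>
      if rs ord0 != None then
        [set (None, join_tapes
          (fun i => (rs i, if i == ord0 then MRight else MStay))
          (fun j => (Some (inr mark), MRight)))]
      else
        [set (Some (q0, [ffun=> false]), join_tapes
          (fun i => (rs i, if i == ord0 then MLeft else MStay))
          (fun j => (None, MLeft)))]
  | Some (q, dirs) =>
      [set x | [exists a, exists q',
        [&& rules q a q', guard a rs, [exists j, rc j != None] &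
          x == run_move dirs r a q']]]
  end.

Definition clock_machine : machine Sigma :=
  {| work := E; state := clock_state; ntapes := k + d; start := None;
     accepting := [set s : clock_state | if s is Some (q, _) then q == qf else false];
     delta := clock_delta |}.

Implicit Types t : tape (Sigma + E).

Definition flip_tape t := Tape (right_cells t) (scanned t) (left_cells t).

(** The head is on the top of the stack, with only blanks to its right, so a push moves right and a
    pop moves left. *)
Definition stack_tape (s : seq cell) t : Prop :=
  (forall i, nth None (scanned t :: left_cells t) i = nth None s i) /\
  (forall i, nth None (right_cells t) i = None).

(** On a block of [n] marks, the digit is the number of marks from the head on in its direction of
    travel, to the right when [b] holds; mirroring the tape reduces this case to the other one. *)
Definition digit_tape (n v : nat) (b : bool) t : Prop :=
  let t' := if b then flip_tape t else t in
  [/\ v <= n,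
     forall i, (nth None (scanned t' :: left_cells t') i != None) = (i < v) &
     forall i, (nth None (right_cells t') i != None) = (i < n - v)].

Lemma digit_tape_scanned n v b t :
  digit_tape n v b t -> (scanned t == None) = (v == 0).
Proof.
case=> _ h _; have := h 0; rewrite lt0n => /(congr1 negb).
by rewrite !negbK; case: (b).
Qed.

Lemma digit_tape_flip n v b t : digit_tape n v b t -> digit_tape n v (~~ b) (flip_tape t).
Proof. by case: b; case: t. Qed.

Lemma digit_tape_move n v b t : 0 < v -> digit_tape n v b t ->
  digit_tape n v.-1 b (act (scanned t, if b then MRight else MLeft) t).
Proof.
wlog: b t / b = false => [hw|->] v0.
  case: b; last exact: hw.
  move/digit_tape_flip/(hw false _ erefl v0)/digit_tape_flip => /=.
  by case: t.
case=> vn hl hr; split=> /= [|i|i]; first exact: leq_trans (leq_pred _) vn.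
  by rewrite -ltnS prednK // -hl; case: i => [|i] /=; rewrite ?head_nth ?nth_behead.
case: i => [|i] /=; last by rewrite hr; lia.
by have := hl 0; rewrite /= => ->; lia.
Qed.

(** At zero the head is on the blank next to the block, with all [n] marks behind it: turning around
    resets the digit in one move, without any writing. *)
Lemma digit_tape_turn n b t : digit_tape n 0 b t ->
  digit_tape n n (~~ b) (act (scanned t, if ~~ b then MRight else MLeft) t).
Proof.
wlog: b t / b = false => [hw|->].
  case: b; last exact: hw.
  move/digit_tape_flip/(hw false _ erefl)/digit_tape_flip => /=.
  by case: t.
case=> _ hl hr; split=> //= i; last first.
  by rewrite subnn ltn0; have := hl i; rewrite ltn0.
by have := hr i; rewrite subn0 => <-; case: i => [|i] /=; rewrite ?head_nth ?nth_behead.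
Qed.

Lemma stack_tape_act a (r : 'I_k.+1 -> cell) (st st' : store) (T : 'I_k.+1 -> tape (Sigma + E)) :
  (forall i, stack_tape (st i) (T i)) -> (forall i, r i = scanned (T i)) ->
  exec_instr a st = Some st' ->
  forall i, stack_tape (st' i) (act (instr_action a r i) (T i)).
Proof.
move=> hT hr.
have stay i : act (r i, MStay) (T i) = T i by rewrite hr; case: (T i).
case: a => [[i' [[x|]|[x|]]]|] /=; last by move=> [<-] i; rewrite stay.
- case: eqP => // hx [<-] i; rewrite /upd ffunE.
  case: eqVneq => [->|_]; last by rewrite stay.
  have [hl hr'] := hT i'; split=> [|[]] // j /=.
  by case: j => [|j] /=; rewrite ?head_nth ?nth_behead -?hl.
- by case: eqP => // hx [<-] i; case: eqP => [->|_]; rewrite stay.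
- move=> [<-] i; rewrite /upd ffunE.
  case: eqVneq => [->|_]; last by rewrite stay.
  have [hl hr'] := hT i'; split=> //= -[|j] //=.
  by rewrite nth_behead -hl.
move=> [<-] i; rewrite /upd ffunE.
case: eqVneq => [->|_]; last by rewrite stay.
have [hl hr'] := hT i'; split=> [[|j]|j] /=; rewrite ?head_nth ?nth_behead //.
by rewrite hr -hl; case: j.
Qed.

Lemma guardP a (r : 'I_k.+1 -> cell) (st : store) :
  (forall i, r i = head None (st i)) -> guard a r = isSome (exec_instr a st).
Proof.
move=> hr; case: a => [[i [[x|]|[x|]]]|] //=; rewrite hr; by case: ifP.
Qed.

Definition represents n (v : nat -> nat) (c : config clock_machine) (q : Q)
    (st : store) : Prop :=
  exists dirs, [/\ c.1 = Some (q, dirs),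
    forall i, stack_tape (st i) (c.2 (lshift d i : 'I_(k.+1 + d))) &
    forall j : 'I_d, digit_tape n (v j) (dirs j) (c.2 (rshift k.+1 j : 'I_(k.+1 + d)))].

Lemma join_lshift T (f : 'I_k.+1 -> T) (g : 'I_d -> T) i :
  join_tapes f g (lshift d i : 'I_(k.+1 + d)) = f i.
Proof. by rewrite ffunE (unsplitK (inl i : 'I_k.+1 + 'I_d)). Qed.

Lemma join_rshift T (f : 'I_k.+1 -> T) (g : 'I_d -> T) j :
  join_tapes f g (rshift k.+1 j : 'I_(k.+1 + d)) = g j.
Proof. by rewrite ffunE (unsplitK (inr j : 'I_k.+1 + 'I_d)). Qed.

Lemma next_tape (c : config clock_machine) a i :
  (next_config c a).2 i = act (a.2 i) (c.2 i).
Proof. exact: ffunE. Qed.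

Lemma represents_next n (v : nat -> nat) (c : config clock_machine) q (st : store)
    (dirs : {ffun 'I_d -> bool}) a q' st' :
  c.1 = Some (q, dirs) ->
  (forall i, stack_tape (st i) (c.2 (lshift d i : 'I_(k.+1 + d)))) ->
  (forall j : 'I_d, digit_tape n (v j) (dirs j) (c.2 (rshift k.+1 j : 'I_(k.+1 + d)))) ->
  exec_instr a st = Some st' ->
  represents n (odometer_tick n d v)
    (next_config c (run_move dirs [ffun i => scanned (c.2 i)] a q')) q' st'.
Proof.
move=> c1 hs hc ha; set r := [ffun i => _].
set rc := fun j => r (rshift k.+1 j : 'I_(k.+1 + d)).
have low j : clock_low rc j = odometer_low d v j.
  apply: eq_forallb => i; congr (_ ==> _).
  by rewrite /rc ffunE (digit_tape_scanned (hc i)).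
exists (clock_dirs dirs rc); split=> // [i|j].
  rewrite next_tape join_lshift.
  apply: (stack_tape_act (T := fun i => c.2 (lshift d i : 'I_(k.+1 + d))) hs _ ha).
  by move=> {}i; rewrite ffunE.
have rcE : rc j = scanned (c.2 (rshift k.+1 j : 'I_(k.+1 + d))) by rewrite /rc ffunE.
rewrite next_tape join_rshift -/rc /clock_action low rcE.
rewrite /odometer_tick; case: ifP => lj; last first.
  rewrite [clock_dirs _ _ _]ffunE low lj addbF.
  by have := hc j; case: (c.2 _).
have z := digit_tape_scanned (hc j).
have -> : clock_dirs dirs rc j = dirs j (+) (v j == 0).
  by rewrite ffunE low lj rcE z.
case: eqVneq => [vj|vj].
  rewrite addbT; apply: digit_tape_turn; rewrite -vj; exact: hc.
by rewrite addbF; apply: digit_tape_move; rewrite ?lt0n.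
Qed.

(** The clocked machine and the stack machine simulate each other step by step, except that the
    former stops when the odometer shows zero. *)
Lemma represents_step n (v : nat -> nat) (c : config clock_machine) q st :
  represents n v c q st ->
  (forall c', step c c' -> 0 < odometer_value n d v /\
     exists q' st', sstep (q, st) (q', st') /\
       represents n (odometer_tick n d v) c' q' st') /\
  (forall q' st', sstep (q, st) (q', st') -> 0 < odometer_value n d v ->
     exists2 c', step c c' & represents n (odometer_tick n d v) c' q' st').
Proof.
move=> [dirs [c1 hs hc]].
have hv : [exists j : 'I_d, [ffun i => scanned (c.2 i)] (rshift k.+1 j : 'I_(k.+1 + d)) != None] =
    (0 < odometer_value n d v).
  rewrite lt0n -odometer_zero; apply/idP/idP.
    case/existsP => j; rewrite ffunE (digit_tape_scanned (hc j)) => vj.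
    by apply: contra vj => /forallP/(_ j); rewrite ltn_ord.
  rewrite negb_forall => /existsP[j]; rewrite ltn_ord /= => vj.
  by apply/existsP; exists j; rewrite ffunE (digit_tape_scanned (hc j)).
have hg a : guard a (fun i => [ffun i => scanned (c.2 i)] (lshift d i : 'I_(k.+1 + d))) =
    isSome (exec_instr a st).
  by apply: guardP => i; rewrite ffunE head_nth -(hs i).1.
have mE x : x \in moves c = [exists a, exists q',
    [&& rules q a q', isSome (exec_instr a st), 0 < odometer_value n d v &
        x == run_move dirs [ffun i => scanned (c.2 i)] a q']].
  rewrite /moves /= c1 /= inE; apply: eq_existsb => a; apply: eq_existsb => q'.
  by rewrite hg hv.
split=> [c' [x]|q' st' [a ra ha] v0].
  rewrite mE => /existsP[a /existsP[q' /and4P[ra]]].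
  case ha: exec_instr => [st'|] // _ v0 /eqP -> ->; split=> //.
  exists q', st'; split; first by exists a.
  exact: (represents_next q' c1 hs hc ha).
exists (next_config c (run_move dirs [ffun i => scanned (c.2 i)] a q')).
  apply: step_next; rewrite mE; apply/existsP; exists a; apply/existsP; exists q'.
  by rewrite ra ha v0 eqxx.
exact: (represents_next q' c1 hs hc ha).
Qed.

Lemma represents_bound n (v : nat -> nat) (c : config clock_machine) q st m c' :
  represents n v c q st -> nsteps m c c' ->
  m <= odometer_value n d v /\
  exists q' st' v', srun m (q, st) (q', st') /\ represents n v' c' q' st'.
Proof.
elim: m c q st v => [|m IH] c q st v rep /=.
  by move=> <-; split=> //; exists q, st, v.
case=> c1 s1 n1; have [v0 [q1 [st1 [s1' rep1]]]] := (represents_step rep).1 _ s1.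
have [mV [q' [st' [v' [r' rep']]]]] := IH _ _ _ _ rep1 n1.
have := odometer_tickP n d v; rewrite (odometer_zero n) -[_ == 0]negbK -lt0n v0 /= => tE.
split; first by rewrite -tE.
by exists q', st', v'; split=> //; exists (q1, st1).
Qed.

Lemma represents_run n (v : nat -> nat) (c : config clock_machine) q st m q' st' :
  represents n v c q st -> srun m (q, st) (q', st') -> m <= odometer_value n d v ->
  exists c' v', nsteps m c c' /\ represents n v' c' q' st'.
Proof.
elim: m c q st v => [|m IH] c q st v rep /=.
  by case=> <- <- _; exists c, v.
case=> [[q1 st1] s1 r1] mV; have v0 : 0 < odometer_value n d v by lia.
have [c1 s1' rep1] := (represents_step rep).2 _ _ s1 v0.
have := odometer_tickP n d v; rewrite (odometer_zero n) -[_ == 0]negbK -lt0n v0 /= => tE.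
have [|c' [v' [n' rep']]] := IH _ _ _ _ rep1 r1; first by lia.
by exists c', v'; split=> //; exists c1.
Qed.

Definition input_cells (w : seq Sigma) : seq cell := [seq Some (inl x) | x <- w].

(** [u] is the part already read, latest letter first. So the input becomes a stack with its last
    letter on top, which explains [rev w] in the statements below. *)
Definition setup_config (u r : seq Sigma) : config clock_machine :=
  (None, join_tapes
    (fun i => if i == ord0 then
       Tape (input_cells u) (head None (input_cells r)) (behead (input_cells r))
     else Tape [::] None [::])
    (fun j => Tape (nseq (size u) (Some (inr mark))) None [::])).

Lemma init_setup w : init clock_machine w = setup_config [::] w.
Proof.
congr pair; apply/ffunP => i; rewrite !ffunE.
case: splitP => [j ij|j ij].
  have -> : (i == ord0) = (j == ord0) by rewrite -!val_eqE /= ij.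
  by case: (j == ord0) => //; case: w => //= x w; rewrite /word_tape /= -map_comp.
by have -> : (i == ord0) = false by rewrite -val_eqE /= ij.
Qed.

Lemma setup_lshift u r i : (setup_config u r).2 (lshift d i : 'I_(k.+1 + d)) =
  if i == ord0 then
    Tape (input_cells u) (head None (input_cells r)) (behead (input_cells r))
  else Tape [::] None [::].
Proof. exact: join_lshift. Qed.

Lemma setup_rshift u r j : (setup_config u r).2 (rshift k.+1 j : 'I_(k.+1 + d)) =
  Tape (nseq (size u) (Some (inr mark))) None [::].
Proof. exact: join_rshift. Qed.

Lemma clock_delta_setup_nil (r : {ffun 'I_(k + d).+1 -> cell}) :
  r (lshift d ord0 : 'I_(k.+1 + d)) = None ->
  clock_delta None r =
    [set (Some (q0, [ffun=> false]), join_tapes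
      (fun i => (r (lshift d i : 'I_(k.+1 + d)), if i == ord0 then MLeft else MStay))
      (fun j => (None, MLeft)))].
Proof. by move=> r0; rewrite /clock_delta r0. Qed.

Lemma step_setup_cons x u r c' : step (setup_config u (x :: r)) c' ->
  c' = setup_config (x :: u) r.
Proof.
case=> y; rewrite /moves /= ffunE join_lshift /= inE => /eqP -> ->.
congr pair; apply/ffunP => i; rewrite ffunE.
case: (@split_ordP k.+1 d i) => j -> /=.
  rewrite !join_lshift ffunE join_lshift.
  by case: (j == ord0).
by rewrite !join_rshift.
Qed.

Lemma setup_step_cons x u r : step (setup_config u (x :: r)) (setup_config (x :: u) r).
Proof.
have [c' s] : exists c', step (setup_config u (x :: r)) c'.
  by eexists; apply: step_next; rewrite /moves /= ffunE join_lshift; apply: set11.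
by have <- := step_setup_cons s.
Qed.

Lemma step_setup_nil u c' : step (setup_config u [::]) c' ->
  represents (size u) (fun=> size u) c' q0 (init_store u).
Proof.
case=> y yM ->; rewrite -/(next_config (setup_config u [::]) y).
have {}yM : y \in clock_delta None [ffun i => scanned ((setup_config u [::]).2 i)].
  exact: yM.
move: yM; rewrite clock_delta_setup_nil; last by rewrite ffunE setup_lshift.
set r := [ffun i => scanned _]; have rE i : r (lshift d i : 'I_(k.+1 + d)) = None.
  by rewrite ffunE; have -> := setup_lshift u [::] i; case: (i == ord0).
rewrite inE => /eqP->; exists [ffun=> false]; split=> // [i|j]; rewrite next_tape.
  rewrite join_lshift rE setup_lshift.
  rewrite /init_store ffunE; case: (i == ord0) => /=; last by split=> -[|[]].
  by split=> -[|[|i']] //=; rewrite ?head_nth ?nth_behead ?nth_nil.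
rewrite join_rshift setup_rshift [[ffun=> false] j]ffunE; split=> //= i;
  last by rewrite subnn ltn0; case: i => [|[]].
rewrite head_nth; set marks := nseq (size u) (Some (inr mark : symbol)).
have -> : nth None (nth None marks 0 :: behead marks) i = nth None marks i.
  by case: i => //= i; rewrite nth_behead.
by rewrite nth_nseq; case: ifP.
Qed.

Lemma setup_step_nil u : exists c', step (setup_config u [::]) c'.
Proof.
by eexists; apply: step_next; rewrite /moves /= ffunE join_lshift; apply: set11.
Qed.

Lemma setup_bound u r m c' : nsteps m (setup_config u r) c' ->
  (m <= size r /\ c'.1 = None) \/
  (m <= size r + (size u + size r).+1 ^ d /\
   exists m' q st v, srun m' (q0, init_store (rev r ++ u)) (q, st) /\
     represents (size u + size r) v c' q st).
Proof.
elim: r u m => [|x r IH] u [|m] /=; try by move=> <-; left.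
  case=> c1 /step_setup_nil rep n1; right.
  have [mV [q [st [v [r1 rep1]]]]] := represents_bound rep n1.
  rewrite addn0 -odometer_value_max ltnS; split=> //.
  by exists m, q, st, v.
case=> c1 /step_setup_cons -> /IH[[mr c0]|]; first by left.
rewrite /= addSnnS => -[mV [m' [q [st [v [r1 rep1]]]]]]; right; split=> //.
exists m', q, st, v; split=> //; by rewrite rev_cons cat_rcons.
Qed.

Lemma setup_run u r m q st : srun m (q0, init_store (rev r ++ u)) (q, st) ->
  m < (size u + size r).+1 ^ d ->
  exists m' c v, nsteps m' (setup_config u r) c /\
     represents (size u + size r) v c q st.
Proof.
elim: r u => [|x r IH] u.
  rewrite addn0 -odometer_value_max ltnS => r1 mV.
  have [c1 s1] := setup_step_nil u.
  have [c [v [n1 rep]]] := represents_run (step_setup_nil s1) r1 mV.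
  by exists m.+1, c, v; split=> //; exists c1.
rewrite rev_cons cat_rcons -addSnnS => r1 mV.
have [m' [c [v [n1 rep]]]] := IH (x :: u) r1 mV.
exists m'.+1, c, v; split=> //.
by exists (setup_config (x :: u) r); first exact: setup_step_cons.
Qed.

(** One step per letter, one step to turn back, and at most [(size w).+1 ^ d - 1] ticks. *)
Lemma clock_machine_halts w :
  halts_within clock_machine w (size w + (size w).+1 ^ d).
Proof.
move=> m c; rewrite init_setup => /setup_bound[[mw _]|[]]; last by rewrite add0n.
by apply: leq_trans mw (leq_addr _ _).
Qed.

Lemma clock_machine_accepts_sound w : accepts clock_machine w ->
  exists m st, srun m (q0, init_store (rev w)) (qf, st).
Proof.
case=> m [c []]; rewrite init_setup => /setup_bound[[_ c0] _|[_]].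
  by rewrite inE c0.
case=> m' [q [st [v [r1 [dirs [c1 _ _]]]]]] _; rewrite inE c1 => /eqP Eq.
by exists m', st; rewrite -Eq cats0 in r1 *.
Qed.

(** As no rule leaves [qf], a configuration in this state has no moves, so reaching it before the
    clock runs out suffices. *)
Lemma clock_machine_accepts_complete w m st :
  (forall a q, ~~ rules qf a q) ->
  srun m (q0, init_store (rev w)) (qf, st) -> m < (size w).+1 ^ d ->
  accepts clock_machine w.
Proof.
move=> hf r1 mV; rewrite -[rev w]cats0 in r1.
have [m' [c [v [n1 rep]]]] := setup_run r1 mV.
exists m', c; rewrite init_setup; split=> //.
  apply/eqP; apply: contraT => /set0Pn[x xM].
  have [_ [q' [st' [[a /=]]]]] := (represents_step rep).1 _ (step_next xM).
  by rewrite (negbTE (hf _ _)).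
by case: rep => dirs [c1 _ _]; rewrite inE c1 eqxx.
Qed.

End StackMachine.

(** * Nondeterministic programs on stacks *)

Inductive prog (A : Type) : Type :=
| Skip
| Fail
| Act of A
| Seq of prog A & prog A
| Alt of prog A & prog A
| Star of prog A.

Arguments Skip {A}.
Arguments Fail {A}.

(** The embedding into generic trees gives programs a choice structure, from which [seq_sub] makes a
    finite type of control states. *)
Fixpoint tree_of_prog (A : Type) (r : prog A) : GenTree.tree A :=
  match r with
  | Skip => GenTree.Node 0 [::]
  | Fail => GenTree.Node 1 [::]
  | Act a => GenTree.Leaf a
  | Seq x y => GenTree.Node 2 [:: tree_of_prog x; tree_of_prog y]
  | Alt x y => GenTree.Node 3 [:: tree_of_prog x; tree_of_prog y]
  | Star x => GenTree.Node 4 [:: tree_of_prog x]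
  end.

Fixpoint prog_of_tree (A : Type) (t : GenTree.tree A) : prog A :=
  match t with
  | GenTree.Leaf a => Act a
  | GenTree.Node 0 _ => Skip
  | GenTree.Node 2 [:: t; u] => Seq (prog_of_tree t) (prog_of_tree u)
  | GenTree.Node 3 [:: t; u] => Alt (prog_of_tree t) (prog_of_tree u)
  | GenTree.Node 4 [:: t] => Star (prog_of_tree t)
  | _ => Fail
  end.

Lemma tree_of_progK A : cancel (@tree_of_prog A) (@prog_of_tree A).
Proof. by elim=> //= [x -> y ->|x -> y ->|x ->]. Qed.

HB.instance Definition _ (A : choiceType) :=
  Choice.copy (prog A) (can_type (@tree_of_progK A)).

Section Programs.
Variables (Sigma E : finType) (k : nat).
Local Notation instr := (instr Sigma E k).
Local Notation store := (store Sigma E k).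
Local Notation prog := (prog instr).
Implicit Types (r x y : prog) (st : store) (a : instr).

Fixpoint next r : seq (instr * prog) :=
  match r with
  | Skip | Fail => [::]
  | Act a => [:: (a, Skip)]
  | Seq Skip y => [:: (None, y)]
  | Seq x y => [seq (p.1, Seq p.2 y) | p <- next x]
  | Alt x y => [:: (None, x); (None, y)]
  | Star x => [:: (None, Skip); (None, Seq x (Star x))]
  end.

(** A finite list containing all that may remain of [r] during a run, as with the partial
    derivatives of a regular expression. *)
Fixpoint residuals r : seq prog :=
  match r with
  | Skip | Fail => [:: r]
  | Act a => [:: r; Skip]
  | Seq x y => [seq Seq x' y | x' <- residuals x] ++ residuals y
  | Alt x y => r :: residuals x ++ residuals y
  | Star x => [:: r, Skip & [seq Seq x' r | x' <- residuals x]]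
  end.

Lemma residuals_refl r : r \in residuals r.
Proof.
by elim: r => [||a|x IHx y _|x _ y _|x _] /=; rewrite ?mem_cat ?map_f ?mem_head.
Qed.

Lemma nextSeq x y : next (Seq x y) =
  if x == Skip then [:: (None, y)] else [seq (p.1, Seq p.2 y) | p <- next x].
Proof. by case: x. Qed.

Lemma next_residuals_seq x y r1 r2 a :
  (forall r1 r2 a, r1 \in residuals x -> (a, r2) \in next r1 -> r2 \in residuals x) ->
  r1 \in [seq Seq x' y | x' <- residuals x] -> (a, r2) \in next r1 ->
  r2 = y \/ r2 \in [seq Seq x' y | x' <- residuals x].
Proof.
move=> IH /mapP[x' x'r ->]; rewrite nextSeq; case: eqP => _.
  by rewrite inE => /eqP[_ ->]; left.
case/mapP=> -[b z] /= /(IH _ _ _ x'r) zr [_ ->]; right; exact: map_f.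
Qed.

Lemma next_residuals r r1 r2 a :
  r1 \in residuals r -> (a, r2) \in next r1 -> r2 \in residuals r.
Proof.
elim: r r1 r2 a => [||b|x IHx y IHy|x IHx y IHy|x IHx] r1 r2 a.
- by move=> /=; rewrite inE => /eqP->.
- by move=> /=; rewrite inE => /eqP->.
- move=> /=; rewrite !inE => /orP[]/eqP-> //.
  by rewrite inE => /eqP[_ ->]; rewrite eqxx orbT.
- rewrite /= !mem_cat => /orP[/next_residuals_seq H /(H _ _ IHx)[->|->] //|].
    by rewrite residuals_refl orbT.
  by move=> r1y /(IHy _ _ _ r1y)->; rewrite orbT.
- rewrite /= !(mem_cat, in_cons) => /or3P[/eqP->|r1x /(IHx _ _ _ r1x)->|r1y /(IHy _ _ _ r1y)->];
    rewrite ?orbT //.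
  by rewrite !inE => /orP[]/eqP[_ ->]; rewrite residuals_refl ?orbT.
have nS s : s \in next (Star x) -> s.2 \in residuals (Star x).
  rewrite /= !in_cons orbF => /orP[]/eqP-> /=; rewrite ?eqxx ?orbT //.
  by rewrite map_f ?residuals_refl // !orbT.
rewrite [residuals _]/= !inE => /or3P[/eqP->|/eqP-> //|r1s].
  by move/nS; rewrite /= !inE.
by move/(next_residuals_seq IHx r1s) => [->|->]; rewrite ?eqxx ?orbT.
Qed.

Fixpoint prun n (c c' : prog * store) : Prop :=
  if n is n'.+1 then
    exists a r st, [/\ (a, r) \in next c.1, exec_instr a c.2 = Some st &
                       prun n' (r, st) c']
  else c = c'.

(** The counts agree with [next]: choosing an alternative, leaving or unfolding a star, and passing
    to the second half of a sequence each take one idle instruction. *)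
Inductive exec : prog -> nat -> store -> store -> Prop :=
| exec_skip st : exec Skip 0 st st
| exec_act a st st' : exec_instr a st = Some st' -> exec (Act a) 1 st st'
| exec_seq x y m n st st1 st2 :
    exec x m st st1 -> exec y n st1 st2 -> exec (Seq x y) (m + n.+1) st st2
| exec_altl x y n st st' : exec x n st st' -> exec (Alt x y) n.+1 st st'
| exec_altr x y n st st' : exec y n st st' -> exec (Alt x y) n.+1 st st'
| exec_star0 x st : exec (Star x) 1 st st
| exec_starS x n st st' : exec (Seq x (Star x)) n st st' -> exec (Star x) n.+1 st st'.

Lemma execP r n st st' : exec r n st st' ->
  match r with
  | Skip => st = st'
  | Fail => False
  | Act a => exec_instr a st = Some st'
  | Seq x y => exists m1 m2 st1,
      [/\ exec x m1 st st1, exec y m2 st1 st' & n = m1 + m2.+1]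
  | Alt x y => exists n', exec x n' st st' \/ exec y n' st st'
  | Star x => st = st' \/ exists2 n', n' < n & exec (Seq x (Star x)) n' st st'
  end.
Proof.
case=> {r n st st'} [//|//|x y m n st st1 st2|x y n st st'|x y n st st'|x st|x n st st'].
- by exists m, n, st1.
- by exists n; left.
- by exists n; right.
- by left.
by right; exists n.
Qed.

Lemma prun_cat m n c c1 c2 : prun m c c1 -> prun n c1 c2 -> prun (m + n) c c2.
Proof.
elim: m c => [|m IH] c /=; first by move->.
by case=> a [r [st [h1 h2 /IH h3]]] /h3; exists a, r, st.
Qed.

Lemma prun_seq m x y st st1 : prun m (x, st) (Skip, st1) ->
  prun m (Seq x y, st) (Seq Skip y, st1).
Proof.
elim: m x st => [|m IH] x st; first by case=> -> ->.
case=> a [r [st' [/= h1 h2 /IH h3]]]; exists a, (Seq r y), st'; split=> //.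
change ((a, Seq r y) \in next (Seq x y)).
rewrite nextSeq ifN; last by apply: contraTneq h1 => ->.
by apply/mapP; exists (a, r).
Qed.

Lemma exec_prun r n st st' : exec r n st st' -> prun n (r, st) (Skip, st').
Proof.
elim=> {r n st st'} [st //|a st st' h|x y m n st st1 st2 _ h1 _ h2|x y n st st' _ h
  |x y n st st' _ h|x st|x n st st' _ h].
- by exists a, Skip, st'; rewrite inE eqxx.
- apply: prun_cat (prun_seq y h1) _.
  by exists None, y, st1; split=> //=; rewrite inE.
- by exists None, x, st; rewrite !inE eqxx.
- by exists None, y, st; rewrite !inE eqxx orbT.
- by exists None, Skip, st; rewrite !inE eqxx.
by exists None, (Seq x (Star x)), st; rewrite !inE eqxx orbT.
Qed.

Lemma next_exec r a r' st st1 n st2 : (a, r') \in next r ->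
  exec_instr a st = Some st1 -> exec r' n st1 st2 -> exec r n.+1 st st2.
Proof.
elim: r a r' n st st1 st2 => [||b|x IHx y IHy|x IHx y IHy|x IHx] a r' n st st1 st2 //.
- rewrite inE => /eqP[-> ->] h e; inversion e; subst; exact: exec_act.
- rewrite nextSeq; case: eqP => [->|_].
    rewrite inE => /eqP[-> ->] [<-] e; exact: exec_seq (exec_skip _) e.
  case/mapP=> -[b z] /= zx [-> ->] h e.
  inversion e; subst; rewrite -addSn; apply: exec_seq; last by eassumption.
  apply: IHx zx h _; eassumption.
- by rewrite !inE => /orP[]/eqP[-> ->] [<-] e; [apply: exec_altl|apply: exec_altr].
rewrite !inE => /orP[]/eqP[-> ->] [<-] e; last exact: exec_starS.
by inversion e; subst; apply: exec_star0.
Qed.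

Lemma prun_exec r n st st' : prun n (r, st) (Skip, st') -> exec r n st st'.
Proof.
elim: n r st => [|n IH] r st; first by case=> -> ->; apply: exec_skip.
by case=> a [r1 [st1 [/= h1 h2 /IH h3]]]; apply: next_exec h1 h2 h3.
Qed.

Variable r0 : prog.

Definition control : finType := seq_sub (Skip :: residuals r0).

Definition control_rules (q : control) (a : instr) (q' : control) : bool :=
  (a, ssval q') \in next (ssval q).

Lemma prun_srun n (q : control) r st st' :
  prun n (ssval q, st) (r, st') ->
  exists2 q' : control, ssval q' = r & srun control_rules n (q, st) (q', st').
Proof.
elim: n q st => [|n IH] q st; first by case=> <- <-; exists q.
case=> a [r1 [st1 [/= h1 h2 h3]]].
have r1P : r1 \in Skip :: residuals r0.
  rewrite inE; have := ssvalP q; rewrite inE => /orP[/eqP qE|qr].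
    by rewrite qE in h1.
  by rewrite (next_residuals qr h1) orbT.
have [q' Eq r'] := IH (SeqSub r1P) _ h3; exists q' => //.
by exists (SeqSub r1P, st1) => //; exists a.
Qed.

Lemma srun_prun n (q q' : control) st st' :
  srun control_rules n (q, st) (q', st') -> prun n (ssval q, st) (ssval q', st').
Proof.
elim: n q st => [|n IH] q st /=; first by case=> -> ->.
by case=> -[q1 st1] [a h1 h2] /IH h3; exists a, (ssval q1), st1.
Qed.

End Programs.

Lemma prog_machine (Sigma E : finType) (k d : nat) (mark : E)
    (r : prog (instr Sigma E k)) :
  exists M : machine Sigma, forall w : seq Sigma,
    [/\ halts_within M w (size w + (size w).+1 ^ d),
        (accepts M w -> exists n st, exec r n (init_store E k (rev w)) st) &
        (forall n st, exec r n (init_store E k (rev w)) st ->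
           n < (size w).+1 ^ d -> accepts M w)].
Proof.
have q0P : r \in Skip :: residuals r by rewrite inE residuals_refl orbT.
pose q0 : control r := SeqSub q0P.
pose qf : control r := SeqSub (mem_head Skip (residuals r)).
exists (clock_machine d mark (@control_rules _ _ _ r) q0 qf) => w.
split; first exact: clock_machine_halts.
  case/clock_machine_accepts_sound=> m [st /srun_prun/prun_exec].
  by exists m, st.
move=> n st /exec_prun/(@prun_srun _ _ _ r _ q0)[q' Eq r1] nV.
have Eq' : q' = qf by apply: val_inj; rewrite /= Eq.
by rewrite Eq' in r1; apply: clock_machine_accepts_complete r1 nV.
Qed.

(** * Reasoning about programs *)

Notation marker := (option bool).
Notation sym := (token + option bool)%type.
Notation program := (prog (instr token (option bool) 4)).

Definition stacks : Type := {ffun 'I_5 -> seq sym}.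

Definition set_stack (S : stacks) (i : 'I_5) (s : seq sym) : stacks :=
  [ffun j => if j == i then s else S j].

(** Blank cells appear only between the two instructions of a push, so stores without blanks suffice
    to specify programs. *)
Definition cells (S : stacks) : store token (option bool) 4 :=
  [ffun i => map Some (S i)].

Definition Pop (i : 'I_5) (s : sym) : program := Act (Some (i, inl (Some s))).
Definition Empty (i : 'I_5) : program := Act (Some (i, inl None)).
Definition Push (i : 'I_5) (s : sym) : program :=
  Seq (Act (Some (i, inr None))) (Act (Some (i, inr (Some s)))).
Definition Test (i : 'I_5) (s : sym) : program := Seq (Pop i s) (Push i s).
Definition alts (l : seq program) : program := foldr (@Alt _) Fail l.

(** Partial correctness of all runs, for soundness; [run] gives one run with its cost, for
    completeness. *)
Definition spec (x : program) (S : stacks) (P : stacks -> Prop) : Prop :=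
  forall n st, exec x n (cells S) st -> exists S', st = cells S' /\ P S'.

Definition run (x : program) (c : nat) (S S' : stacks) : Prop :=
  exists2 n, n <= c & exec x n (cells S) (cells S').

Section Logic.
Implicit Types (x y z : program) (S : stacks) (P Q : stacks -> Prop) (i j : 'I_5).

Lemma spec_weaken x S P Q : spec x S P -> (forall S', P S' -> Q S') -> spec x S Q.
Proof. by move=> h PQ n st /h[S' [-> /PQ]]; exists S'. Qed.

Lemma spec_skip S P : P S -> spec Skip S P.
Proof. by move=> PS n st /execP <-; exists S. Qed.

Lemma spec_seq x y S P Q :
  spec x S P -> (forall S', P S' -> spec y S' Q) -> spec (Seq x y) S Q.
Proof.
move=> hx hy n st /execP[m1 [m2 [st1 [/hx[S1 [-> /hy h]] /h]]]] //.
Qed.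

Lemma spec_alt x y S P : spec x S P -> spec y S P -> spec (Alt x y) S P.
Proof. by move=> hx hy n st /execP[m [/hx|/hy]]. Qed.

Lemma spec_alts (T : Type) (f : T -> program) l S P :
  (forall t, spec (f t) S P) -> spec (alts (map f l)) S P.
Proof.
move=> h; elim: l => [|t l IH]; first by move=> n st /execP.
exact: spec_alt (h t) IH.
Qed.

Lemma spec_star x S P : P S -> (forall S', P S' -> spec x S' P) -> spec (Star x) S P.
Proof.
move=> PS hx n; elim/ltn_ind: n S PS => n IH S PS st e.
case/execP: e => [<-|[n' n'n /execP[m1 [m2 [st1 [/(hx _ PS)[S' [-> PS']] e nE]]]]]].
  by exists S.
by apply: IH PS' _ e; lia.
Qed.

Lemma spec_pop i s S :
  spec (Pop i s) S (fun S' => exists r, S i = s :: r /\ S' = set_stack S i r).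
Proof.
move=> n st /execP /=; rewrite ffunE.
case: eqP => // h [<-]; case E: (S i) h => [|s' r] //= [Es]; subst s'.
exists (set_stack S i r); split; last by exists r.
by apply/ffunP => j; rewrite !ffunE; case: eqP.
Qed.

Lemma spec_empty i S : spec (Empty i) S (fun S' => S i = [::] /\ S' = S).
Proof.
move=> n st /execP /=; rewrite ffunE.
by case: eqP => // h [<-]; exists S; case: (S i) h.
Qed.

Lemma spec_push i s S : spec (Push i s) S (fun S' => S' = set_stack S i (s :: S i)).
Proof.
move=> n st /execP[m1 [m2 [st1 [/execP[<-] /execP[<-] _]]]].
exists (set_stack S i (s :: S i)); split=> //.
by apply/ffunP => j; rewrite !ffunE eqxx /=; case: eqP.
Qed.

Lemma run_weaken x c c' S S' : c <= c' -> run x c S S' -> run x c' S S'.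
Proof. by move=> cc [n nc e]; exists n => //; apply: leq_trans cc. Qed.

Lemma run_seq x y c c' S S1 S2 :
  run x c S S1 -> run y c' S1 S2 -> run (Seq x y) (c + c' + 1) S S2.
Proof.
move=> [m mc e] [n nc e']; exists (m + n.+1); first by lia.
exact: exec_seq e e'.
Qed.

Lemma run_skip S : run Skip 0 S S.
Proof. by exists 0 => //; apply: exec_skip. Qed.

Lemma run_altl x y c S S' : run x c S S' -> run (Alt x y) c.+1 S S'.
Proof. by case=> n nc e; exists n.+1 => //; apply: exec_altl. Qed.

Lemma run_altr x y c S S' : run y c S S' -> run (Alt x y) c.+1 S S'.
Proof. by case=> n nc e; exists n.+1 => //; apply: exec_altr. Qed.

Lemma run_alts (T : eqType) (f : T -> program) l t c S S' :
  t \in l -> run (f t) c S S' -> run (alts (map f l)) (c + size l) S S'.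
Proof.
elim: l => //= x l IH; rewrite inE => /orP[/eqP<-|tl] h.
  by apply: run_weaken (run_altl _ h); rewrite addnS ltnS leq_addr.
by apply: run_weaken (run_altr _ (IH tl h)); rewrite addnS.
Qed.

Lemma run_star0 x S : run (Star x) 1 S S.
Proof. by exists 1 => //; apply: exec_star0. Qed.

Lemma run_starS x c c' S S1 S2 : run x c S S1 -> run (Star x) c' S1 S2 ->
  run (Star x) (c + c' + 2) S S2.
Proof.
move=> h h'; have [n nc e] := run_seq h h'; exists n.+1; first by lia.
exact: exec_starS.
Qed.

Lemma run_star1 x c S S' : run x c S S' -> run (Star x) (c + 3) S S'.
Proof. by move=> h; apply: run_weaken (run_starS h (run_star0 x S')); rewrite -addnA. Qed.

Lemma run_star_trans x c c' S S1 S2 :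
  run (Star x) c S S1 -> run (Star x) c' S1 S2 -> run (Star x) (c + c') S S2.
Proof.
move=> [n nc e1] [n' nc' e2].
suff [m mn e] : exists2 m, m <= n + n' & exec (Star x) m (cells S) (cells S2).
  by exists m => //; apply: leq_trans mn (leq_add nc nc').
move: (cells S) e1 => st {nc nc' S}.
elim/ltn_ind: n st => n IH st /execP[->|[k kn /execP[m1 [m2 [st1 [e e1 Ek]]]]]].
  by exists n' => //; apply: leq_addl.
have [|m mn e3] := IH m2 _ _ e1; first by lia.
by exists (m1 + m.+1).+1; [lia|apply/exec_starS/exec_seq/e3].
Qed.

Lemma run_pop i s r S : S i = s :: r -> run (Pop i s) 1 S (set_stack S i r).
Proof.
move=> Si; exists 1 => //; apply: exec_act; rewrite /= ffunE Si eqxx; congr Some.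
by apply/ffunP => j; rewrite !ffunE; case: eqP.
Qed.

Lemma run_empty i S : S i = [::] -> run (Empty i) 1 S S.
Proof. by move=> Si; exists 1 => //; apply: exec_act; rewrite /= ffunE Si eqxx. Qed.

Lemma run_push i s S : run (Push i s) 3 S (set_stack S i (s :: S i)).
Proof.
exists 3 => //; apply: (exec_seq (m := 1) (n := 1)); apply: exec_act => //=.
congr Some; apply/ffunP => j; rewrite !ffunE eqxx /=; by case: eqP.
Qed.

Lemma set_set S i s s' : set_stack (set_stack S i s) i s' = set_stack S i s'.
Proof. by apply/ffunP => j; rewrite !ffunE; case: eqP. Qed.

Lemma set_setC S i j s s' : i != j ->
  set_stack (set_stack S i s) j s' = set_stack (set_stack S j s') i s.
Proof.
move=> ij; apply/ffunP => l; rewrite !ffunE.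
by case: eqVneq => // ->; rewrite eq_sym (negbTE ij).
Qed.

Lemma set_id S i : set_stack S i (S i) = S.
Proof. by apply/ffunP => j; rewrite !ffunE; case: eqP => [->|]. Qed.

Lemma get_set S i s : set_stack S i s i = s.
Proof. by rewrite ffunE eqxx. Qed.

Lemma get_set_neq S i j s : i != j -> set_stack S i s j = S j.
Proof. by move=> ij; rewrite ffunE eq_sym (negbTE ij). Qed.

Lemma spec_test i s S :
  spec (Test i s) S (fun S' => (exists r, S i = s :: r) /\ S' = S).
Proof.
apply: spec_seq (@spec_pop i s S) _ => S1 [r [Si ->]].
apply: spec_weaken (@spec_push i s _) _ => S' ->; split; first by exists r.
by rewrite get_set set_set -Si set_id.
Qed.

Lemma run_test i s r S : S i = s :: r -> run (Test i s) 5 S S.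
Proof.
move=> Si; have := run_seq (run_pop Si) (run_push i s _).
by rewrite get_set set_set -Si set_id.
Qed.

End Logic.

Definition all_tokens : seq token :=
  [:: TVar; TDigit false; TDigit true; TOver; TUnder; TBang; TArrow].

Definition all_markers : seq marker := [:: None; Some true; Some false].

Lemma all_tokensP t : t \in all_tokens.
Proof. by case: t => [|[]||||]; rewrite !inE eqxx ?orbT. Qed.

Lemma all_markersP m : m \in all_markers.
Proof. by case: m => [[]|]. Qed.

Definition move_tokens (i j : 'I_5) : program :=
  Star (alts [seq Seq (Pop i (inl t)) (Push j (inl t)) | t <- all_tokens]).

(** The star in [move_tokens] may stop anywhere; the test for a marker discards the runs that stop
    too early. *)
Definition move_body (i j : 'I_5) : program :=
  Seq (move_tokens i j) (alts [seq Test i (inr m) | m <- all_markers]).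

Notation toks := (map (@inl token (option bool))).

Lemma spec_move_tokens (i j : 'I_5) (S : stacks) : i != j ->
  spec (move_tokens i j) S (fun S' => exists u r, S i = toks u ++ r /\
    S' = set_stack (set_stack S i r) j (toks (rev u) ++ S j)).
Proof.
move=> ij; apply: spec_star; first by exists [::], (S i); rewrite !set_id.
move=> S1 [u [r [Si ->]]]; apply: spec_alts => t.
apply: spec_seq (@spec_pop _ _ _) _ => S2 [r' [E ->]].
rewrite get_set_neq 1?eq_sym // get_set in E.
apply: spec_weaken (@spec_push _ _ _) _ => S3 ->.
exists (rcons u t), r'; split; first by rewrite Si E map_rcons cat_rcons.
rewrite get_set_neq // get_set rev_rcons /=.
by rewrite (set_setC _ _ _ ij) set_set set_setC 1?eq_sym // set_set.
Qed.

Lemma run_move_tokens (i j : 'I_5) (S : stacks) u r : i != j -> S i = toks u ++ r ->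
  run (move_tokens i j) (20 * size u + 1) S
    (set_stack (set_stack S i r) j (toks (rev u) ++ S j)).
Proof.
move=> ij; elim: u S => [|t u IH] S Si.
  by rewrite /= in Si *; rewrite -Si !set_id; apply: run_star0.
have h : run (alts [seq Seq (Pop i (inl t)) (Push j (inl t)) | t <- all_tokens]) 12 S
    (set_stack (set_stack S i (toks u ++ r)) j (inl t :: S j)).
  apply: (run_alts (c := 5) (all_tokensP t)).
  have := run_push j (inl t) (set_stack S i (toks u ++ r)).
  by rewrite get_set_neq // => h; have := run_seq (run_pop Si) h.
have := IH (set_stack (set_stack S i (toks u ++ r)) j (inl t :: S j)).
rewrite get_set_neq 1?eq_sym // !get_set => /(_ erefl) h'.
apply: (@run_weaken _ (12 + (20 * size u + 1) + 2)); first by rewrite /=; lia.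
have -> : set_stack (set_stack S i r) j (toks (rev (t :: u)) ++ S j) =
  set_stack (set_stack (set_stack (set_stack S i (toks u ++ r)) j
    (inl t :: S j)) i r) j (toks (rev u) ++ inl t :: S j).
  rewrite rev_cons map_rcons cat_rcons; apply/ffunP => l; rewrite !ffunE.
  by case: (l == j); case: (l == i).
exact: run_starS h h'.
Qed.

Lemma spec_move_body (i j : 'I_5) (S : stacks) : i != j ->
  spec (move_body i j) S (fun S' => exists u m r, S i = toks u ++ inr m :: r /\
    S' = set_stack (set_stack S i (inr m :: r)) j (toks (rev u) ++ S j)).
Proof.
move=> ij; apply: spec_seq (@spec_move_tokens i j S ij) _ => S1 [u [r [Si ->]]].
apply: spec_alts => m.
apply: spec_weaken (@spec_test _ _ _) _ => S2 [[r' E] ->].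
rewrite get_set_neq 1?eq_sym // get_set in E; subst r.
by exists u, m, r'.
Qed.

Lemma run_move_body (i j : 'I_5) (S : stacks) u m r : i != j -> S i = toks u ++ inr m :: r ->
  run (move_body i j) (20 * size u + 10) S
    (set_stack (set_stack S i (inr m :: r)) j (toks (rev u) ++ S j)).
Proof.
move=> ij Si; have h := run_move_tokens ij Si; move: h; set S1 := set_stack _ j _ => h.
have h' : run (alts [seq Test i (inr m) | m <- all_markers]) 8 S1 S1.
  apply: (run_alts (c := 5) (all_markersP m)).
  by apply: (run_test (r := r)); rewrite /S1 get_set_neq 1?eq_sym // get_set.
by apply: run_weaken (run_seq h h'); lia.
Qed.

(** A stack splits uniquely at its first marker, so the decompositions guessed by the programs are
    the intended ones. *)
Lemma toks_inj u u' m m' r r' :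
  toks u ++ inr m :: r = toks u' ++ inr m' :: r' -> [/\ u = u', m = m' & r = r'].
Proof.
elim: u u' => [|t u IH] [|t' u'] //=; first by case=> -> ->.
by case=> -> /IH[-> -> ->].
Qed.

(** [iW] holds the input and [iX] the lines derived so far; [iT] keeps a sequence of words set
    aside, [iU] and [iV] a single word each. *)
Definition iW : 'I_5 := @Ordinal 5 0 isT.
Definition iX : 'I_5 := @Ordinal 5 1 isT.
Definition iT : 'I_5 := @Ordinal 5 2 isT.
Definition iU : 'I_5 := @Ordinal 5 3 isT.
Definition iV : 'I_5 := @Ordinal 5 4 isT.

Definition mk (w x t u v : seq sym) : stacks :=
  [ffun i : 'I_5 => nth [::] [:: w; x; t; u; v] i].

Lemma mk_set w x t u v s :
  (set_stack (mk w x t u v) iW s = mk s x t u v) *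
  (set_stack (mk w x t u v) iX s = mk w s t u v) *
  (set_stack (mk w x t u v) iT s = mk w x s u v) *
  (set_stack (mk w x t u v) iU s = mk w x t s v) *
  (set_stack (mk w x t u v) iV s = mk w x t u s).
Proof. by do !split; apply/ffunP => -[[|[|[|[|[|?]]]]] ?] //; rewrite !ffunE. Qed.

Lemma mk_get w x t u v :
  (mk w x t u v iW = w) * (mk w x t u v iX = x) * (mk w x t u v iT = t) *
  (mk w x t u v iU = u) * (mk w x t u v iV = v).
Proof. by rewrite !ffunE. Qed.

Definition mkE := (mk_set, mk_get).

Notation word := (bool * seq token)%type.

Definition stop : sym := inr None.
Definition sign (g : bool) : sym := inr (Some g).

(* From the top down: each word follows its sign, each line precedes a [stop]. *)
Definition word_syms (a : word) : seq sym := sign a.1 :: toks a.2.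
Definition words_syms (s : seq word) : seq sym := flatten (map word_syms s).
Definition line_syms (s : seq word) : seq sym := rcons (words_syms s) stop.
Definition lines_syms (L : seq (seq word)) : seq sym := flatten (map line_syms L).

(* Moving words from stack to stack reverses their order and their letters. *)
Definition moved_syms (s : seq word) : seq sym :=
  words_syms (rev [seq (a.1, rev a.2) | a <- s]).

Definition take_word (g : bool) (j : 'I_5) : program :=
  Seq (Pop iX (sign g)) (move_body iX j).

Definition put_word (g : bool) (i : 'I_5) : program :=
  Seq (move_body i iX) (Push iX (sign g)).

Definition move_words (i j : 'I_5) : program :=
  Star (alts [seq Seq (Pop i (sign g)) (Seq (move_body i j) (Push j (sign g)))
             | g <- [:: true; false]]).

Section Words.
Implicit Types (S : stacks) (i j : 'I_5) (s t : seq word) (L : seq (seq word)).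

Lemma words_syms_cat s t : words_syms (s ++ t) = words_syms s ++ words_syms t.
Proof. by rewrite /words_syms map_cat flatten_cat. Qed.

Lemma words_syms_cons a s : words_syms (a :: s) = word_syms a ++ words_syms s.
Proof. by []. Qed.

Lemma lines_syms_cons s L : lines_syms (s :: L) = words_syms s ++ stop :: lines_syms L.
Proof. by rewrite /lines_syms /= cat_rcons. Qed.

Lemma words_syms_head s r : exists m z, words_syms s ++ stop :: r = inr m :: z.
Proof. by case: s => [|[g a] s]; [exists None, r|exists (Some g); eexists]. Qed.

Lemma lines_syms_sign L g r : lines_syms L = sign g :: r ->
  exists a s L', L = ((g, a) :: s) :: L' /\ r = toks a ++ lines_syms (s :: L').
Proof.
case: L => [|[|[g' a] s] L] // [<- <-]; exists a, s, L; split=> //.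
by rewrite lines_syms_cons cat_rcons catA.
Qed.

Lemma moved_syms_rcons s a :
  moved_syms (rcons s a) = word_syms (a.1, rev a.2) ++ moved_syms s.
Proof. by rewrite /moved_syms map_rcons rev_rcons. Qed.

Lemma moved_syms_cons a s :
  moved_syms (a :: s) = moved_syms s ++ word_syms (a.1, rev a.2).
Proof.
by rewrite /moved_syms /= rev_cons -cats1 words_syms_cat /words_syms /= cats0.
Qed.

Lemma moved_moved s : moved_syms (rev [seq (a.1, rev a.2) | a <- s]) = words_syms s.
Proof.
rewrite /moved_syms map_rev revK -map_comp; congr words_syms.
by rewrite -[RHS]map_id; apply: eq_map => -[g a] /=; rewrite revK.
Qed.

Lemma spec_take_word g j S L : iX != j -> S iX = lines_syms L ->
  spec (take_word g j) S (fun S' => exists a s L', L = ((g, a) :: s) :: L' /\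
    S' = set_stack (set_stack S iX (lines_syms (s :: L'))) j (toks (rev a) ++ S j)).
Proof.
move=> Xj SX; apply: spec_seq (@spec_pop _ _ _) _ => S1 [r [E ->]].
rewrite SX in E; have [a [s [L' [EL Er]]]] := lines_syms_sign E.
apply: spec_weaken (@spec_move_body _ _ _ Xj) _ => S2 [u [m [r' [E' ->]]]].
exists a, s, L'; split=> //; rewrite get_set in E'.
rewrite Er lines_syms_cons in E'; have [m' [z Ez]] := words_syms_head s (lines_syms L').
rewrite Ez in E'; have [-> <- <-] := toks_inj E'.
by rewrite set_set get_set_neq // lines_syms_cons Ez.
Qed.

Lemma run_take_word g j S a s L : iX != j -> S iX = lines_syms (((g, a) :: s) :: L) ->
  run (take_word g j) (20 * size a + 12) S
    (set_stack (set_stack S iX (lines_syms (s :: L))) j (toks (rev a) ++ S j)).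
Proof.
move=> Xj SX; have [m [z Ez]] := words_syms_head s (lines_syms L).
have SX' : S iX = sign g :: (toks a ++ inr m :: z).
  by rewrite SX lines_syms_cons /= -catA Ez.
have h1 := run_pop SX'.
have h2 := @run_move_body iX j _ a m z Xj (get_set S iX (toks a ++ inr m :: z)).
have h := run_seq h1 h2; rewrite set_set get_set_neq // in h.
by rewrite lines_syms_cons Ez; apply: run_weaken h; lia.
Qed.

Lemma spec_move_words i j S s r : i != j -> S i = words_syms s ++ stop :: r ->
  spec (move_words i j) S (fun S' => exists s1 s2, s = s1 ++ s2 /\
    S' = set_stack (set_stack S i (words_syms s2 ++ stop :: r)) j (moved_syms s1 ++ S j)).
Proof.
move=> ij Si; apply: spec_star; first by exists [::], s; rewrite -Si !set_id.
move=> S1 [s1 [s2 [Es ->]]]; apply: spec_alts => g.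
apply: spec_seq (@spec_pop _ _ _) _ => S2 [r' [E ->]].
rewrite get_set_neq 1?eq_sym // get_set in E.
have [a [s3 Es2]] : exists a s3, s2 = (g, a) :: s3.
  by case: s2 {Es} E => [|[g' a] s3] // [<- _]; exists a, s3.
move: E; rewrite Es2 /= => -[Er'].
apply: spec_seq (@spec_move_body _ _ _ ij) _ => S3 [u [m [r2 [E ->]]]].
rewrite get_set -Er' -catA in E; have [m' [z Ez]] := words_syms_head s3 r.
rewrite Ez in E; have [<- <- <-] := toks_inj E.
apply: spec_weaken (@spec_push _ _ _) _ => S4 ->.
exists (rcons s1 (g, a)), s3; split; first by rewrite Es Es2 cat_rcons.
rewrite Ez moved_syms_rcons /= -!catA get_set get_set_neq // get_set.
apply/ffunP => l; rewrite !ffunE.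
by case: (l == j); case: (l == i).
Qed.

Lemma run_move_words i j S s r : i != j -> S i = words_syms s ++ stop :: r ->
  run (move_words i j) (40 * size (words_syms s) + 1) S
    (set_stack (set_stack S i (stop :: r)) j (moved_syms s ++ S j)).
Proof.
move=> ij; elim: s S => [|[g a] s IH] S Si.
  by rewrite /= in Si *; rewrite -Si !set_id; apply: run_star0.
have [m [z Ez]] := words_syms_head s r.
have Si' : S i = sign g :: (toks a ++ inr m :: z) by rewrite Si /= -catA Ez.
have h1 := run_pop Si'.
have h2 := @run_move_body i j _ a m z ij (get_set S i (toks a ++ inr m :: z)).
have h3 := run_seq h1 (run_seq h2 (run_push j (sign g) _)).
rewrite get_set set_set get_set_neq // set_set in h3.
have gl : g \in [:: true; false] by case: (g).
have h4 := run_alts (f := fun g => Seq (Pop i (sign g))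
  (Seq (move_body i j) (Push j (sign g)))) gl h3.
have := IH (set_stack (set_stack S i (words_syms s ++ stop :: r)) j
  (word_syms (g, rev a) ++ S j)).
rewrite get_set_neq 1?eq_sym // !get_set => /(_ erefl) h5.
have E1 : set_stack (set_stack S i (inr m :: z)) j (sign g :: toks (rev a) ++ S j) =
  set_stack (set_stack S i (words_syms s ++ stop :: r)) j
    (word_syms (g, rev a) ++ S j) by rewrite Ez.
rewrite E1 in h4; have := run_starS h4 h5.
have -> : set_stack (set_stack (set_stack (set_stack S i
    (words_syms s ++ stop :: r)) j (word_syms (g, rev a) ++ S j)) i (stop :: r)) j
    (moved_syms s ++ word_syms (g, rev a) ++ S j) =
  set_stack (set_stack S i (stop :: r)) j (moved_syms ((g, a) :: s) ++ S j).
  rewrite moved_syms_cons -catA; apply/ffunP => l; rewrite !ffunE.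
  by case: (l == j); case: (l == i).
by apply: run_weaken; rewrite words_syms_cons size_cat /= size_map; lia.
Qed.

(** Two moves cancel the reversals of [moved_syms], and the test for [stop] ensures that nothing is
    left behind. *)
Lemma spec_move_back i j S s r : i != j -> S i = moved_syms s ++ stop :: r ->
  spec (Seq (move_words i j) (Test i stop)) S (fun S' =>
    S' = set_stack (set_stack S i (stop :: r)) j (words_syms s ++ S j)).
Proof.
move=> ij Si; apply: spec_seq (@spec_move_words i j S _ r ij Si) _.
move=> S1 [s1 [s2 [Es ->]]]; apply: spec_weaken (@spec_test _ _ _) _.
move=> S2 [[r' E] ->]; rewrite get_set_neq 1?eq_sym // get_set in E.
case: s2 Es E => [|[g a] s2] //; rewrite cats0 => Es _.
by rewrite -(moved_moved s) Es.
Qed.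

Lemma run_move_back i j S s r : i != j -> S i = moved_syms s ++ stop :: r ->
  run (Seq (move_words i j) (Test i stop)) (40 * size (words_syms s) + 7) S
    (set_stack (set_stack S i (stop :: r)) j (words_syms s ++ S j)).
Proof.
move=> ij Si; have h := run_move_words ij (S := S) (s := rev [seq (a.1, rev a.2) | a <- s]) Si.
have h' := run_seq h (run_test (i := i) (s := stop) (r := r) _).
rewrite moved_moved in h'.
have {h'} h' := h' _; apply: run_weaken (h' _).
  have -> : size (words_syms (rev [seq (a.1, rev a.2) | a <- s])) = size (words_syms s).
    rewrite /words_syms !size_flatten /shape -!map_comp map_rev sumn_rev -map_comp.
    by congr sumn; apply: eq_map => -[g a]; rewrite /= !size_map size_rev.
  lia.
by rewrite get_set_neq 1?eq_sym // get_set.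
Qed.

End Words.

(** * The program for the cyclic calculus *)

Definition division_token (o : bool) : token := if o then TOver else TUnder.

(** The cyclic rules on arbitrary words of tokens, as the machine performs them without parsing
    formulae. That all words met are codes is an invariant, shown in [wstep_theorems]. *)
Inductive wstep : seq (seq word) -> seq (seq word) -> Prop :=
| wstep_ax p b c L : c ==> b ->
    wstep L ([:: (false, encode_formula (banged b (Var p)));
                 (true, encode_formula (banged c (Var p)))] :: L)
| wstep_rot x s L : wstep ((x :: s) :: L) (rcons s x :: L)
| wstep_swap a x s L :
    wstep ([:: (false, TBang :: a), x & s] :: L) ([:: x, (false, TBang :: a) & s] :: L)
| wstep_contr a s L :
    wstep ([:: (false, TBang :: a), (false, TBang :: a) & s] :: L)
          (((false, TBang :: a) :: s) :: L)
| wstep_par o a b s L :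
    wstep ([:: (~~ o, a), (o, b) & s] :: L)
          (((true, division_token o :: b ++ a) :: s) :: L)
| wstep_tens o a b s t L :
    wstep [:: (o, a) :: s, (~~ o, b) :: t & L]
          (((false, division_token o :: b ++ a) :: s ++ t) :: L).

(** The [stop] at the bottom of each work stack is the marker that [move_body] finds when it empties
    the stack. *)
Definition idle (w : seq sym) (L : seq (seq word)) : stacks :=
  mk w (lines_syms L) [:: stop] [:: stop] [:: stop].

Definition rot_prog : program := alts
  [seq Seq (take_word g iU) (Seq (move_words iX iT) (Seq (Test iX stop)
     (Seq (put_word g iU) (Seq (move_words iT iX) (Test iT stop)))))
  | g <- [:: true; false]].

Definition bang_body (j : 'I_5) : program :=
  Seq (Pop iX (sign false)) (Seq (Pop iX (inl TBang)) (move_body iX j)).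

Definition swap_prog : program := Seq (bang_body iU) (alts
  [seq Seq (take_word g iV) (Seq (move_body iU iX) (Seq (Push iX (inl TBang))
     (Seq (Push iX (sign false)) (put_word g iV))))
  | g <- [:: true; false]]).

Definition match_prog (i j l : 'I_5) : program := Star (alts
  [seq Seq (Pop i (inl t)) (Seq (Pop j (inl t)) (Push l (inl t))) | t <- all_tokens]).

Definition contr_prog : program :=
  Seq (bang_body iU) (Seq (bang_body iV) (Seq (match_prog iU iV iX)
    (Seq (Test iU stop) (Seq (Test iV stop)
    (Seq (Push iX (inl TBang)) (Push iX (sign false))))))).

(** The operands lie reversed on [iU] and [iV]; moving [iU] first puts the word of [iV] above it,
    the order in the code of [division]. *)
Definition unite_prog (o g : bool) : program :=
  Seq (move_body iU iX) (Seq (move_body iV iX)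
    (Seq (Push iX (inl (division_token o))) (Push iX (sign g)))).

Definition par_prog : program := alts
  [seq Seq (take_word (~~ o) iU) (Seq (take_word o iV) (unite_prog o true))
  | o <- [:: true; false]].

(** Popping the [stop] that ends the first line merges its context with that of the second. *)
Definition tens_prog : program := alts
  [seq Seq (take_word o iU) (Seq (move_words iX iT) (Seq (Pop iX stop)
     (Seq (take_word (~~ o) iV) (Seq (Seq (move_words iT iX) (Test iT stop))
     (unite_prog o false)))))
  | o <- [:: true; false]].

Lemma sign_sym g : g \in [:: true; false]. Proof. by case: g. Qed.

(* Since [stop] lies below it, the whole content of a work stack is moved. *)
Lemma spec_empty_body (i j : 'I_5) (S : stacks) u r : i != j ->
  S i = toks u ++ stop :: r ->
  spec (move_body i j) S (fun S' =>
    S' = set_stack (set_stack S i (stop :: r)) j (toks (rev u) ++ S j)).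
Proof.
move=> ij Si; apply: spec_weaken (@spec_move_body _ _ _ ij) _ => S' [u' [m [r' [E ->]]]].
by rewrite Si in E; have [<- <- <-] := toks_inj E.
Qed.

Lemma spec_first_body (j : 'I_5) (S : stacks) u s L : iX != j ->
  S iX = toks u ++ lines_syms (s :: L) ->
  spec (move_body iX j) S (fun S' =>
    S' = set_stack (set_stack S iX (lines_syms (s :: L))) j (toks (rev u) ++ S j)).
Proof.
move=> ij Si; apply: spec_weaken (@spec_move_body _ _ _ ij) _ => S' [u' [m [r' [E ->]]]].
move: E; rewrite Si lines_syms_cons; have [m' [z ->]] := words_syms_head s (lines_syms L).
by case/toks_inj => <- <- <-.
Qed.

Lemma spec_put_word g i (S : stacks) u r : i != iX -> S i = toks u ++ stop :: r ->
  spec (put_word g i) S (fun S' =>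
    S' = set_stack (set_stack S i (stop :: r)) iX (word_syms (g, rev u) ++ S iX)).
Proof.
move=> iX' Si; apply: spec_seq (@spec_empty_body _ _ _ _ _ iX' Si) _ => S1 ->.
apply: spec_weaken (@spec_push _ _ _) _ => S' ->.
by rewrite get_set set_set.
Qed.

Lemma spec_rot w L :
  spec rot_prog (idle w L) (fun S' => exists2 L', S' = idle w L' & wstep L L').
Proof.
apply: spec_alts => g.
apply: spec_seq (@spec_take_word g iU _ L _ _) _; rewrite ?mkE //.
move=> S1 [a [s [L' [EL ->]]]]; rewrite ?mkE lines_syms_cons.
apply: spec_seq (@spec_move_words iX iT _ s (lines_syms L') _ _) _; rewrite ?mkE //.
move=> S2 [s1 [s2 [Es ->]]]; rewrite ?mkE.
apply: spec_seq (@spec_test _ _ _) _ => S3 [[r E] ->]; rewrite ?mkE in E.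
case: s2 Es E => [|[g' b] s2] //; rewrite cats0 => Es _; subst s1.
apply: spec_seq (@spec_put_word g iU _ (rev a) [::] _ _) _; rewrite ?mkE //.
move=> S3' ->; rewrite ?mkE revK.
apply: spec_weaken (@spec_move_back iT iX _ s [::] _ _) _; rewrite ?mkE //.
move=> S4 ->; rewrite ?mkE; exists (rcons s (g, a) :: L'); last by rewrite EL; constructor.
by rewrite /idle lines_syms_cons -cats1 words_syms_cat words_syms_cons -!catA.
Qed.

Lemma spec_unite o g w u v t s L a b :
  u = toks (rev a) ++ [:: stop] -> v = toks (rev b) ++ [:: stop] ->
  spec (unite_prog o g) (mk w (lines_syms (s :: L)) t u v) (fun S' =>
    S' = mk w (lines_syms (((g, division_token o :: b ++ a) :: s) :: L)) t [:: stop] [:: stop]).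
Proof.
move=> -> ->.
apply: spec_seq (@spec_empty_body iU iX _ _ [::] _ _) _; [by []|by rewrite mkE|].
move=> S1 ->; rewrite ?mkE revK.
apply: spec_seq (@spec_empty_body iV iX _ _ [::] _ _) _; [by []|by rewrite mkE|].
move=> S2 ->; rewrite ?mkE revK.
apply: spec_seq (@spec_push _ _ _) _ => S3 ->; rewrite ?mkE.
apply: spec_weaken (@spec_push _ _ _) _ => S4 ->; rewrite ?mkE.
by rewrite !lines_syms_cons words_syms_cons /= map_cat -!catA.
Qed.

Lemma spec_par w L :
  spec par_prog (idle w L) (fun S' => exists2 L', S' = idle w L' & wstep L L').
Proof.
apply: spec_alts => o.
apply: spec_seq (@spec_take_word _ iU _ L _ _) _; rewrite ?mkE //.
move=> S1 [a [s [L1 [EL ->]]]]; rewrite ?mkE.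
apply: spec_seq (@spec_take_word _ iV _ (s :: L1) _ _) _; rewrite ?mkE //.
move=> S2 [b [s' [L2 [[Es EL2] ->]]]]; rewrite ?mkE; subst s L2 L.
apply: spec_weaken (@spec_unite o true w _ _ _ _ _ a b erefl erefl) _.
by move=> S' ->; eexists; last exact: wstep_par.
Qed.

Lemma spec_tens w L :
  spec tens_prog (idle w L) (fun S' => exists2 L', S' = idle w L' & wstep L L').
Proof.
apply: spec_alts => o.
apply: spec_seq (@spec_take_word _ iU _ L _ _) _; rewrite ?mkE //.
move=> S1 [a [s [L1 [EL ->]]]]; rewrite ?mkE lines_syms_cons.
apply: spec_seq (@spec_move_words iX iT _ s _ _ _) _; rewrite ?mkE //.
move=> S2 [s1 [s2 [Es ->]]]; rewrite ?mkE.
apply: spec_seq (@spec_pop _ _ _) _ => S3 [r [E ->]]; rewrite ?mkE in E *.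
case: s2 Es E => [|[g' b] s2] //; rewrite cats0 => Es [<-]; subst s1.
apply: spec_seq (@spec_take_word _ iV _ L1 _ _) _; rewrite ?mkE //.
move=> S4 [b [t [L2 [EL1 ->]]]]; rewrite ?mkE; subst L1.
apply: spec_seq (@spec_move_back iT iX _ s [::] _ _) _; rewrite ?mkE //.
move=> S5 ->; rewrite ?mkE lines_syms_cons catA -words_syms_cat -lines_syms_cons.
apply: spec_weaken (@spec_unite o false w _ _ _ _ _ a b erefl erefl) _.
by move=> S' ->; eexists; last (rewrite EL; exact: wstep_tens).
Qed.

Lemma spec_bang_body (j : 'I_5) (S : stacks) L : iX != j -> S iX = lines_syms L ->
  spec (bang_body j) S (fun S' => exists a s L',
    L = ((false, TBang :: a) :: s) :: L' /\
    S' = set_stack (set_stack S iX (lines_syms (s :: L'))) j (toks (rev a) ++ S j)).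
Proof.
move=> Xj SX; apply: spec_seq (@spec_pop _ _ _) _ => S1 [r [E ->]].
rewrite SX in E; have [a0 [s [L' [EL Er]]]] := lines_syms_sign E; subst r.
apply: spec_seq (@spec_pop _ _ _) _ => S2 [r [E' ->]]; rewrite get_set in E' *.
have [a [Ea Er]] : exists a, a0 = TBang :: a /\ r = toks a ++ lines_syms (s :: L').
  case: a0 E' {E EL} => [|t a0] /=.
    by rewrite lines_syms_cons; have [m [z ->]] := words_syms_head s (lines_syms L').
  by move=> [-> <-]; exists a0.
subst a0 r; rewrite set_set.
apply: spec_weaken (@spec_first_body j _ a s L' _ _) _ => //; rewrite ?get_set //.
by move=> S3 ->; rewrite set_set get_set_neq //; exists a, s, L'.
Qed.

Lemma spec_swap w L :
  spec swap_prog (idle w L) (fun S' => exists2 L', S' = idle w L' & wstep L L').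
Proof.
apply: spec_seq (@spec_bang_body iU _ L _ _) _; rewrite ?mkE //.
move=> S1 [a [s [L' [EL ->]]]]; rewrite ?mkE; apply: spec_alts => g.
apply: spec_seq (@spec_take_word g iV _ (s :: L') _ _) _; rewrite ?mkE //.
move=> S4 [b [s1 [L1 [[Es EL1] ->]]]]; rewrite ?mkE; subst s L1.
apply: spec_seq (@spec_empty_body iU iX _ _ [::] _ _) _; [by []|by rewrite mkE|].
move=> S5 ->; rewrite ?mkE revK.
apply: spec_seq (@spec_push _ _ _) _ => S6 ->; rewrite ?mkE.
apply: spec_seq (@spec_push _ _ _) _ => S7 ->; rewrite ?mkE.
apply: spec_weaken (@spec_put_word g iV _ (rev b) [::] _ _) _; rewrite ?mkE //.
move=> S8 ->; rewrite ?mkE revK; eexists; last by rewrite EL; exact: wstep_swap.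
by rewrite /idle !lines_syms_cons !words_syms_cons /= -!catA /= -?catA.
Qed.

Lemma spec_match (i j l : 'I_5) (S : stacks) : uniq [:: i; j; l] ->
  spec (match_prog i j l) S (fun S' => exists u r r',
    [/\ S i = toks u ++ r, S j = toks u ++ r' &
    S' = set_stack (set_stack (set_stack S i r) j r') l (toks (rev u) ++ S l)]).
Proof.
rewrite /= !inE => /and3P[/norP[ij il] jl _].
apply: spec_star; first by exists [::], (S i), (S j); rewrite /= !set_id.
move=> S1 [u [r [r' [Si Sj ->]]]]; apply: spec_alts => t.
apply: spec_seq (@spec_pop _ _ _) _ => S2 [r1 [E1 ->]].
rewrite !ffunE (negbTE ij) (negbTE il) eqxx in E1.
apply: spec_seq (@spec_pop _ _ _) _ => S3 [r2 [E2 ->]].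
rewrite !ffunE (negbTE jl) eqxx [j == i]eq_sym (negbTE ij) in E2.
apply: spec_weaken (@spec_push _ _ _) _ => S4 ->.
exists (rcons u t), r1, r2; rewrite map_rcons !cat_rcons -E1 -E2; split=> //.
apply/ffunP => x; rewrite !ffunE !eqxx [l == j]eq_sym (negbTE jl) [l == i]eq_sym (negbTE il).
rewrite rev_rcons /=; do 3!case: (_ == _) => //.
Qed.

Lemma run_match (i j l : 'I_5) (S : stacks) u r r' : uniq [:: i; j; l] ->
  S i = toks u ++ r -> S j = toks u ++ r' ->
  run (match_prog i j l) (30 * size u + 1) S
    (set_stack (set_stack (set_stack S i r) j r') l (toks (rev u) ++ S l)).
Proof.
move=> uq; elim: u S => [|t u IH] S Si Sj.
  rewrite /= in Si Sj *; rewrite -Si set_id -Sj set_id set_id; exact: run_star0.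
have := uq; rewrite /= !inE => /and3P[/norP[ij il] jl _].
have h1 := run_pop Si; set S1 := set_stack S i _ in h1.
have h2 : run (Pop j (inl t)) 1 S1 (set_stack S1 j (toks u ++ r')).
  by apply: run_pop; rewrite get_set_neq.
set S2 := set_stack S1 j _ in h2; have h3 := run_push l (inl t) S2.
set S3 := set_stack S2 l _ in h3.
have h4 := run_alts (f := fun t => Seq (Pop i (inl t)) (Seq (Pop j (inl t))
  (Push l (inl t)))) (all_tokensP t) (run_seq h1 (run_seq h2 h3)).
have := IH S3; have -> : S3 i = toks u ++ r.
  by rewrite /S3 /S2 get_set_neq 1?eq_sym // get_set_neq 1?eq_sym // get_set.
have -> : S3 j = toks u ++ r' by rewrite /S3 /S2 get_set_neq 1?eq_sym // get_set.
move=> /(_ erefl erefl) h5; have := run_starS h4 h5.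
have -> : set_stack (set_stack (set_stack S3 i r) j r') l (toks (rev u) ++ S3 l) =
  set_stack (set_stack (set_stack S i r) j r') l (toks (rev (t :: u)) ++ S l).
  rewrite /S3 get_set /S2 get_set_neq // /S1 get_set_neq // rev_cons map_rcons cat_rcons.
  by apply/ffunP => x; rewrite !ffunE; do 3!case: (_ == _) => //.
by apply: run_weaken; rewrite /=; lia.
Qed.

Lemma spec_contr w L :
  spec contr_prog (idle w L) (fun S' => exists2 L', S' = idle w L' & wstep L L').
Proof.
apply: spec_seq (@spec_bang_body iU _ L _ _) _; rewrite ?mkE //.
move=> S1 [a [s [L' [EL ->]]]]; rewrite ?mkE.
apply: spec_seq (@spec_bang_body iV _ (s :: L') _ _) _; rewrite ?mkE //.
move=> S2 [b [s1 [L1 [[Es EL1] ->]]]]; rewrite ?mkE; subst s L1.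
apply: spec_seq (@spec_match iU iV iX _ isT) _ => S3 [c [r [r' [E1 E2 ->]]]].
rewrite ?mkE in E1 E2 *.
apply: spec_seq (@spec_test _ _ _) _ => S4 [[z E] ->]; rewrite ?mkE in E *.
subst r; have [Ec _ Ez] := toks_inj E1.
apply: spec_seq (@spec_test _ _ _) _ => S5 [[z' E'] ->]; rewrite ?mkE in E' *.
subst r'; have [Ec' _ Ez'] := toks_inj E2.
apply: spec_seq (@spec_push _ _ _) _ => S6 ->; rewrite ?mkE.
apply: spec_weaken (@spec_push _ _ _) _ => S7 ->; rewrite ?mkE.
have Eab : a = b by apply: (can_inj revK); rewrite Ec.
rewrite EL -Ez -Ez' -Ec revK -Eab; eexists; last exact: wstep_contr.
by rewrite /idle !lines_syms_cons !words_syms_cons /= -!catA.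
Qed.

Lemma nat_digits_last p : last true (nat_digits p).
Proof.
rewrite /nat_digits; case: (bin_of_nat p) => // q.
suff: forall b, last b (pos_digits q) by apply.
by elim: q => //= q IH _.
Qed.

Lemma nat_digits_surj ds : last true ds -> exists p, nat_digits p = ds.
Proof.
case: ds => [|b ds] h; first by exists 0.
suff [q Eq] : exists q, pos_digits q = b :: ds.
  by exists (nat_of_bin (Npos q)); rewrite /nat_digits nat_of_binK.
elim: ds b h => [|c ds IH] b /= h; first by exists xH; move: h => /= ->.
by have [q Eq] := IH c h; case: b; [exists (xI q)|exists (xO q)]; rewrite /= Eq.
Qed.

Definition push_both (t : token) : program :=
  Seq (Push iX (inl t)) (Push iU (inl t)).

(** Digits are stacked from the most significant one, which must be [true]; the empty word stands
    for index zero. By [nat_digits_surj] only codes of numbers arise. *)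
Definition digits_prog : program :=
  Alt Skip (Seq (push_both (TDigit true))
    (Star (alts [seq push_both (TDigit b) | b <- [:: true; false]]))).

Definition bang_prog (b : bool) : program := if b then Push iX (inl TBang) else Skip.

(** The variable is guessed once and written on two stacks; the copy on [iU] travels through [iV] so
    that the two reversals cancel. *)
Definition ax_prog : program :=
  Seq (Push iX stop) (Seq digits_prog (Seq (push_both TVar) (alts
    [seq Seq (bang_prog bc.2) (Seq (Push iX (sign true)) (Seq (move_body iU iV)
       (Seq (move_body iV iX) (Seq (bang_prog bc.1) (Push iX (sign false))))))
    | bc <- [:: (false, false); (true, false); (true, true)]]))).

Lemma spec_push_both t w x y u v :
  spec (push_both t) (mk w x y u v)
    (fun S' => S' = mk w (inl t :: x) y (inl t :: u) v).
Proof.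
apply: spec_seq (@spec_push _ _ _) _ => S1 ->.
by apply: spec_weaken (@spec_push _ _ _) _ => S2 ->; rewrite ?mkE.
Qed.

Lemma run_push_both t w x y u v :
  run (push_both t) 7 (mk w x y u v) (mk w (inl t :: x) y (inl t :: u) v).
Proof.
have h1 := run_push iX (inl t) (mk w x y u v); rewrite ?mkE in h1.
have h2 := run_push iU (inl t) (mk w (inl t :: x) y u v); rewrite ?mkE in h2.
exact: run_seq h1 h2.
Qed.

Lemma spec_digits w x y u v :
  spec digits_prog (mk w x y u v) (fun S' => exists2 ds, last true ds &
    S' = mk w (toks (map TDigit ds) ++ x) y (toks (map TDigit ds) ++ u) v).
Proof.
apply: spec_alt; first by apply: spec_skip; exists [::].
apply: spec_seq (@spec_push_both _ _ _ _ _ _) _ => S1 ->.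
apply: (@spec_weaken _ _ (fun S' => exists2 ds, last false ds &
    S' = mk w (toks (map TDigit ds) ++ x) y (toks (map TDigit ds) ++ u) v)).
  apply: spec_star; first by exists [:: true].
  move=> S2 [ds dsl ->]; apply: spec_alts => b.
  apply: spec_weaken (@spec_push_both _ _ _ _ _ _) _ => S3 ->.
  by exists (b :: ds) => //; case: (ds) dsl.
by move=> S2 [ds dsl ->]; exists ds => //; case: (ds) dsl.
Qed.

Lemma run_digits ds w x y u v : last true ds ->
  run digits_prog (20 * size ds + 20) (mk w x y u v)
    (mk w (toks (map TDigit ds) ++ x) y (toks (map TDigit ds) ++ u) v).
Proof.
case/lastP: ds => [_|ds c]; first by apply: run_weaken (run_altl _ (run_skip _)).
rewrite last_rcons => ->.
have h : run (Star (alts [seq push_both (TDigit b) | b <- [:: true; false]]))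
    (12 * size ds + 1)
    (mk w (inl (TDigit true) :: x) y (inl (TDigit true) :: u) v)
    (mk w (toks (map TDigit (rcons ds true)) ++ x) y
      (toks (map TDigit (rcons ds true)) ++ u) v).
  set x0 := inl _ :: x; set u0 := inl _ :: u.
  have -> : toks (map TDigit (rcons ds true)) ++ x = toks (map TDigit ds) ++ x0.
    by rewrite !map_rcons cat_rcons.
  have -> : toks (map TDigit (rcons ds true)) ++ u = toks (map TDigit ds) ++ u0.
    by rewrite !map_rcons cat_rcons.
  elim: ds => [|b ds IH]; first exact: run_star0.
  have h1 := run_push_both (TDigit b) w (toks (map TDigit ds) ++ x0) y
    (toks (map TDigit ds) ++ u0) v.
  have h2 := run_alts (f := fun b => push_both (TDigit b)) (sign_sym b) h1.
  by apply: run_weaken (run_star_trans IH (run_star1 h2)); rewrite /=; lia.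
apply: run_weaken (run_altr _ (run_seq (run_push_both _ w x y u v) h)).
by rewrite size_rcons; lia.
Qed.

Lemma mk_bang_prog b w x y u v :
  spec (bang_prog b) (mk w x y u v) (fun S' =>
    S' = mk w ((if b then [:: inl TBang] else [::]) ++ x) y u v) /\
  run (bang_prog b) 3 (mk w x y u v)
    (mk w ((if b then [:: inl TBang] else [::]) ++ x) y u v).
Proof.
case: b; last by split; [apply: spec_skip|apply: run_weaken (run_skip _)].
split; first by apply: spec_weaken (@spec_push _ _ _) _ => S' ->; rewrite ?mkE.
by have := run_push iX (inl TBang) (mk w x y u v); rewrite ?mkE.
Qed.

Lemma encode_banged b p :
  toks (encode_formula (banged b (Var p))) =
  (if b then [:: inl TBang] else [::]) ++ inl TVar :: toks (map TDigit (nat_digits p)).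
Proof. by case: b. Qed.

Lemma spec_ax w L :
  spec ax_prog (idle w L) (fun S' => exists2 L', S' = idle w L' & wstep L L').
Proof.
apply: spec_seq (@spec_push _ _ _) _ => S1 ->; rewrite ?mkE.
apply: spec_seq (@spec_digits _ _ _ _ _) _ => S2 [ds /nat_digits_surj[p <-] ->].
apply: spec_seq (@spec_push_both _ _ _ _ _ _) _ => S3 ->.
set P := (P in spec _ _ P).
have h b c : c ==> b -> spec (Seq (bang_prog c) (Seq (Push iX (sign true))
    (Seq (move_body iU iV) (Seq (move_body iV iX) (Seq (bang_prog b)
      (Push iX (sign false))))))) (mk w (inl TVar :: toks (map TDigit (nat_digits p)) ++
        stop :: lines_syms L) [:: stop]
        (inl TVar :: toks (map TDigit (nat_digits p)) ++ [:: stop]) [:: stop]) P.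
  move=> cb; apply: spec_seq (mk_bang_prog _ _ _ _ _ _).1 _ => S4 ->.
  apply: spec_seq (@spec_push _ _ _) _ => S5 ->; rewrite ?mkE.
  apply: spec_seq (@spec_empty_body iU iV _ (TVar :: map TDigit (nat_digits p)) [::] _ _) _;
    rewrite ?mkE // => S6 ->; rewrite ?mkE.
  apply: spec_seq (@spec_empty_body iV iX _ (rev (TVar :: map TDigit (nat_digits p))) [::] _ _) _;
    rewrite ?mkE // => S7 ->; rewrite ?mkE.
  apply: spec_seq (mk_bang_prog _ _ _ _ _ _).1 _ => S8 ->.
  apply: spec_weaken (@spec_push _ _ _) _ => S9 ->; rewrite ?mkE.
  rewrite /P; eexists; last exact: (wstep_ax p L cb).
  rewrite /idle lines_syms_cons !words_syms_cons /word_syms !encode_banged revK /=.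
  by rewrite -!catA /= -?catA /= -?catA.
do ! (apply: spec_alt; first exact: h).
by move=> n st /execP.
Qed.

(** * From steps on words to theorems of the cyclic calculus *)

Definition encode_item (x : item) : word := (x.1, encode_formula x.2).

Fixpoint theorems (L : seq (seq item)) : Prop :=
  if L is s :: L' then (exists v n, cyclic v n s) /\ theorems L' else True.

Lemma cyclic_leq v v' n s : v <= v' -> cyclic v n s -> cyclic v' n s.
Proof.
move=> vv'; elim=> {n s}; try by move=> *; econstructor; eauto.
by move=> p b c bc pv; apply: cyclic_ax => //; apply: leq_trans pv vv'.
Qed.

Lemma encode_bang_inv A a : encode_formula A = TBang :: a ->
  exists2 B, A = Bang B & a = encode_formula B.
Proof. by case: A => // B [<-]; exists B. Qed.

Lemma encode_division o A B :
  encode_formula (division o A B) =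
  division_token o :: encode_formula B ++ encode_formula A.
Proof. by case: o. Qed.

(** The shape of a principal formula is visible in its code, so steps lift to formulae. Only
    contraction compares two words, and there the injectivity of the code is used. *)
Lemma wstep_theorems Ls M :
  wstep (map (map encode_item) Ls) M -> theorems Ls ->
  exists2 Ls', M = map (map encode_item) Ls' & theorems Ls'.
Proof.
move EL: (map _ Ls) => L st; case: st EL => {L M}
  [p b c L bc|x s L|a x s L|a s L|o a b s L|o a b s t L].
- move=> <- thL; exists ([:: neg (banged b (Var p)); pos (banged c (Var p))] :: Ls) => //.
  by split=> //; exists (size (nat_digits p)), 1; apply: cyclic_ax.
- case: Ls => [|[|y l] Ls] //= [<- <- <-] [[v [n D]] thL].
  exists (rcons l y :: Ls); first by rewrite /= map_rcons.
  by split=> //; exists v, n.+1; apply: cyclic_rot.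
- case: Ls => [|[|[g A] [|y l]] Ls] //= [-> /encode_bang_inv[B -> ->] <- <- <-] [[v [n D]] thL].
  exists ([:: y, neg (Bang B) & l] :: Ls) => //.
  by split=> //; exists v, n.+1; apply: cyclic_swap.
- case: Ls => [|[|[g A] [|[g' A'] l]] Ls] //=.
  case=> -> /encode_bang_inv[B -> ->] -> /encode_bang_inv[B' -> EB] <- <- [[v [n D]] thL].
  have {}EB : B = B' by have [] := @encode_formula_cat_inj B B' [::] [::]; rewrite ?cats0.
  subst B'; exists ((neg (Bang B) :: l) :: Ls) => //.
  by split=> //; exists v, n.+1; apply: cyclic_contr.
- case: Ls => [|[|[g A] [|[g' B] l]] Ls] //= [-> <- -> <- <- <-] [[v [n D]] thL].
  exists ((pos (division o A B) :: l) :: Ls).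
    by rewrite /= /encode_item /= encode_division.
  by split=> //; exists v, n.+1; apply: cyclic_par.
case: Ls => [|[|[g A] l] [|[|[g' B] l'] Ls]] //=.
case=> -> <- <- -> <- <- <- [[v [n D]] [[v' [n' D']] thL]].
exists ((neg (division o A B) :: l ++ l') :: Ls).
  by rewrite /= /encode_item /= encode_division map_cat.
split=> //; exists (maxn v v'), (n + n').+1; apply: cyclic_tens.
  by apply: cyclic_leq D; apply: leq_maxl.
by apply: cyclic_leq D'; apply: leq_maxr.
Qed.

Definition step_prog : program :=
  Alt ax_prog (Alt rot_prog (Alt swap_prog (Alt contr_prog (Alt par_prog tens_prog)))).

Definition theorem_stacks (w : seq sym) (S : stacks) : Prop :=
  exists2 Ls, S = idle w (map (map encode_item) Ls) & theorems Ls.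

Lemma spec_loop w S : theorem_stacks w S -> spec (Star step_prog) S (theorem_stacks w).
Proof.
move=> thS; apply: spec_star => // S1 [Ls -> thL].
have h S' : (exists2 M, S' = idle w M & wstep (map (map encode_item) Ls) M) ->
    theorem_stacks w S'.
  by case=> M -> /wstep_theorems/(_ thL)[Ls' -> thL']; exists Ls'.
apply: spec_alt; first exact: spec_weaken (@spec_ax w _) h.
apply: spec_alt; first exact: spec_weaken (@spec_rot w _) h.
apply: spec_alt; first exact: spec_weaken (@spec_swap w _) h.
apply: spec_alt; first exact: spec_weaken (@spec_contr w _) h.
apply: spec_alt; first exact: spec_weaken (@spec_par w _) h.
exact: spec_weaken (@spec_tens w _) h.
Qed.

(** * The cost of following a given cyclic derivation *)

Lemma size_words_cons g a s :
  size (words_syms ((g, a) :: s)) = size a + (size (words_syms s)).+1.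
Proof. by rewrite words_syms_cons size_cat /= size_map addSnnS. Qed.

Lemma run_empty_body (i j : 'I_5) (S : stacks) u r : i != j ->
  S i = toks u ++ stop :: r ->
  run (move_body i j) (20 * size u + 10) S
    (set_stack (set_stack S i (stop :: r)) j (toks (rev u) ++ S j)).
Proof. exact: run_move_body. Qed.

Lemma run_put_word g i (S : stacks) u r : i != iX -> S i = toks u ++ stop :: r ->
  run (put_word g i) (20 * size u + 14) S
    (set_stack (set_stack S i (stop :: r)) iX (word_syms (g, rev u) ++ S iX)).
Proof.
move=> iX' Si; have h1 := run_empty_body iX' Si.
have h2 := run_push iX (sign g) (set_stack (set_stack S i (stop :: r)) iX (toks (rev u) ++ S iX)).
rewrite get_set set_set in h2.
by apply: run_weaken (run_seq h1 h2); lia.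
Qed.

Lemma run_unite o g w t s L a b :
  run (unite_prog o g) (20 * size a + 20 * size b + 30)
    (mk w (lines_syms (s :: L)) t (toks (rev a) ++ [:: stop]) (toks (rev b) ++ [:: stop]))
    (mk w (lines_syms (((g, division_token o :: b ++ a) :: s) :: L)) t [:: stop] [:: stop]).
Proof.
set S := mk _ _ _ _ _.
have h1 := @run_empty_body iU iX S (rev a) [::] isT (mk_get _ _ _ _ _).1.2.
rewrite {2}/S !mkE revK in h1.
set S1 := mk _ _ _ _ _ in h1.
have h2 := @run_empty_body iV iX S1 (rev b) [::] isT (mk_get _ _ _ _ _).2.
rewrite {2}/S1 !mkE revK in h2; set S2 := mk _ _ _ _ _ in h2.
have h3 := run_push iX (inl (division_token o)) S2.
rewrite {2}/S2 !mkE in h3; set S3 := mk _ _ _ _ _ in h3.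
have h4 := run_push iX (sign g) S3; rewrite {2}/S3 !mkE in h4.
have := run_seq h1 (run_seq h2 (run_seq h3 h4)).
rewrite !lines_syms_cons words_syms_cons /= map_cat -!catA.
by apply: run_weaken; rewrite !size_rev; lia.
Qed.

Lemma run_rot w x s L :
  run rot_prog (100 * size (words_syms (x :: s)) + 100)
    (idle w ((x :: s) :: L)) (idle w (rcons s x :: L)).
Proof.
case: x => g a; set S := idle _ _.
have h1 := @run_take_word g iU S a s L isT (mk_get _ _ _ _ _).1.1.1.2.
rewrite {2}/S /idle !mkE lines_syms_cons in h1; set S1 := mk _ _ _ _ _ in h1.
have h2 := @run_move_words iX iT S1 s (lines_syms L) isT (mk_get _ _ _ _ _).1.1.1.2.
rewrite {2}/S1 !mkE in h2; set S2 := mk _ _ _ _ _ in h2.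
have h3 := @run_test iX stop (lines_syms L) S2 (mk_get _ _ _ _ _).1.1.1.2.
have h4 := @run_put_word g iU S2 (rev a) [::] isT (mk_get _ _ _ _ _).1.2.
rewrite {2}/S2 !mkE revK in h4; set S3 := mk _ _ _ _ _ in h4.
have h5 := @run_move_back iT iX S3 s [::] isT (mk_get _ _ _ _ _).1.1.2.
rewrite {2}/S3 !mkE in h5.
have h := run_alts (f := fun g => Seq (take_word g iU) (Seq (move_words iX iT)
  (Seq (Test iX stop) (Seq (put_word g iU) (Seq (move_words iT iX) (Test iT stop))))))
  (sign_sym g) (run_seq h1 (run_seq h2 (run_seq h3 (run_seq h4 h5)))).
have E : words_syms s ++ word_syms (g, a) ++ stop :: lines_syms L =
    lines_syms (rcons s (g, a) :: L).
  by rewrite lines_syms_cons -cats1 words_syms_cat words_syms_cons -!catA.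
rewrite E in h; apply: run_weaken h.
by rewrite size_words_cons size_rev /=; lia.
Qed.

Lemma run_par w o a b s L :
  run par_prog (100 * size (words_syms [:: (~~ o, a), (o, b) & s]) + 100)
    (idle w ([:: (~~ o, a), (o, b) & s] :: L))
    (idle w (((true, division_token o :: b ++ a) :: s) :: L)).
Proof.
set S := idle _ _.
have h1 := @run_take_word (~~ o) iU S a _ L isT (mk_get _ _ _ _ _).1.1.1.2.
rewrite {2}/S /idle !mkE in h1; set S1 := mk _ _ _ _ _ in h1.
have h2 := @run_take_word o iV S1 b s L isT (mk_get _ _ _ _ _).1.1.1.2.
rewrite {2}/S1 /idle !mkE in h2.
have h := run_alts (f := fun o => Seq (take_word (~~ o) iU) (Seq (take_word o iV)
  (unite_prog o true))) (sign_sym o) (run_seq h1 (run_seq h2 (run_unite o true _ _ _ _ _ _))).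
apply: run_weaken h; by rewrite !size_words_cons /=; lia.
Qed.

Lemma run_tens w o a b s t L :
  run tens_prog (100 * (size (words_syms ((o, a) :: s)) +
                        size (words_syms ((~~ o, b) :: t))) + 100)
    (idle w [:: (o, a) :: s, (~~ o, b) :: t & L])
    (idle w (((false, division_token o :: b ++ a) :: s ++ t) :: L)).
Proof.
set S := idle _ _.
have h1 := @run_take_word o iU S a s _ isT (mk_get _ _ _ _ _).1.1.1.2.
rewrite {2}/S /idle !mkE lines_syms_cons in h1; set S1 := mk _ _ _ _ _ in h1.
have h2 := @run_move_words iX iT S1 s _ isT (mk_get _ _ _ _ _).1.1.1.2.
rewrite {2}/S1 !mkE in h2; set S2 := mk _ _ _ _ _ in h2.
have h3 := @run_pop iX stop _ S2 (mk_get _ _ _ _ _).1.1.1.2.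
rewrite {2}/S2 !mkE in h3; set S3 := mk _ _ _ _ _ in h3.
have h4 := @run_take_word (~~ o) iV S3 b t L isT (mk_get _ _ _ _ _).1.1.1.2.
rewrite {2}/S3 !mkE in h4; set S4 := mk _ _ _ _ _ in h4.
have h5 := @run_move_back iT iX S4 s [::] isT (mk_get _ _ _ _ _).1.1.2.
rewrite {2}/S4 !mkE lines_syms_cons catA -words_syms_cat -lines_syms_cons in h5.
have h := run_alts (f := fun o => Seq (take_word o iU) (Seq (move_words iX iT)
   (Seq (Pop iX stop) (Seq (take_word (~~ o) iV)
   (Seq (Seq (move_words iT iX) (Test iT stop)) (unite_prog o false))))))
  (sign_sym o) (run_seq h1 (run_seq h2 (run_seq h3 (run_seq h4 (run_seq h5
    (run_unite o false _ _ _ _ _ _)))))).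
apply: run_weaken h; by rewrite !size_words_cons /=; lia.
Qed.

Lemma run_bang_body (j : 'I_5) (S : stacks) a s L : iX != j ->
  S iX = lines_syms (((false, TBang :: a) :: s) :: L) ->
  run (bang_body j) (20 * size a + 14) S
    (set_stack (set_stack S iX (lines_syms (s :: L))) j (toks (rev a) ++ S j)).
Proof.
move=> Xj SX; have [m [z Ez]] := words_syms_head s (lines_syms L).
have SX' : S iX = sign false :: inl TBang :: (toks a ++ inr m :: z).
  by rewrite SX lines_syms_cons /= -catA Ez.
have h1 := run_pop SX'; set S1 := set_stack _ _ _ in h1.
have h2 : run (Pop iX (inl TBang)) 1 S1 (set_stack S1 iX (toks a ++ inr m :: z)).
  by apply: run_pop; rewrite get_set.
have h3 := @run_move_body iX j _ a m z Xj (get_set S1 iX (toks a ++ inr m :: z)).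
have := run_seq h1 (run_seq h2 h3).
rewrite !set_set !get_set_neq // lines_syms_cons Ez.
by apply: run_weaken; lia.
Qed.

Lemma run_swap w a x s L :
  run swap_prog (100 * size (words_syms [:: (false, TBang :: a), x & s]) + 100)
    (idle w ([:: (false, TBang :: a), x & s] :: L))
    (idle w ([:: x, (false, TBang :: a) & s] :: L)).
Proof.
case: x => g b; set S := idle _ _.
have h1 := @run_bang_body iU S a _ L isT (mk_get _ _ _ _ _).1.1.1.2.
rewrite {2}/S /idle !mkE in h1; set S1 := mk _ _ _ _ _ in h1.
have h2 := @run_take_word g iV S1 b s L isT (mk_get _ _ _ _ _).1.1.1.2.
rewrite {2}/S1 /idle !mkE in h2; set S2 := mk _ _ _ _ _ in h2.
have h3 := @run_empty_body iU iX S2 (rev a) [::] isT (mk_get _ _ _ _ _).1.2.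
rewrite {2}/S2 !mkE revK in h3; set S3 := mk _ _ _ _ _ in h3.
have h4 := run_push iX (inl TBang) S3.
rewrite {2}/S3 !mkE in h4; set S4 := mk _ _ _ _ _ in h4.
have h5 := run_push iX (sign false) S4.
rewrite {2}/S4 !mkE in h5; set S5 := mk _ _ _ _ _ in h5.
have h6 := @run_put_word g iV S5 (rev b) [::] isT (mk_get _ _ _ _ _).2.
rewrite {2}/S5 !mkE revK in h6.
have h := run_seq h1 (run_alts (f := fun g => Seq (take_word g iV)
   (Seq (move_body iU iX) (Seq (Push iX (inl TBang))
     (Seq (Push iX (sign false)) (put_word g iV))))) (sign_sym g)
  (run_seq h2 (run_seq h3 (run_seq h4 (run_seq h5 h6))))).
have E : word_syms (g, b) ++ sign false :: inl TBang :: toks a ++ lines_syms (s :: L) =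
  lines_syms ([:: (g, b), (false, TBang :: a) & s] :: L).
  by rewrite !lines_syms_cons !words_syms_cons /= -!catA /= -?catA.
rewrite E in h; apply: run_weaken h.
by rewrite !size_words_cons !size_rev /=; lia.
Qed.

Lemma run_contr w a s L :
  run contr_prog (100 * size (words_syms [:: (false, TBang :: a), (false, TBang :: a) & s]) + 100)
    (idle w ([:: (false, TBang :: a), (false, TBang :: a) & s] :: L))
    (idle w (((false, TBang :: a) :: s) :: L)).
Proof.
set S := idle _ _.
have h1 := @run_bang_body iU S a _ L isT (mk_get _ _ _ _ _).1.1.1.2.
rewrite {2}/S /idle !mkE in h1; set S1 := mk _ _ _ _ _ in h1.
have h2 := @run_bang_body iV S1 a s L isT (mk_get _ _ _ _ _).1.1.1.2.
rewrite {2}/S1 /idle !mkE in h2; set S2 := mk _ _ _ _ _ in h2.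
have h3 := @run_match iU iV iX S2 (rev a) [:: stop] [:: stop] isT
  (mk_get _ _ _ _ _).1.2 (mk_get _ _ _ _ _).2.
rewrite {2}/S2 !mkE revK in h3; set S3 := mk _ _ _ _ _ in h3.
have h4 := @run_test iU stop [::] S3 (mk_get _ _ _ _ _).1.2.
have h5 := @run_test iV stop [::] S3 (mk_get _ _ _ _ _).2.
have h6 := run_push iX (inl TBang) S3.
rewrite {2}/S3 !mkE in h6; set S4 := mk _ _ _ _ _ in h6.
have h7 := run_push iX (sign false) S4; rewrite {2}/S4 !mkE in h7.
have h := run_seq h1 (run_seq h2 (run_seq h3 (run_seq h4 (run_seq h5 (run_seq h6 h7))))).
have E : sign false :: inl TBang :: toks a ++ lines_syms (s :: L) =
  lines_syms (((false, TBang :: a) :: s) :: L).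
  by rewrite !lines_syms_cons !words_syms_cons /= -!catA.
rewrite E in h; apply: run_weaken h.
by rewrite !size_words_cons !size_rev /=; lia.
Qed.

Lemma run_ax w p b c L : c ==> b ->
  run ax_prog (100 * size (nat_digits p) + 200) (idle w L)
    (idle w ([:: (false, encode_formula (banged b (Var p)));
                 (true, encode_formula (banged c (Var p)))] :: L)).
Proof.
move=> cb; set S := idle _ _; set a := TVar :: map TDigit (nat_digits p).
have h1 := run_push iX stop S; rewrite {2}/S /idle !mkE in h1.
have h2 := run_digits w (stop :: lines_syms L) [:: stop] [:: stop] [:: stop] (nat_digits_last p).
have h3 := run_push_both TVar w (toks (map TDigit (nat_digits p)) ++ stop :: lines_syms L)
  [:: stop] (toks (map TDigit (nat_digits p)) ++ [:: stop]) [:: stop].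
have h4 := (mk_bang_prog c w (toks a ++ stop :: lines_syms L) [:: stop]
  (toks a ++ [:: stop]) [:: stop]).2.
set S4 := mk _ _ _ (toks a ++ _) _ in h4.
set S5 := mk _ (_ ++ toks a ++ _) _ _ _ in h4.
have h5 := run_push iX (sign true) S5; rewrite {2}/S5 !mkE in h5.
set S6 := mk _ _ _ _ _ in h5.
have h6 := @run_empty_body iU iV S6 a [::] isT (mk_get _ _ _ _ _).1.2.
rewrite {2}/S6 !mkE in h6; set S7 := mk _ _ _ _ _ in h6.
have h7 := @run_empty_body iV iX S7 (rev a) [::] isT (mk_get _ _ _ _ _).2.
rewrite {2}/S7 !mkE revK in h7; set S8 := mk _ _ _ _ _ in h7.
have h8 := (mk_bang_prog b w (toks a ++ sign true :: (if c then [:: inl TBang] else [::])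
  ++ toks a ++ stop :: lines_syms L) [:: stop] [:: stop] [:: stop]).2.
set S9 := mk _ (_ ++ toks a ++ sign _ :: _) _ _ _ in h8.
have h9 := run_push iX (sign false) S9; rewrite {2}/S9 !mkE in h9.
have bcP : (b, c) \in [:: (false, false); (true, false); (true, true)].
  by case: (b) (c) cb => [] [].
have h10 := run_alts (f := fun bc : bool * bool => Seq (bang_prog bc.2) (Seq (Push iX (sign true))
   (Seq (move_body iU iV) (Seq (move_body iV iX) (Seq (bang_prog bc.1) (Push iX (sign false)))))))
   bcP (run_seq h4 (run_seq h5 (run_seq h6 (run_seq h7 (run_seq h8 h9))))).
have h := run_seq h1 (run_seq h2 (run_seq h3 h10)).
have E : sign false :: (if b then [:: inl TBang] else [::]) ++ toks a ++ sign true ::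
    (if c then [:: inl TBang] else [::]) ++ toks a ++ stop :: lines_syms L =
  lines_syms ([:: (false, encode_formula (banged b (Var p)));
                 (true, encode_formula (banged c (Var p)))] :: L).
  rewrite lines_syms_cons !words_syms_cons /word_syms !encode_banged /=.
  by rewrite -!catA /= -?catA /= -?catA.
rewrite E in h; apply: run_weaken h.
by rewrite size_rev /= size_map; lia.
Qed.

Lemma size_item_cons x s : size (words_syms (map encode_item (x :: s))) =
  size (encode_formula x.2) + (size (words_syms (map encode_item s))).+1.
Proof. by rewrite map_cons size_words_cons. Qed.

(** Only axioms create symbols, as the division rules trade a sign for a division token. An axiom
    has two words of at most [v + 2] letters, each with its sign, hence [2 * v + 6]. *)
Lemma cyclic_size v n s : cyclic v n s ->
  size (words_syms (map encode_item s)) <= n * (2 * v + 6).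
Proof.
have rc x s' : size (words_syms (map encode_item (rcons s' x))) =
    size (words_syms (map encode_item (x :: s'))).
  by rewrite map_rcons -cats1 words_syms_cat size_cat addnC -size_cat -words_syms_cat.
elim=> {n s} [p b c _ pv|n x s _ IH|n A x s _ IH|n A s _ IH|n o A B s _ IH
  |m n o A B s t _ IH1 _ IH2].
- have h d : size (encode_formula (banged d (Var p))) <= v + 2.
    by case: d; rewrite /= size_map; lia.
  by rewrite !size_item_cons /=; have := h b; have := h c; lia.
- by rewrite rc; apply: leq_trans IH _; rewrite leq_mul2r leqnSn orbT.
- move: (2 * v + 6) IH => K; rewrite mulSn !size_item_cons /=; lia.
- move: (2 * v + 6) IH => K; rewrite mulSn !size_item_cons /=; lia.
- move: (2 * v + 6) IH => K.
  rewrite mulSn !size_item_cons /= encode_division /= size_cat; lia.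
move: (2 * v + 6) IH1 IH2 => K; rewrite mulSn mulnDl !size_item_cons.
by rewrite map_cat words_syms_cat /= encode_division /= !size_cat; lia.
Qed.

Lemma run_snoc c c' N (S S1 S2 : stacks) x : run (Star x) c S S1 -> run x c' S1 S2 ->
  c + c' + 3 <= N -> run (Star x) N S S2.
Proof.
by move=> h h' cN; apply: run_weaken (run_star_trans h (run_star1 h')); rewrite addnA.
Qed.

(** The derivation is traversed bottom up, the second premise of a binary rule first, so that the
    first one ends on top where [tens_prog] expects it. Fixing [N] gives all rules the same cost
    bound. *)
Lemma run_loop v n s N w L : cyclic v n s -> n <= N ->
  run (Star step_prog) (n * (100 * (N * (2 * v + 6)) + 300))
    (idle w L) (idle w (map encode_item s :: L)).
Proof.
move=> D; elim: D L => {n s} [p b c bc pv|n x s D IH|n A x s D IH|n A s D IH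
  |n o A B s D IH|m n o A B s t D1 IH1 D2 IH2] L nN.
- apply: run_weaken (run_star1 (run_altl _ (run_ax w p L bc))); rewrite mul1n.
  have : 1 * (2 * v + 6) <= N * (2 * v + 6) by rewrite leq_mul2r nN orbT.
  lia.
- have h := run_rot w (encode_item x) (map encode_item s) L.
  rewrite map_rcons.
  apply: run_snoc (IH L (ltnW nN)) (run_altr _ (run_altl _ h)) _.
  have := leq_trans (cyclic_size D) (leq_mul (ltnW nN) (leqnn (2 * v + 6))).
  by move: (2 * v + 6) => K; rewrite map_cons (mulSn n); lia.
- case: x D IH => g B D IH.
  have h := run_swap w (encode_formula A) (g, encode_formula B) (map encode_item s) L.
  apply: run_snoc (IH L (ltnW nN)) (run_altr _ (run_altr _ (run_altl _ h))) _.
  have := leq_trans (cyclic_size D) (leq_mul (ltnW nN) (leqnn (2 * v + 6))).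
  by move: (2 * v + 6) => K; rewrite !size_item_cons (mulSn n) ?size_words_cons /=; lia.
- have h := run_contr w (encode_formula A) (map encode_item s) L.
  apply: run_snoc (IH L (ltnW nN)) (run_altr _ (run_altr _ (run_altr _ (run_altl _ h)))) _.
  have := leq_trans (cyclic_size D) (leq_mul (ltnW nN) (leqnn (2 * v + 6))).
  by move: (2 * v + 6) => K; rewrite !size_item_cons (mulSn n) ?size_words_cons /=; lia.
- have h := run_par w o (encode_formula A) (encode_formula B) (map encode_item s) L.
  rewrite map_cons [encode_item _]/encode_item encode_division.
  apply: run_snoc (IH L (ltnW nN)) _ _;
    first exact: (run_altr _ (run_altr _ (run_altr _ (run_altr _ (run_altl _ h))))).
  have := leq_trans (cyclic_size D) (leq_mul (ltnW nN) (leqnn (2 * v + 6))).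
  by move: (2 * v + 6) => K; rewrite !size_item_cons (mulSn n) ?size_words_cons /=; lia.
have h := run_tens w o (encode_formula A) (encode_formula B)
  (map encode_item s) (map encode_item t) L.
rewrite map_cons map_cat [encode_item _]/encode_item encode_division.
have mN : m <= N by lia.
have n'N : n <= N by lia.
apply: run_snoc (run_star_trans (IH2 L n'N) (IH1 _ mN))
  (run_altr _ (run_altr _ (run_altr _ (run_altr _ (run_altr _ h))))) _.
have := leq_mul (ltnW nN) (leqnn (2 * v + 6)); rewrite mulnDl.
have := cyclic_size D1; have := cyclic_size D2.
move: (2 * v + 6) => K; rewrite !size_item_cons (mulSn (m + n)) mulnDl ?size_words_cons /=; lia.
Qed.

(** * Checking the input against a theorem *)

Definition left_sym (x : sym) : bool :=
  match x with inl _ => true | inr m => m == Some false end.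

Definition tokens_of (z : seq sym) : seq token :=
  pmap (fun x => if x is inl t then Some t else None) z.

Definition left_prog : program :=
  Star (Alt (Pop iX (sign false))
    (alts [seq Seq (Pop iX (inl t)) (Push iT (inl t)) | t <- all_tokens])).

(** The top line is poured onto [iT], which leaves the last letter of its code on top, just as [iW]
    holds the input, so both are compared directly. Popping [stop] right after the conclusion forces
    the word to be rotated with its conclusion last. *)
Definition drain_prog : program :=
  Seq left_prog (Seq (Pop iX (sign true)) (Seq (Push iT (inl TArrow))
    (Seq (move_tokens iX iT) (Seq (Pop iX stop) (Seq (match_prog iT iW iU)
    (Seq (Test iT stop) (Empty iW))))))).

Definition main_prog : program :=
  Seq (Push iT stop) (Seq (Push iU stop) (Seq (Push iV stop)
    (Seq (Star step_prog) drain_prog))).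

Lemma spec_left w x t u v :
  spec left_prog (mk w x t u v) (fun S' => exists z r,
    [/\ x = z ++ r, all left_sym z & S' = mk w r (toks (rev (tokens_of z)) ++ t) u v]).
Proof.
apply: spec_star; first by exists [::], x.
move=> S1 [z [r [-> zl ->]]]; apply: spec_alt.
  apply: spec_weaken (@spec_pop _ _ _) _ => S2 [r' [E ->]]; rewrite !mkE in E *.
  exists (rcons z (sign false)), r'; rewrite cat_rcons E all_rcons zl; split=> //.
  by rewrite -cats1 /tokens_of pmap_cat cats0.
apply: spec_alts => a; apply: spec_seq (@spec_pop _ _ _) _ => S2 [r' [E ->]].
rewrite !mkE in E *; apply: spec_weaken (@spec_push _ _ _) _ => S3 ->; rewrite !mkE.
exists (rcons z (inl a)), r'; rewrite cat_rcons E all_rcons zl; split=> //.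
by rewrite -cats1 /tokens_of pmap_cat rev_cat.
Qed.

Lemma run_left w z r t u v : all left_sym z ->
  run left_prog (20 * size z + 1) (mk w (z ++ r) t u v)
    (mk w r (toks (rev (tokens_of z)) ++ t) u v).
Proof.
elim: z t => [|x z IH] t; first by move=> _; apply: run_star0.
case: x => [a|[[]|]] //= /IH {}IH.
  have h1 := @run_pop iX (inl a) (z ++ r) (mk w (inl a :: z ++ r) t u v) (mk_get _ _ _ _ _).1.1.1.2.
  rewrite !mkE in h1; have h2 := run_push iT (inl a) (mk w (z ++ r) t u v).
  rewrite !mkE in h2.
  have h := run_alts (f := fun t => Seq (Pop iX (inl t)) (Push iT (inl t)))
    (all_tokensP a) (run_seq h1 h2).
  rewrite rev_cons map_rcons cat_rcons.
  by apply: run_weaken (run_starS (run_altr _ h) (IH (inl a :: t))); rewrite /=; lia.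
have h1 := @run_pop iX (sign false) (z ++ r) (mk w (sign false :: z ++ r) t u v)
  (mk_get _ _ _ _ _).1.1.1.2.
rewrite !mkE in h1.
by apply: run_weaken (run_starS (run_altl _ h1) (IH t)); lia.
Qed.

Lemma left_sym_split z r z' r' : all left_sym z -> all left_sym z' ->
  z ++ sign true :: r = z' ++ sign true :: r' -> z = z' /\ r = r'.
Proof.
elim: z z' => [|x z IH] [|x' z'] //=.
- by move=> _ _ [->].
- by move=> _ /andP[h _] [E _]; rewrite -E in h.
- by move=> /andP[h _] _ [E _]; rewrite E in h.
by move=> /andP[_ hz] /andP[_ hz'] [-> /(IH _ hz hz')[-> ->]].
Qed.

Lemma left_sym_negs G : all left_sym (words_syms (map encode_item (map neg G))).
Proof.
elim: G => [|A G IH] //; rewrite !map_cons words_syms_cons all_cat IH andbT /=.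
by rewrite all_map; apply/allP.
Qed.

Lemma tokens_of_negs G : tokens_of (words_syms (map encode_item (map neg G))) =
  flatten (map encode_formula G).
Proof.
have tk s : tokens_of (toks s) = s by elim: s => //= a s IH; congr cons.
elim: G => [|A G IH] //; rewrite !map_cons words_syms_cons /tokens_of pmap_cat.
by rewrite -!/(tokens_of _) IH /= tk.
Qed.

Lemma spec_drain w Ls : theorems Ls ->
  spec drain_prog (idle (toks (rev w)) (map (map encode_item) Ls))
    (fun _ => derivability_problem w).
Proof.
move=> thL; apply: spec_seq (@spec_left _ _ _ _ _) _ => S1 [z [r [Ez zl ->]]].
apply: spec_seq (@spec_pop _ _ _) _ => S2 [r1 [Er ->]]; rewrite !mkE in Er *; subst r.
apply: spec_seq (@spec_push _ _ _) _ => S3 ->; rewrite !mkE.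
apply: spec_seq (@spec_move_tokens iX iT _ isT) _ => S4 [c [r2 [Ec ->]]].
rewrite !mkE in Ec *; subst r1.
apply: spec_seq (@spec_pop _ _ _) _ => S5 [r3 [Er ->]]; rewrite !mkE in Er *; subst r2.
have [Pi [C [Lr [zE cE D B]]]] : exists Pi C Lr,
    [/\ z = words_syms (map encode_item (map neg Pi)),
        toks c ++ stop :: r3 = toks (encode_formula C) ++ stop :: Lr,
        derivable Pi C & all bang_only_vars Pi && bang_only_vars C].
  case: Ls thL Ez => [|s Ls]; first by case: (z).
  move=> [[v [n D]] _] /=; rewrite lines_syms_cons => Ez.
  have [s1 [s2 [C [Es dC]]]] := cyclic_sound D.
  have B := cyclic_bang_only D.
  rewrite Es map_cat map_cons words_syms_cat words_syms_cons -!catA in Ez.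
  (* [sign true] is not a left symbol, so the guessed prefix [z] ends exactly at the conclusion. *)
  have [zE rE] := left_sym_split (left_sym_negs s1) zl Ez.
  (* The marker met below the conclusion is [stop], not the sign of a further word. *)
  have s2E : s2 = [::].
    case: s2 rE {Es dC Ez B} => // A s2; rewrite map_cons words_syms_cons -!catA.
    by move/toks_inj => [].
  subst s2; rewrite Es all_cat /= !all_map andbT in B.
  exists s1, C, (lines_syms (map (map encode_item) Ls)); split=> //.
have [cE' _ _] := toks_inj cE; subst c.
apply: spec_seq (@spec_match iT iW iU _ isT) _ => S6 [u [rT [rW [E1 E2 ->]]]].
rewrite !mkE in E1 E2 *.
apply: spec_seq (@spec_test _ _ _) _ => S7 [[rT' E3] ->]; rewrite !mkE in E3 *; subst rT.
apply: spec_weaken (@spec_empty _ _) _ => S8 [E4 _]; rewrite !mkE in E4; subst rW.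
rewrite cats0 in E2.
have uE : u = rev (encode_sequent Pi C).
  have : toks (rev (encode_sequent Pi C)) ++ [:: stop] = toks u ++ stop :: rT'.
    rewrite -E1 zE tokens_of_negs /encode_sequent rev_cat rev_cons map_cat map_rcons.
    by rewrite -cats1 -!catA.
  by case/toks_inj.
have wE : rev w = u.
  by apply: (inj_map (can_inj (g := fun x => if x is inl t then t else TVar) _) E2).
by exists Pi, C; split=> //; apply: (can_inj revK); rewrite wE uE.
Qed.

Lemma size_encode_gt0 A : 0 < size (encode_formula A).
Proof. by case: A. Qed.

Lemma size_negs G :
  size (words_syms (map encode_item (map neg G))) <=
    2 * size (flatten (map encode_formula G)).
Proof.
elim: G => [|A G IH] //; rewrite !map_cons size_words_cons /= size_cat.
by have := size_encode_gt0 A; lia.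
Qed.

Lemma run_drain Pi C : let w := encode_sequent Pi C in
  exists S, run drain_prog (200 * size w + 200)
    (idle (toks (rev w)) [:: map encode_item (map neg Pi ++ [:: pos C])]) S.
Proof.
move=> w; set z := words_syms (map encode_item (map neg Pi)).
set c := encode_formula C.
have wE : rev w = rev c ++ TArrow :: rev (tokens_of z).
  by rewrite /w /encode_sequent rev_cat rev_cons cat_rcons /z tokens_of_negs.
have XE : lines_syms [:: map encode_item (map neg Pi ++ [:: pos C])] =
    z ++ sign true :: toks c ++ [:: stop].
  by rewrite lines_syms_cons map_cat words_syms_cat words_syms_cons /word_syms /= cats0 -!catA.
rewrite /idle XE.
have h1 := run_left (toks (rev w)) (sign true :: toks c ++ [:: stop]) [:: stop] [:: stop]
  [:: stop] (left_sym_negs Pi).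
rewrite -/z in h1; set S1 := mk _ (sign true :: _) _ _ _ in h1.
have h2 := @run_pop iX (sign true) _ S1 (mk_get _ _ _ _ _).1.1.1.2.
rewrite {2}/S1 !mkE in h2; set S2 := mk _ _ _ _ _ in h2.
have h3 := run_push iT (inl TArrow) S2; rewrite {2}/S2 !mkE in h3.
set S3 := mk _ _ _ _ _ in h3.
have h4 := @run_move_tokens iX iT S3 c [:: stop] isT (mk_get _ _ _ _ _).1.1.1.2.
rewrite {2}/S3 !mkE in h4; set S4 := mk _ _ _ _ _ in h4.
have h5 := @run_pop iX stop [::] S4 (mk_get _ _ _ _ _).1.1.1.2.
rewrite {2}/S4 !mkE in h5; set S5 := mk _ _ _ _ _ in h5.
have TE : toks (rev c) ++ inl TArrow :: toks (rev (tokens_of z)) ++ [:: stop] =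
    toks (rev w) ++ [:: stop] by rewrite wE map_cat -catA.
have hT : S5 iT = toks (rev w) ++ [:: stop] by rewrite /S5 !mkE TE.
have hW : S5 iW = toks (rev w) ++ [::] by rewrite /S5 !mkE cats0.
have h6 := @run_match iT iW iU S5 _ _ _ isT hT hW.
rewrite {2}/S5 !mkE in h6; set S6 := mk _ _ _ _ _ in h6.
have h7 := @run_test iT stop [::] S6 (mk_get _ _ _ _ _).1.1.2.
have h8 := @run_empty iW S6 (mk_get _ _ _ _ _).1.1.1.1.
exists S6; apply: run_weaken (run_seq h1 (run_seq h2 (run_seq h3 (run_seq h4
  (run_seq h5 (run_seq h6 (run_seq h7 h8))))))).
have : size w = size (flatten (map encode_formula Pi)) + (size c).+1.
  by rewrite /w /encode_sequent size_cat.
have := size_negs Pi; rewrite -/z size_rev.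
by move: (size w) (size z) (size c) (size (flatten _)) => a b e f; lia.
Qed.

(** * Soundness, completeness and polynomial cost of the whole program *)

Lemma init_mk w : init_store (option bool) 4 w = cells (mk (toks w) [::] [::] [::] [::]).
Proof.
apply/ffunP => i; rewrite !ffunE; case: i => -[|[|[|[|[|i]]]]] //= h.
by rewrite -map_comp.
Qed.

Lemma main_sound w n st : exec main_prog n (init_store (option bool) 4 (rev w)) st ->
  derivability_problem w.
Proof.
rewrite init_mk; suff h : spec main_prog (mk (toks (rev w)) [::] [::] [::] [::])
  (fun _ => derivability_problem w) by case/h => S' [].
apply: spec_seq (@spec_push _ _ _) _ => S1 ->; rewrite !mkE.
apply: spec_seq (@spec_push _ _ _) _ => S2 ->; rewrite !mkE.
apply: spec_seq (@spec_push _ _ _) _ => S3 ->; rewrite !mkE.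
apply: (@spec_seq _ _ _ (theorem_stacks (toks (rev w)))).
  by apply: spec_loop; exists [::].
by move=> S4 [Ls -> thL]; apply: spec_drain.
Qed.

Lemma admissible_encode v A :
  bang_only_vars A -> size (encode_formula A) <= v -> admissible v A.
Proof.
elim: A => [p|B IHB A IHA|A IHA B IHB|[] // p _] /=.
- by rewrite size_map => _ /ltnW.
- by case/andP=> hB hA; rewrite size_cat => sz; rewrite IHB ?IHA //; lia.
- by case/andP=> hA hB; rewrite size_cat => sz; rewrite IHA ?IHB //; lia.
by move=> _; rewrite /= size_map => /ltnW/ltnW.
Qed.

Lemma connectives_encode A : connectives A <= size (encode_formula A).
Proof.
elim: A => //= [B IHB A IHA|A IHA B IHB|A IHA]; rewrite ?size_cat; lia.
Qed.

Lemma weight_encode Pi C : weight Pi C < size (encode_sequent Pi C).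
Proof.
rewrite /encode_sequent size_cat /= addnS ltnS leq_add ?connectives_encode //.
elim: Pi => //= A Pi IH; rewrite size_cat /total_connectives /= leq_add //.
exact: connectives_encode.
Qed.

Lemma admissible_encodes v Pi : all bang_only_vars Pi ->
  size (flatten (map encode_formula Pi)) <= v -> all (admissible v) Pi.
Proof.
elim: Pi => //= A Pi IH /andP[hA hPi]; rewrite size_cat => sz.
by rewrite admissible_encode ?IH //; lia.
Qed.

(** A bare power, because the clock runs for [n ^ d] ticks; with [n > 1] a larger exponent absorbs
    the coefficients. *)
Definition poly_bounded (f : nat -> nat) : Prop :=
  exists d, forall n, 1 < n -> f n < n ^ d.

Lemma poly_bounded_const c : poly_bounded (fun=> c).
Proof.
exists c => n n1; apply: leq_trans (ltn_expl c (ltnSn 1)) _.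
by case: c => // c; rewrite leq_exp2r.
Qed.

Lemma poly_bounded_id : poly_bounded id.
Proof. by exists 2 => n n1; rewrite -[X in X < _]expn1 ltn_exp2l. Qed.

Lemma poly_bounded_add f g :
  poly_bounded f -> poly_bounded g -> poly_bounded (fun n => f n + g n).
Proof.
move=> [d hf] [e hg]; exists (d + e).+1 => n n1.
have n0 : 0 < n by apply: ltnW.
have hd : f n < n ^ (d + e) by apply: leq_trans (hf n n1) (leq_pexp2l n0 (leq_addr _ _)).
have he : g n < n ^ (d + e) by apply: leq_trans (hg n n1) (leq_pexp2l n0 (leq_addl _ _)).
rewrite expnS; apply: leq_trans (leq_mul n1 (leqnn (n ^ (d + e)))).
by move: (n ^ _) hd he => x; lia.
Qed.

Lemma poly_bounded_mul f g :
  poly_bounded f -> poly_bounded g -> poly_bounded (fun n => f n * g n).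
Proof.
move=> [d hf] [e hg]; exists (d + e) => n n1.
by rewrite expnD ltn_mul ?hf ?hg.
Qed.

(* [n] stands for [size w + 1]. *)
Definition steps_bound (n : nat) : nat :=
  let L := n + 1 in 10 * L * L * (5 * L) + 4 * L * L.

(** The number of rules times the cost per rule in [run_loop], plus the cost of the final check in
    [run_drain] and of the initial pushes. *)
Definition cost_bound (n : nat) : nat :=
  steps_bound n * (100 * (steps_bound n * (2 * n + 6)) + 300) + (200 * n + 300).

Lemma cost_poly_bounded : poly_bounded cost_bound.
Proof.
have L := poly_bounded_add poly_bounded_id (poly_bounded_const 1).
have S : poly_bounded steps_bound.
  apply: poly_bounded_add; do ! apply: poly_bounded_mul => //;
    exact: poly_bounded_const.
apply: poly_bounded_add; first apply: poly_bounded_mul => //.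
  apply: poly_bounded_add; last exact: poly_bounded_const.
  apply: poly_bounded_mul; first exact: poly_bounded_const.
  apply: poly_bounded_mul => //; apply: poly_bounded_add; last exact: poly_bounded_const.
  by apply: poly_bounded_mul poly_bounded_id; apply: poly_bounded_const.
apply: poly_bounded_add; last exact: poly_bounded_const.
by apply: poly_bounded_mul poly_bounded_id; apply: poly_bounded_const.
Qed.

Lemma main_complete w : derivability_problem w ->
  exists2 n, n <= cost_bound (size w).+1 &
    exists st, exec main_prog n (init_store (option bool) 4 (rev w)) st.
Proof.
move=> [Pi [C [/andP[hPi hC] D wE]]]; rewrite init_mk.
have wC : size (encode_formula C) <= size w by rewrite wE /encode_sequent size_cat /=; lia.
have wPi : size (flatten (map encode_formula Pi)) <= size w.
  by rewrite wE /encode_sequent size_cat leq_addr.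
have ww : (weight Pi C).+2 <= (size w).+1 + 1.
  by have := weight_encode Pi C; rewrite -wE; lia.
have [m mn cyc] := derivable_provable D (admissible_encodes hPi wPi)
  (admissible_encode hC wC) ww.
have hl := run_loop (toks (rev w)) [::] cyc mn.
have [S hd] := run_drain Pi C; rewrite -wE in hd.
set S0 := mk _ _ _ _ _.
have h1 := run_push iT stop S0; rewrite {2}/S0 !mkE in h1; set S1 := mk _ _ _ _ _ in h1.
have h2 := run_push iU stop S1; rewrite {2}/S1 !mkE in h2; set S2 := mk _ _ _ _ _ in h2.
have h3 := run_push iV stop S2; rewrite {2}/S2 !mkE in h3.
have [n nc e] := run_seq h1 (run_seq h2 (run_seq h3 (run_seq hl hd))).
exists n; last by exists (cells S).
apply: leq_trans nc _; rewrite /cost_bound.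
have := leq_mul mn (leqnn (100 * (steps_bound (size w).+1 * (2 * (size w).+1 + 6)) + 300)).
have : m * (100 * (steps_bound (size w).+1 * (2 * size w + 6)) + 300) <=
  m * (100 * (steps_bound (size w).+1 * (2 * (size w).+1 + 6)) + 300).
  rewrite leq_mul2l leq_add2r leq_mul2l leq_mul2l; lia.
rewrite /steps_bound; lia.
Qed.

Theorem theorem6 :
  TM_decidable derivability_problem /\ in_NP derivability_problem.
Proof.
have [d hd] := cost_poly_bounded.
have [M hM] := prog_machine d None main_prog.
have aM w : accepts M w <-> derivability_problem w.
  have [_ sound complete] := hM w; split=> [/sound[n [st]]|dw].
    exact: main_sound.
  have [n nc [st e]] := main_complete dw; apply: complete e _.
  (* The base [(size w).+1] must exceed one, which holds as the code of a sequent is never empty. *)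
  apply: leq_ltn_trans nc (hd _ _); rewrite ltnS.
  have [Pi [C [_ _ ->]]] := dw; exact: leq_ltn_trans (weight_encode Pi C).
have haltM w : halts_within M w (size w + (size w).+1 ^ d) by have [] := hM w.
split; first by apply: (@halting_TM_decidable _ M) => // w; exists (size w + (size w).+1 ^ d).
exists M, ('X + ('X + 1) ^+ d)%R => w; split=> //.
have -> : (('X + ('X + 1) ^+ d).[size w])%R = size w + (size w).+1 ^ d.
  by rewrite hornerD hornerX horner_exp hornerD hornerX hornerC -addn1.
exact: haltM.
Qed.
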